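(* Let $\alpha_1,\alpha_2>0$ with $\alpha_1+\alpha_2>2$, let $\nu\in\mathbb R$ with $-\alpha_2<2\nu<\alpha_1$, and let $Y_1,Y_2$ be independent gamma random variables, $Y_i$ having shape $\alpha_i$ and rate $\alpha_i/\kappa_i$, $\kappa_i>0$; put $\zeta=\kappa_2/\kappa_1$. Let $\mathscr T_\nu$ be the estimator defined in the context. Then $\mathsf E\mathscr T_\nu^2<\infty$ and $$\mathsf E\mathscr T_\nu^2=\frac1{\kappa_1^2}\sum_{k=0}^\infty\sum_{\ell=0}^k\frac{g_{k,\ell}^2(\zeta,\nu)}{(\alpha_1)_\ell\,(\alpha_2)_{k-\ell}\,\ell!\,(k-\ell)!},$$ where $g_{n,\omega}(z,\nu)=n!\,(\omega+\nu)^{(n+1)}z^\nu\,\mathbf F(1,\omega+\nu+1;n+2;1-z)$. Additionally, $$\mathsf E\mathscr T_\nu^2=\frac{\nu^2\zeta^{2\nu}}{\kappa_1^2}\int_0^1\!\!\int_0^1 F\!\left(1+\nu,1+\nu;\alpha_1;\tfrac{(1-x)(1-y)}{(1-(1-\zeta)x)(1-(1-\zeta)y)}\right)F\bigl(1-\nu,1-\nu;\alpha_2;(1-x)(1-y)\bigr)\bigl((1-(1-\zeta)x)(1-(1-\zeta)y)\bigr)^{-\nu-1}dx\,dy .$$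
   Context: $(s)_w=\Gamma(s+w)/\Gamma(s)$; $(s)^{(n)}=\prod_{k=0}^{n-1}(s-k)$; $F={}_2F_1$ is the Gauss hypergeometric function and $\mathbf F(a,b;c;x)=F(a,b;c;x)/\Gamma(c)$ its regularized version. The estimator is $$\mathscr T_\nu=\frac{\alpha_1-1}{\alpha_1Y_1}\Bigl(F(1,2-\alpha_1;\alpha_2;-Z)-\frac{Z^\nu}{(\alpha_1-1)_{-\nu}(\alpha_2)_\nu}F(1,2-\alpha_1+\nu;\alpha_2+\nu;-Z)\Bigr),\qquad Z=\frac{\alpha_2Y_2}{\alpha_1Y_1},$$ removable singularities (e.g. at $\alpha_1=1$, where $(\alpha_1-1)\Gamma(\alpha_1-1)$ is read as $\Gamma(\alpha_1)$) being filled by continuity. *)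

(* Defs.v *)
From HB Require Import structures.
From mathcomp Require Import all_boot all_order all_algebra.
From mathcomp Require Import all_classical all_reals all_analysis.

Set Implicit Arguments.
Unset Strict Implicit.
Unset Printing Implicit Defensive.

Import Order.TTheory GRing.Theory Num.Theory.
Import numFieldNormedType.Exports.

Local Open Scope classical_set_scope.
Local Open Scope ring_scope.

Section SpecialFunctions.
Context {R : realType}.
Implicit Types a b c s w x z nu omega : R.

Definition rising s (n : nat) : R := \prod_(k < n) (s + k%:R).

(* (s)^{(n)} *)
Definition falling s (n : nat) : R := \prod_(k < n) (s - k%:R).

Definition Gamma_int s : R :=
  \int[lebesgue_measure]_(t in `]0, +oo[) (t `^ (s - 1) * expR (- t)).

(* The shift n = truncn (1 - s) is 0 for s > 0, and for s <= 0 it is the least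
   n with s + n > 0.  At the poles s = 0, -1, -2, ... the product vanishes, so
   that Gamma s = 0 there; since also 0^-1 = 0, (Gamma s)^-1 is the entire
   function 1/Gamma at every real s. *)
Definition Gamma s : R :=
  let n := Num.truncn (1 - s) in Gamma_int (s + n%:R) / rising s n.

(* (s)_w, for real w *)
Definition poch s w : R := Gamma (s + w) / Gamma s.

Definition real_analytic_at (f : R -> R) (x0 : R) : Prop :=
  exists (u : R^nat) (r : R), 0 < r /\
    forall x, `|x - x0| < r -> pseries u (x - x0) @ \oo --> f x.

Definition hyp2F1_coef a b c (n : nat) : R :=
  (rising a n * rising b n) / (rising c n * n`!%:R).

(* The Gauss series and its analytic continuation along ]-oo, 1[, which
   determine f on ]-oo, 1[; f is set to 0 on the cut [1, +oo[. *)
Definition is_hyp2F1 a b c (f : R -> R) : Prop :=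
  [/\ forall x, `|x| < 1 -> pseries (hyp2F1_coef a b c) x @ \oo --> f x,
      forall x, x < 1 -> real_analytic_at f x
    & forall x, 1 <= x -> f x = 0].

(* c is meant to be different from 0, -1, -2, ... *)
Definition hyp2F1 a b c : R -> R := xget (fun=> 0) [set f | is_hyp2F1 a b c f].

Definition hyp2F1_reg a b c x : R := hyp2F1 a b c x / Gamma c.

Definition g (n : nat) omega z nu : R :=
  n`!%:R * falling (omega + nu) n.+1 * z `^ nu *
  hyp2F1_reg 1 (omega + nu + 1) (n%:R + 2) (1 - z).

(* The factor (alpha1 - 1) is distributed over the difference, and
   (alpha1 - 1) / (alpha1 - 1)_{-nu} is written
   Gamma alpha1 / Gamma (alpha1 - 1 - nu); this fills in the removable
   singularity at alpha1 = 1.  At alpha1 - 1 - nu = 0 the quotient is 0, the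
   value given by continuity. *)
Definition estimator (alpha1 alpha2 nu y1 y2 : R) : R :=
  let Z := (alpha2 * y2) / (alpha1 * y1) in
  (alpha1 * y1)^-1 *
  ((alpha1 - 1) * hyp2F1 1 (2 - alpha1) alpha2 (- Z)
   - Gamma alpha1 / Gamma (alpha1 - 1 - nu) * (Z `^ nu / poch alpha2 nu)
     * hyp2F1 1 (2 - alpha1 + nu) (alpha2 + nu) (- Z)).

Definition gamma_pdf (shape rate x : R) : R :=
  if 0 < x
  then rate `^ shape / Gamma shape * x `^ (shape - 1) * expR (- (rate * x))
  else 0.

End SpecialFunctions.

Section Probability.
Context d (T : measurableType d) (R : realType) (P : probability T R).

Definition gamma_distributed (shape rate : R) (X : {RV P >-> R}) : Prop :=
  forall A : set R, measurable A ->
    distribution P X A =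
      (\int[lebesgue_measure]_(x in A) (gamma_pdf shape rate x)%:E)%E.

Definition independent_RVs (X Y : {RV P >-> R}) : Prop :=
  forall A B : set R, measurable A -> measurable B ->
    P (X @^-1` A `&` Y @^-1` B) = (P (X @^-1` A) * P (Y @^-1` B))%E.

End Probability.

(* Main.v *)
(* Let M be the law of (alpha1 Y1, alpha2 Y2), a product of two gamma laws of
   scales kappa1 and kappa2. For 0 <= r, s < 1 the normalized exponentials
     e_(r,s)(u) = (1-r)^-alpha1 (1-s)^-alpha2
                  exp(- r u1 / (kappa1 (1-r)) - s u2 / (kappa2 (1-s)))
   have the Gram kernel
     E[e_(r,s) e_(r',s')] = (1 - r r')^-alpha1 (1 - s s')^-alpha2
                          = sum_(l,m) (alpha1)_l (alpha2)_m / (l! m!) (r r')^l (s s')^m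
   and span a dense subspace of L^2(M). Hence, without orthogonal polynomials,
   if E[f e_(r,s)] = sum_(l,m) c_(l,m) r^l s^m then
   E[f^2] = sum_(l,m) c_(l,m)^2 l! m! / ((alpha1)_l (alpha2)_m).
   For the estimator, each of the two hypergeometric functions is a Stieltjes-like
   kernel with an explicit transform, and both transforms combine into
     E[T e_(r,s)] = ((zeta')^nu - 1) / (kappa1' (zeta' - 1)),
   where kappa1' = kappa1 (1-r), kappa2' = kappa2 (1-s), zeta' = kappa2' / kappa1'.
   Written as an integral over [0, 1] this expands with
     c_(l,m) = nu zeta^nu / kappa1 (1+nu)_l (1-nu)_m / (l! m!)
               int_0^1 (1-t)^(l+m) (1-(1-zeta)t)^(-l-nu-1) dt,
   which by Euler's integral is g_(l+m,l) up to sign and normalization. Squaring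
   the integral as a double integral and summing over l and m under it gives the
   second formula. *)
Require Import Defs.
From HB Require Import structures.
From mathcomp Require Import all_boot all_order all_algebra.
From mathcomp Require Import all_classical all_reals all_analysis.
From mathcomp Require Import measurable_realfun ring lra zify.
Set Implicit Arguments.
Unset Strict Implicit.
Unset Printing Implicit Defensive.
Import Order.TTheory GRing.Theory Num.Theory.
Import numFieldNormedType.Exports.
Local Open Scope classical_set_scope.
Local Open Scope ring_scope.

(** * Power series *)

(** The exponentials [e_(r,s)] are generating functions of products of Laguerre polynomials, so the
    [c_(l,m)] are Laguerre coefficients up to normalization. Three obstacles shape the proof. The
    closed form of the transform has a removable singularity where zeta' = 1, and its expansion
    under the integral needs r < min(1, zeta). Both are met by asking for the expansion only on
    short rays (rho x, rho) that avoid zeta' = 1; these still determine all coefficients. Next, for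
    alpha1 >= 2 neither hypergeometric term of the estimator is square integrable, only their
    difference is. The L^2 bound therefore needs asymptotics with a common leading term, whereas the
    transforms may be computed term by term, since each term is integrable against the exponentials.
    Finally, the Stieltjes transforms have exceptional parameters, where a logarithm appears or an
    auxiliary integral diverges; keeping the factor q - 1, which the coefficients of the estimator
    supply, covers them all. *)

Section DoubleSeries.
Context {R : realType}.
Implicit Types (A : nat -> nat -> R) (L : R^nat).

Lemma cvg_le_bound (u : R^nat) (l c : R) :
  u @ \oo --> l -> (\forall n \near \oo, u n <= c) -> l <= c.
Proof.
move=> ul uc; rewrite -(cvg_lim _ ul)//; apply: limr_le => //.
by apply/cvg_ex; exists l.
Qed.

Lemma ler_norm_sum2 A n (F : nat -> nat) (G : nat -> nat) :
  `|\sum_(0 <= k < n) \sum_(F k <= m < G k) A k m| <=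
  \sum_(0 <= k < n) \sum_(F k <= m < G k) `|A k m|.
Proof.
apply: le_trans (ler_norm_sum _ _ _) _.
by apply: ler_sum => k _; exact: ler_norm_sum.
Qed.

Lemma triangle_sum A n :
  \sum_(0 <= j < n) \sum_(0 <= k < j.+1) A k (j - k)%N =
  \sum_(0 <= k < n) \sum_(0 <= m < n - k) A k m.
Proof.
elim: n => [|n IH]; first by rewrite !big_geq.
rewrite big_nat_recr//= IH.
have -> : \sum_(0 <= k < n) \sum_(0 <= m < n - k) A k m =
    \sum_(0 <= k < n.+1) \sum_(0 <= m < n - k) A k m.
  by rewrite big_nat_recr//= subnn [X in _ + X]big_geq// addr0.
rewrite -big_split/=; apply: eq_big_nat => k /andP[_ kn].
by rewrite subSn// big_nat_recr.
Qed.

Lemma square_sum_mono A p q n : (forall k m, 0 <= A k m) ->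
  (p <= q)%N -> (forall k, (k < p)%N -> (p <= n k)%N) ->
  \sum_(0 <= k < p) \sum_(0 <= m < p) A k m <=
  \sum_(0 <= k < q) \sum_(0 <= m < n k) A k m.
Proof.
move=> A0 pq pn; rewrite (big_cat_nat (n := p) (p := q))//=.
rewrite -[leLHS]addr0 lerD//; last first.
  by apply: sumr_ge0 => k _; exact: sumr_ge0.
apply: ler_sum_nat => k /andP[_ kp].
rewrite (big_cat_nat (n := p) (p := n k))//= ?pn//.
by rewrite lerDl; exact: sumr_ge0.
Qed.

Lemma double_series_diag A L (B : R) :
  (forall n, \sum_(0 <= k < n) \sum_(0 <= m < n) `|A k m| <= B) ->
  (forall k, series (A k) @ \oo --> L k) ->
  exists2 S : R, series L @ \oo --> S &
    series (fun n => \sum_(0 <= k < n.+1) A k (n - k)%N) @ \oo --> S.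
Proof.
move=> AB AL.
pose T : R^nat := fun n => \sum_(0 <= k < n) \sum_(0 <= m < n) `|A k m|.
pose Q : R^nat := fun n => \sum_(0 <= k < n) \sum_(0 <= m < n) A k m.
have ndT : nondecreasing_seq T.
  by move=> p q pq; apply: square_sum_mono.
have cT : cvgn T.
  apply: nondecreasing_is_cvgn => //; exists B => _ [n _ <-]; exact: AB.
have TT : forall n, T n <= limn T by move=> n; exact: nondecreasing_cvgn_le.
have TnT : (fun n => limn T - T n) @ \oo --> (0 : R).
  by rewrite -[X in _ --> X](subrr (limn T)); apply: cvgB => //; exact: cvg_cst.
have strip (n p : nat) : (n <= p)%N ->
    \sum_(0 <= k < n) \sum_(n <= m < p) `|A k m| <= T p - T n.
  move=> np; rewrite lerBrDr -big_split/=.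
  apply: (@le_trans _ _ (\sum_(0 <= k < n) \sum_(0 <= m < p) `|A k m|)).
    apply: ler_sum => k _; rewrite [leRHS](big_cat_nat (n := n))//=.
    by rewrite addrC.
  rewrite /T [leRHS](big_cat_nat (n := n) (p := p))//= lerDl.
  by apply: sumr_ge0 => k _; exact: sumr_ge0.
have RQ n : `|series L n - Q n| <= limn T - T n.
  have h : (fun p => \sum_(0 <= k < n) series (A k) p - Q n) @ \oo -->
      series L n - Q n.
    apply: cvgB; last exact: cvg_cst.
    rewrite /series /=.
    by apply: cvg_big => [|i _]; [exact: add_continuous|exact: AL].
  apply: (cvg_le_bound (cvg_norm h)).
  near=> p; have np : (n <= p)%N by near: p; exact: nbhs_infty_ge.
  rewrite /= -sumrB.
  apply: (@le_trans _ _ (T p - T n)); last by rewrite lerB.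
  apply: le_trans (strip n p np).
  rewrite (eq_bigr (fun k => \sum_(n <= m < p) A k m)); last first.
    move=> k _; rewrite /series/= (big_cat_nat (n := n) (p := p))//=.
    by rewrite addrAC subrr add0r.
  exact: ler_norm_sum2.
(* The triangle of size [n] contains the square of size [n./2]. *)
have QD n : `|Q n - \sum_(0 <= k < n) \sum_(0 <= m < n - k) A k m|
    <= limn T - T n./2.
  rewrite /Q -sumrB (eq_bigr (fun k => \sum_(n - k <= m < n) A k m)); last first.
    move=> k _; rewrite (big_cat_nat (n := (n - k)%N) (p := n))//= ?leq_subr//.
    by rewrite addrAC subrr add0r.
  apply: le_trans (ler_norm_sum2 _ _ _ _) _.
  apply: (@le_trans _ _ (T n - \sum_(0 <= k < n) \sum_(0 <= m < n - k) `|A k m|)).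
    rewrite /T -sumrB; apply: ler_sum => k _.
    rewrite [X in _ <= X - _](big_cat_nat (n := (n - k)%N) (p := n))//= ?leq_subr//.
    by rewrite addrAC subrr add0r.
  apply: lerB => //; apply: square_sum_mono => //.
    by lia.
  by move=> k kn; lia.
have QT (m n : nat) : (m <= n)%N -> `|Q n - Q m| <= T n - T m.
  move=> mn; rewrite /Q /T.
  rewrite (big_cat_nat (n := m) (p := n))//= [in leRHS](big_cat_nat (n := m) (p := n))//=.
  rewrite addrAC -sumrB [in leRHS]addrAC -sumrB.
  apply: le_trans (ler_normD _ _) _; apply: lerD.
    rewrite (eq_bigr (fun k => \sum_(m <= j < n) A k j)); last first.
      move=> k _; rewrite (big_cat_nat (n := m) (p := n))//=.
      by rewrite addrAC subrr add0r.
    rewrite [leRHS](eq_bigr (fun k => \sum_(m <= j < n) `|A k j|)); last first.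
      move=> k _; rewrite (big_cat_nat (n := m) (p := n))//=.
      by rewrite addrAC subrr add0r.
    exact: ler_norm_sum2.
  apply: le_trans (ler_norm_sum _ _ _) _.
  by apply: ler_sum => k _; exact: ler_norm_sum.
(* By [QT] the sequence [T \+ Q] is monotone, so [Q] is a difference of two bounded monotone
   sequences. *)
have cQ : cvgn Q.
  have cTQ : cvgn (T \+ Q).
    apply: nondecreasing_is_cvgn.
      move=> m n mn /=; have := QT _ _ mn; rewrite ler_norml => /andP[+ _].
      by lra.
    exists (B + B) => _ [n _ <-] /=; apply: lerD; first exact: AB.
    apply: le_trans (AB n); apply: le_trans (ler_norm _) _.
    exact: ler_norm_sum2.
  have -> : Q = (T \+ Q) \- T by apply/funext => n /=; rewrite addrC addKr.
  exact: is_cvgB.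
exists (limn Q).
  apply: (@cvg_sub0 _ _ _ _ _ _ Q) => //.
  apply: norm_cvg0; apply: (squeeze_cvgr _ (cvg_cst (0 : R)) TnT).
  near=> n; rewrite normr_ge0/=; exact: RQ.
have -> : series (fun n => \sum_(0 <= k < n.+1) A k (n - k)%N) =
   (fun n => \sum_(0 <= k < n) \sum_(0 <= m < n - k) A k m).
  apply/funext => n; exact: triangle_sum.
have TnT2 : (fun n => limn T - T n./2) @ \oo --> (0 : R).
  apply: cvg_comp TnT.
  move=> X [N _ NX]; exists N.*2 => // n /= Nn; apply: NX => /=.
  by rewrite -(doubleK N); exact: half_leq.
apply: (@cvg_sub0 _ _ _ _ _ _ Q) => //.
apply: norm_cvg0; apply: (squeeze_cvgr _ (cvg_cst (0 : R)) TnT2).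
near=> n; rewrite normr_ge0/=; rewrite -normrN opprB; exact: QD.
Unshelve. all: by end_near. Qed.

End DoubleSeries.

Section PowerSeries.
Context {R : realType}.
Implicit Types (u : R^nat) (f : R -> R) (r x y z e : R).

Definition pser_cv u (r : R) f := forall x, `|x| < r -> pseries u x @ \oo --> f x.

Lemma pser_cv_normed u r f x : pser_cv u r f -> `|x| < r ->
  cvgn (pseries (fun n => `|u n|) `|x|).
Proof.
move=> uf xr; have [y xy yr] : exists2 y : R, `|x| < y & y < r.
  by exists ((`|x| + r) / 2); lra.
have y0 : 0 < y by rewrite (le_lt_trans _ xy).
apply: (@is_cvg_pseries_inside_norm _ u y).
  by apply/cvg_ex; exists (f y); apply: uf; rewrite gtr0_norm.
by rewrite normr_id (gtr0_norm y0).
Qed.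

(** Comparison with the series at w = |x|: factoring w^(n+1) - |z|^(n+1) gives (n+1) |z|^n (w - |z|)
    <= w^(n+1) for |z| < w, so differentiation does not shrink the disc. *)
Lemma is_cvg_pseries_diffs u (x z : R) :
  cvgn (pseries (fun n => `|u n|) `|x|) -> `|z| < `|x| ->
  cvgn (pseries (pseries_diffs u) z).
Proof.
move=> cx zx; set w := `|x| in cx zx *.
have wz : 0 < w - `|z| by lra.
apply: normed_cvg.
have -> : [normed series (fun i => pseries_diffs u i * z ^+ i)] =
  series (fun i => `|pseries_diffs u i * z ^+ i|) by [].
apply: (@series_le_cvg _ _ (fun i => (w - `|z|)^-1 * (`|u i.+1| * w ^+ i.+1))).
- by move=> n; exact: normr_ge0.
- by move=> n; rewrite mulr_ge0 ?invr_ge0 ?(ltW wz)// mulr_ge0// exprn_ge0// /w.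
- move=> n; rewrite ler_pdivlMl// /pseries_diffs !normrM normr_nat normrX.
  have -> : (w - `|z|) * (n.+1%:R * `|u n.+1| * `|z| ^+ n) =
     `|u n.+1| * (n.+1%:R * (`|z| ^+ n * (w - `|z|))) by ring.
  rewrite ler_wpM2l//.
  apply: (@le_trans _ _ (w ^+ n.+1 - `|z| ^+ n.+1)); last by rewrite gerBl exprn_ge0.
  rewrite subrXX mulrA [leRHS]mulrC ler_wpM2r ?(ltW wz)//.
  rewrite mulr_natl -[X in _ *+ X]card_ord -sumr_const; apply: ler_sum => i _.
  rewrite -[in leLHS](subnK (ltn_ord i : (i <= n)%N)) exprD.
  rewrite ler_wpM2r ?exprn_ge0//; apply: lerXn2r; rewrite ?nnegrE /w//; exact: ltW.
- apply: is_cvg_seriesZ.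
  move: cx; rewrite /pseries -(is_cvg_series_restrict 1) => /cvg_ex[l cl].
  rewrite -cvg_shiftS in cl; apply/cvg_ex; exists l.
  have -> // : series (fun i => `|u i.+1| * w ^+ i.+1) =
      (fun n => \sum_(1 <= k < n.+1) `|u k| * w ^+ k).
  by apply/funext => n; rewrite /series/= big_add1.
Qed.

Lemma pser_cv_diffs u r f : pser_cv u r f ->
  pser_cv (pseries_diffs u) r (fun x => limn (pseries (pseries_diffs u) x)).
Proof.
move=> uf x xr.
have [y xy yr] : exists2 y : R, `|x| < y & y < r by exists ((`|x| + r) / 2); lra.
have y0 : 0 < y by rewrite (le_lt_trans _ xy).
apply: (@is_cvg_pseries_diffs u y); rewrite ?(gtr0_norm y0)//.
have := @pser_cv_normed u r f y uf; rewrite (gtr0_norm y0); exact.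
Qed.

Lemma open_norm_lt r x : `|x| < r -> \forall y \near x, `|y| < r.
Proof.
move=> xr; exists (r - `|x|) => /=; first lra.
move=> y /=; have := ler_normB x y; have := ler_normD (x - y) (- x).
by rewrite addrAC subrr sub0r !normrN; lra.
Qed.

Lemma pser_cv_is_derive u r f x : pser_cv u r f -> `|x| < r ->
  is_derive x (1 : R) f (limn (pseries (pseries_diffs u) x)).
Proof.
move=> uf xr.
have [y xy yr] : exists2 y : R, `|x| < y & y < r by exists ((`|x| + r) / 2); lra.
have y0 : 0 < y by rewrite (le_lt_trans _ xy).
have yr' : `|y| < r by rewrite gtr0_norm.
apply: (@near_eq_is_derive _ _ _ (fun x => limn (pseries u x))).
  near=> z; apply: cvg_lim => //; apply: uf.
  by near: z; apply: (@open_norm_lt r x).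
apply: (@pseries_snd_diffs _ _ y); last by rewrite (gtr0_norm y0).
- by apply/cvg_ex; exists (f y); exact: uf.
- by apply/cvg_ex; eexists; exact: (pser_cv_diffs uf).
- by apply/cvg_ex; eexists; exact: (pser_cv_diffs (pser_cv_diffs uf)).
Unshelve. all: by end_near. Qed.

Lemma pser_cv_continuous u r f x : pser_cv u r f -> `|x| < r -> {for x, continuous f}.
Proof.
move=> uf xr; have [] := pser_cv_is_derive uf xr => + _.
by move/derivable1_diffP/differentiable_continuous.
Qed.

Lemma pser_cv0 u r f : 0 < r -> pser_cv u r f -> u 0%N = f 0.
Proof.
move=> r0 uf; have := uf 0; rewrite normr0 => /(_ r0) h.
apply/esym; rewrite -(cvg_lim _ h)//; apply: cvg_lim => //.
apply: cvg_near_cst; near=> n.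
have n0 : (0 < n)%N by near: n; exact: nbhs_infty_gt.
rewrite /pseries /series /= -(prednK n0) big_nat_recl//= expr0 mulr1.
by rewrite big1 ?addr0// => i _; rewrite expr0n mulr0.
Unshelve. all: by end_near. Qed.

Lemma pser_cv_shift u r f k : 0 < r -> pser_cv u r f ->
  (forall j, (j < k)%N -> u j = 0) ->
  exists2 h : R -> R, pser_cv (fun n => u (n + k)%N) r h &
    forall x, `|x| < r -> f x = x ^+ k * h x.
Proof.
move=> r0 uf u0; pose v n := u (n + k)%N.
have key x : series (fun i => u i * x ^+ i) \o addn k = (fun n => x ^+ k * pseries v x n).
  apply/funext => n /=; rewrite addnC series_addn /series /=.
  rewrite big1_seq ?add0r; last first.
    by move=> i /andP[_]; rewrite mem_index_iota => /andP[_ ik]; rewrite u0// mul0r.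
  rewrite -{1}[k]add0n big_addn addnK /pseries /series/= mulr_sumr.
  by apply: eq_bigr => i _; rewrite exprD /v; ring.
have cu x : `|x| < r -> (fun n => x ^+ k * pseries v x n) @ \oo --> f x.
  move=> xr; rewrite -key; apply: cvg_comp (uf _ xr).
  by move=> X [N _ NX]; exists N => // n /= Nn; apply: NX => /=; rewrite (leq_trans Nn)// leq_addl.
have cv x : `|x| < r -> x != 0 -> pseries v x @ \oo --> x ^- k * f x.
  move=> xr x0; have -> : pseries v x = (fun n => x ^- k * (x ^+ k * pseries v x n)).
    by apply/funext => n; rewrite mulKf// expf_neq0.
  by apply: cvgMr => //; exact: cu.
have cv' x : `|x| < r -> cvgn (pseries v x).
  move=> xr; pose y := (`|x| + r) / 2.
  have y0 : 0 < y by rewrite /y; have := normr_ge0 x; lra.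
  apply: (@is_cvg_pseries_inside _ _ y); last by rewrite (gtr0_norm y0) /y; lra.
  apply/cvg_ex; exists (y ^- k * f y); apply: cv; last by rewrite gt_eqF.
  by rewrite (gtr0_norm y0) /y; lra.
exists (fun x => limn (pseries v x)) => [x xr|x xr]; first exact: cv'.
apply/esym; rewrite -(cvg_lim _ (cu x xr))//; apply/esym/cvg_lim => //.
by apply: cvgMr => //; exact: cv'.
Qed.

(** Once the coefficients before the k-th vanish, [f] is [x ^+ k] times a function that is zero at
    the given points, hence at 0 by continuity; its value at 0 is [u k]. *)
Lemma pser_cv_eq0 u r f : 0 < r -> pser_cv u r f ->
  (forall e, 0 < e -> exists x, [/\ x != 0, `|x| < e & f x = 0]) ->
  forall n, u n = 0.
Proof.
move=> r0 uf f0; elim/ltn_ind => k IH.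
have [h hk fh] := pser_cv_shift r0 uf IH.
rewrite -[k in LHS]add0n (pser_cv0 r0 hk).
have ch : h x @[x --> 0] --> h 0.
  by apply: pser_cv_continuous hk _; rewrite normr0.
apply/eqP; rewrite -normr_eq0 eq_le normr_ge0 andbT; apply/ler_addgt0Pl => e e0.
rewrite addr0.
move/cvgrPdist_lt : ch => /(_ _ e0)[d /= d0 dh].
have [x [x0 xd fx]] := f0 (Num.min r d) ltac:(by rewrite lt_min r0).
move: xd; rewrite lt_min => /andP[xr xd].
have hx : h x = 0.
  have /eqP := fh _ xr; rewrite fx eq_sym mulf_eq0 expf_eq0 (negbTE x0) andbF /=.
  by move/eqP.
have := dh x; rewrite /ball/= sub0r normrN hx subr0 => /(_ xd) /ltW.
exact.
Qed.

End PowerSeries.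

(** * The identity theorem for real analytic functions *)

Section Identity.
Context {R : realType}.
Implicit Types (u : R^nat) (f g : R -> R) (p q r x y z e : R).

Lemma real_analytic_atP f x0 : real_analytic_at f x0 <->
  exists u r, 0 < r /\ pser_cv u r (fun h => f (x0 + h)).
Proof.
split=> -[u [r [r0 uf]]]; exists u, r; split => //.
  by move=> h hr; have := uf (x0 + h); rewrite addrAC subrr add0r; exact.
by move=> x xr; have := uf (x - x0) xr; rewrite subrKC.
Qed.

Lemma real_analytic_at_continuous f x : real_analytic_at f x -> {for x, continuous f}.
Proof.
move=> /real_analytic_atP[u [r [r0 uf]]].
have h : (fun h => f (x + h)) y @[y --> 0] --> f x.
  rewrite -[X in _ --> f X]addr0; apply: (pser_cv_continuous uf).
  by rewrite normr0.
have -> : f = (fun h => f (x + h)) \o (fun y => y - x).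
  by apply/funext => y /=; rewrite subrKC.
rewrite /prop_for /continuous_at /= subrr addr0.
have c : (fun y => y - x) y @[y --> x] --> (0 : R).
  have -> : (0 : R) = x - x by rewrite subrr.
  by apply: cvgB; [exact: cvg_id|exact: cvg_cst].
by move=> A /h hA; exact: (c _ hA).
Qed.

Lemma near_real_analytic_at f g x : {near x, f =1 g} ->
  real_analytic_at f x -> real_analytic_at g x.
Proof.
move=> [e /= e0 fg] [u [r [r0 uf]]]; exists u, (Num.min r e); split.
  by rewrite lt_min r0.
move=> y; rewrite lt_min => /andP[yr ye].
by rewrite -fg//=; [exact: uf|rewrite distrC].
Qed.

Lemma real_analytic_eq_near f g x :
  real_analytic_at f x -> real_analytic_at g x ->
  (forall e, 0 < e -> exists y, [/\ y != x, `|y - x| < e & f y = g y]) ->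
  {near x, f =1 g}.
Proof.
move=> /real_analytic_atP[u [r [r0 uf]]] /real_analytic_atP[v [s [s0 vg]]] fg.
have t0 : 0 < Num.min r s by rewrite lt_min r0.
have uv : pser_cv (fun n => u n - v n) (Num.min r s) (fun h => f (x + h) - g (x + h)).
  move=> h; rewrite lt_min => /andP[hr hs].
  have -> : pseries (fun n => u n - v n) h = pseries u h \- pseries v h.
    apply/funext => n; rewrite /pseries /series /= -sumrB.
    by apply: eq_bigr => i _; rewrite mulrBl.
  by apply: cvgB; [exact: uf|exact: vg].
have uv0 : forall n, u n - v n = 0.
  apply: (pser_cv_eq0 t0 uv) => e e0; have [y [yx ye fgy]] := fg e e0.
  exists (y - x); rewrite subr_eq0; split => //.
  by rewrite subrKC fgy subrr.
exists (Num.min r s) => // y; rewrite /ball_/= distrC => yt.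
have h := uv _ yt; rewrite subrKC in h.
apply/eqP; rewrite -subr_eq0; apply/eqP; rewrite -(cvg_lim _ h)//.
apply: cvg_lim => //; apply: cvg_near_cst; near=> n.
by rewrite /pseries/series/= big1// => i _; rewrite uv0 ?mul0r.
Unshelve. all: by end_near. Qed.

(** The points near which [f] and [g] agree form an open set. It is also closed in the interval,
    since at a limit point outside it points of agreement accumulate and [real_analytic_eq_near]
    applies. Connectedness does the rest. *)
Lemma real_analytic_eq p q x0 f g : p < x0 < q ->
  (forall x, p < x < q -> real_analytic_at f x) ->
  (forall x, p < x < q -> real_analytic_at g x) ->
  {near x0, f =1 g} -> forall x, p < x < q -> f x = g x.
Proof.
move=> x0pq af ag fgx0.
pose I := [set x : R | p < x < q].
pose B := [set x | I x /\ {near x, f =1 g}].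
have cI : connected I.
  apply/connected_intervalP => x y /= /andP[px xq] /andP[py yq] z /andP[xz zy].
  by rewrite /I /= (lt_le_trans px xz) (le_lt_trans zy yq).
have BI : B = I.
  apply: cI.
  - by exists x0.
  - by exists (interior [set x | f x = g x]) => //; exact: open_interior.
  - exists (closure B); first exact: closed_closure.
    apply/seteqP; split => x; first by move=> Bx; split; [case: Bx|exact: subset_closure].
    move=> [Ix cBx]; split => //.
    have [Bx|nBx] := pselect (B x); first by case: Bx.
    apply: real_analytic_eq_near; [exact: af|exact: ag|] => e e0.
    have [y [By /= yxe]] := cBx _ (nbhsx_ballx x e e0).
    exists y; split; last by case: By => _ /nbhs_singleton.
      by apply/eqP => yx; apply: nBx; rewrite -yx.
    by rewrite distrC.
move=> x Ix; have : B x by rewrite BI.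
by case=> _ /nbhs_singleton.
Qed.

End Identity.

(** * Rising factorials and the Chu-Vandermonde sum *)

Section Rising.
Context {R : realType}.
Implicit Types (s a b c d x : R) (n m k : nat).

Lemma rising0 s : rising s 0 = 1.
Proof. by rewrite /rising big_ord0. Qed.

Lemma risingS s n : rising s n.+1 = rising s n * (s + n%:R).
Proof. by rewrite /rising big_ord_recr. Qed.

Lemma risingSl s n : rising s n.+1 = s * rising (s + 1) n.
Proof.
rewrite /rising big_ord_recl addr0; congr (_ * _).
by apply: eq_bigr => i _; rewrite lift0 -natr1 addrA addrAC.
Qed.

Lemma risingD s k m : rising s (k + m) = rising s k * rising (s + k%:R) m.
Proof.
elim: m => [|m IH]; first by rewrite addn0 rising0 mulr1.
by rewrite addnS !risingS IH natrD addrA mulrA.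
Qed.

Lemma rising_gt0 s n : 0 < s -> 0 < rising s n.
Proof. by move=> s0; apply: prodr_gt0 => i _; rewrite ltr_pwDl. Qed.

Lemma rising_neq0 s n : 0 < s -> rising s n != 0.
Proof. by move=> s0; rewrite gt_eqF// rising_gt0. Qed.

Lemma rising1 n : rising 1 n = n`!%:R :> R.
Proof.
elim: n => [|n IH]; first by rewrite rising0.
by rewrite risingS IH factS natrM nat1r mulrC.
Qed.

Lemma ler_norm_rising s n : `|rising s n| <= rising `|s| n.
Proof.
rewrite /rising normr_prod; apply: ler_prod => i _; rewrite normr_ge0/=.
by apply: le_trans (ler_normD _ _) _; rewrite normr_nat.
Qed.

Lemma rising_ge0 s n : 0 <= s -> 0 <= rising s n.
Proof. by move=> s0; apply: prodr_ge0 => i _; rewrite addr_ge0. Qed.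

Lemma ler_rising s t n : 0 <= s -> s <= t -> rising s n <= rising t n.
Proof.
by move=> s0 st; apply: ler_prod => i _; rewrite addr_ge0//= lerD2r.
Qed.

(** Written without denominators, so that no parameter is exceptional. By Pascal's rule the sum for
    [n.+1] is [c + n] times the sum for [n] minus [d] times the sum at [(c + 1, d + 1)], and both of
    these have the same value because [c - d] is unchanged. *)
Lemma chu_vandermonde c d n :
  \sum_(0 <= k < n.+1) 'C(n, k)%:R * (-1) ^+ k * rising d k * rising (c + k%:R) (n - k)
  = rising (c - d) n.
Proof.
elim: n c d => [|n IH] c d.
  by rewrite big_nat1 bin0 !rising0 expr0 !mulr1.
have step : \sum_(0 <= k < n.+2) 'C(n.+1, k)%:R * (-1) ^+ k * rising d k *
      rising (c + k%:R) (n.+1 - k) =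
    (c + n%:R) * rising (c - d) n - d * rising (c - d) n.
  have -> : d * rising (c - d) n = d * rising ((c + 1) - (d + 1)) n.
    by congr (_ * rising _ _); ring.
  rewrite -!IH !mulr_sumr big_nat_recl//=.
  rewrite (eq_big_nat _ _ (F2 := fun k => 'C(n, k.+1)%:R * (-1) ^+ k.+1 *
     rising d k.+1 * rising (c + k.+1%:R) (n - k) - 
     d * ('C(n, k)%:R * (-1) ^+ k * rising (d + 1) k * rising (c + 1 + k%:R) (n - k)))).
    rewrite big_split/= sumrN addrA; congr (_ - _).
    rewrite big_nat_recr//= (bin_small (ltnSn n)) mulr0n !mul0r addr0.
    rewrite [RHS]big_nat_recl//=.
    rewrite bin0 !rising0 expr0 !mul1r subn0 addr0 bin0 !mul1r; congr (_ + _).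
      by rewrite addr0 subn0 risingS mulrC.
    apply: eq_big_nat => k /andP[_ kn].
    rewrite -[(n - k)%N]prednK ?subn_gt0// -subnS (risingS _ (n - k.+1)).
    have -> : c + k.+1%:R + (n - k.+1)%:R = c + n%:R :> R.
      by rewrite -addrA -natrD subnKC.
    ring.
  move=> k /andP[_ kn]; rewrite binS natrD subSS risingSl exprS.
  have -> : c + 1 + k%:R = c + k.+1%:R :> R by rewrite -natr1; ring.
  ring.
rewrite step risingS; ring.
Qed.

End Rising.

(** * Convergence of the Gauss series and the binomial series *)

Section Binomial.
Context {R : realType}.
Implicit Types (s a b c d x : R) (u : R^nat) (n m k : nat).

Lemma is_cvg_series_ratio u (q : R) N : 0 <= q < 1 ->
  (forall n, (N <= n)%N -> `|u n.+1| <= q * `|u n|) ->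
  cvgn (series (fun n => `|u n|)).
Proof.
move=> /andP[q0 q1] uq.
have uN n : `|u (n + N)%N| <= `|u N| * q ^+ n.
  elim: n => [|n IH]; first by rewrite add0n expr0 mulr1.
  rewrite addSn (le_trans (uq _ _)) ?leq_addl// exprS mulrCA.
  by rewrite ler_wpM2l.
rewrite -(is_cvg_series_restrict N).
have h : cvgn (series (fun n => `|u (n + N)%N|)).
  apply: (@series_le_cvg _ _ (fun n => `|u N| * q ^+ n)) => //.
    by move=> n; rewrite mulr_ge0// exprn_ge0.
  by apply: is_cvg_geometric_series; rewrite ger0_norm.
move/cvg_ex : h => [l hl]; apply/cvg_ex; exists l.
rewrite -(cvg_shiftn N).
have -> // : (fun n => \sum_(N <= k < n + N) `|u k|) = series (fun n => `|u (n + N)%N|).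
by apply/funext => n; rewrite -{1}[N]add0n big_addn addnK.
Qed.

Lemma hyp2F1_coefS a b c n : 0 < c ->
  hyp2F1_coef a b c n.+1 = hyp2F1_coef a b c n * 
    ((a + n%:R) * (b + n%:R) / ((c + n%:R) * n.+1%:R)).
Proof.
move=> c0; rewrite /hyp2F1_coef !risingS factS natrM.
have h1 := rising_neq0 n c0.
have h2 : n`!%:R != 0 :> R by rewrite pnatr_eq0 -lt0n fact_gt0.
have h3 : c + n%:R != 0 by rewrite gt_eqF// ltr_pwDl.
have h4 : n.+1%:R != 0 :> R by rewrite pnatr_eq0.
by rewrite -!mulf_div; field; do !(apply/andP; split).
Qed.

Lemma norm_addn_le a (e : R) : 0 < e ->
  exists N, forall n, (N <= n)%N -> `|a + n%:R| <= (1 + e) * n%:R.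
Proof.
move=> e0; exists (Num.truncn (`|a| / e)).+1 => n Nn.
rewrite (le_trans (ler_normD _ _))// normr_nat mulrDl mul1r addrC lerD2l.
rewrite mulrC -ler_pdivrMr//; apply: ltW.
apply: lt_le_trans (_ : (Num.truncn (`|a| / e)).+1%:R <= n%:R); last by rewrite ler_nat.
exact: truncnS_gt.
Qed.

Lemma cvg_hyp2F1_coef_normed a b c x : 0 < c -> `|x| < 1 ->
  cvgn (pseries (fun n => `|hyp2F1_coef a b c n|) `|x|).
Proof.
move=> c0 x1.
have x0 := normr_ge0 x.
(* Small enough for the ratio bound (1 + e)^2 |x| to stay below 1. *)
pose e := (1 - `|x|) / 3; have e0 : 0 < e by rewrite /e; lra.
have [N1 h1] := norm_addn_le a e0.
have [N2 h2] := norm_addn_le b e0.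
have -> : pseries (fun n => `|hyp2F1_coef a b c n|) `|x| =
   series (fun n => `|hyp2F1_coef a b c n * x ^+ n|).
  by apply/funext => n; apply: eq_bigr => i _; rewrite normrM normrX.
apply: (@is_cvg_series_ratio _ ((1 + e) ^+ 2 * `|x|) (maxn 1 (maxn N1 N2))).
  apply/andP; split; first by rewrite mulr_ge0// exprn_ge0// addr_ge0// ltW.
  by rewrite /e; nra.
move=> n; rewrite !geq_max => /and3P[n0 n1 n2].
have nn0 : 0 < n%:R :> R by rewrite ltr0n.
rewrite hyp2F1_coefS// exprS; set D := _ / _.
have -> : hyp2F1_coef a b c n * D * (x * x ^+ n) =
  D * x * (hyp2F1_coef a b c n * x ^+ n) by ring.
rewrite (normrM (D * x)) ler_wpM2r// normrM ler_wpM2r// /D.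
have d0 : 0 < (c + n%:R) * n.+1%:R by rewrite mulr_gt0// ltr_pwDl.
rewrite normrM normfV (gtr0_norm d0) ler_pdivrMr// normrM.
apply: le_trans (_ : (1 + e) * n%:R * ((1 + e) * n%:R) <= _).
  by apply: ler_pM => //; [exact: h1|exact: h2].
rewrite (_ : _ * _ * _ = (1 + e) ^+ 2 * (n%:R * n%:R)); last by ring.
rewrite ler_wpM2l ?exprn_ge0 ?addr_ge0 ?(ltW e0)//.
by apply: ler_pM => //; [rewrite lerDr ltW|rewrite ler_nat].
Qed.

Lemma pser_cv_hyp2F1_coef a b c : 0 < c ->
  pser_cv (hyp2F1_coef a b c) 1 (fun x => limn (pseries (hyp2F1_coef a b c) x)).
Proof.
move=> c0 x x1; have h := @cvg_hyp2F1_coef_normed a b c x c0 x1.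
 apply: normed_cvg.
have -> // : [normed series (fun n => hyp2F1_coef a b c n * x ^+ n)] =
  pseries (fun n => `|hyp2F1_coef a b c n|) `|x|.
by apply/funext => n; apply: eq_bigr => i _ /=; rewrite normrM normrX.
Qed.

(** Euler's operator x d/dx on coefficients; with it a linear recurrence for the coefficients
    becomes a differential equation for the sum. *)
Lemma pser_cv_theta u (r : R) f : pser_cv u r f ->
  pser_cv (fun n => n%:R * u n) r (fun x => x * limn (pseries (pseries_diffs u) x)).
Proof.
move=> uf x xr; rewrite -cvg_shiftS.
have -> : (fun n => pseries (fun n => n%:R * u n) x n.+1) = 
   (fun n => x * pseries (pseries_diffs u) x n).
  apply/funext => n; rewrite /pseries /series /= big_nat_recl//= mul0r mul0r add0r mulr_sumr.
  by apply: eq_bigr => i _; rewrite exprS /pseries_diffs; ring.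
by apply: cvgMl_tmp; apply: (pser_cv_diffs uf).
Qed.

Lemma is_derive_powR a x : 0 < x -> is_derive x (1 : R) (fun y => y `^ a) (a * x `^ (a - 1)).
Proof.
move=> x0; have := @powR_derive1 R a x; rewrite in_itv/= x0 => /(_ isT) <-.
by rewrite derive1E; apply: derivableP; apply: derivable_powR; rewrite in_itv/= x0.
Qed.

Lemma is_derive_cB (c x : R) : is_derive x (1 : R) (fun y => c - y) (-1).
Proof.
have -> : (fun y => c - y) = cst c - id by [].
by apply: is_derive_eq; rewrite sub0r.
Qed.

Lemma powR_split a x : 0 < x -> x * x `^ (a - 1) = x `^ a.
Proof.
move=> x0; rewrite -{1}(powRr1 (ltW x0)) -powRD; last by rewrite (gt_eqF x0) implybT.
by rewrite addrC subrK.
Qed.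

Lemma derive0_eq (p q : R) (f : R -> R) x y :
  (forall z, p < z < q -> is_derive z (1 : R) f 0) ->
  p < x < q -> p < y < q -> f x = f y.
Proof.
move=> df; wlog xy : x y / x < y.
  move=> H xpq ypq; case: (ltgtP x y) => [|/H|->//] h; first exact: H.
  by rewrite h.
move=> /andP[px xq] /andP[py yq].
have [||c] := @MVT _ f (fun=> 0) x y xy.
- by move=> z; rewrite in_itv/= => /andP[xz zy]; apply: df; rewrite (lt_trans px) ?(lt_trans zy).
- apply: derivable_within_continuous => z; rewrite in_itv/= => /andP[xz zy].
  by have [] := df z; rewrite ?(lt_le_trans px) ?(le_lt_trans zy)//.
by rewrite mul0r => _ /eqP; rewrite subr_eq0 eq_sym => /eqP.
Qed.

(** As the Gauss series of F(a, 1; 1; x) it converges on the unit disc. The recurrence [u1] says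
    that the sum satisfies (1 - x) F' = a F, so the derivative of F (1 - x)^a is zero. *)
Lemma pser_cv_binomial a :
  pser_cv (fun n => rising a n / n`!%:R) 1 (fun x => (1 - x) `^ (- a)).
Proof.
set u : R^nat := fun n => _.
have uE : hyp2F1_coef a 1 1 = u.
  apply/funext => n; rewrite /hyp2F1_coef rising1 /u -mulf_div divff ?mulr1//.
have := @pser_cv_hyp2F1_coef a 1 1 ltr01; rewrite uE.
set F := (fun x => limn _) => uF.
have dF := pser_cv_is_derive uF.
have u1 n : n.+1%:R * u n.+1 = (a + n%:R) * u n.
  rewrite /u risingS factS natrM.
  have h2 : n`!%:R != 0 :> R by rewrite pnatr_eq0 -lt0n fact_gt0.
  have h4 : n.+1%:R != 0 :> R by rewrite pnatr_eq0.
  have aux (x y z w : R) : y != 0 -> z != 0 -> y * (x * w / (y * z)) = w * (x / z).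
    by move=> y0 z0; field; rewrite y0 z0.
  exact: aux.
have ode x : `|x| < 1 -> (1 - x) * limn (pseries (pseries_diffs u) x) = a * F x.
  move=> x1; rewrite mulrBl mul1r.
  have h1 : (pseries (pseries_diffs u) x \- pseries (fun n => n%:R * u n) x) @ \oo -->
      limn (pseries (pseries_diffs u) x) - x * limn (pseries (pseries_diffs u) x).
    by apply: cvgB; [exact: (pser_cv_diffs uF)|exact: (pser_cv_theta uF)].
  have h2 : (fun n => a * pseries u x n) @ \oo --> a * F x.
    by apply: cvgMl_tmp; exact: uF.
  rewrite -(cvg_lim _ h1)// -(cvg_lim _ h2)//; congr (limn _).
  apply/funext => n; rewrite /pseries /series/= mulr_sumr -sumrB.
  by apply: eq_bigr => i _; rewrite /pseries_diffs u1; ring.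
have dG x : `|x| < 1 -> is_derive x (1 : R) (fun y => F y * (1 - y) `^ a) 0.
  move=> x1; have x10 : 0 < 1 - x by have := ler_norm x; lra.
  have d1 := dF _ x1.
  have d2 : is_derive x (1:R) (fun y : R => 1 - y) (-1).
    exact: is_derive_cB.
  have d3 := @is_derive1_comp _ (fun y => y `^ a) (fun y => 1 - y) x _ _ (is_derive_powR a x10) d2.
  apply: (is_derive_eq (is_deriveM d1 d3)); rewrite /GRing.scale /=.
  rewrite -(powR_split a x10).
  have := ode _ x1; set F' := limn _; set P := _ `^ _ => o.
  by rewrite (_ : _ + _ = P * ((1 - x) * F' - a * F x)); [rewrite o subrr mulr0|ring].
move=> x x1; have x10 : 0 < 1 - x by have := ler_norm x; lra.
suff <- : F x = (1 - x) `^ (- a) by exact: uF.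
have : F x * (1 - x) `^ a = F 0 * (1 - 0) `^ a.
  apply: (@derive0_eq (-1) 1 (fun y => F y * (1 - y) `^ a)) => [z zz||].
  - by apply: dG; rewrite ltr_norml.
  - by rewrite -ltr_norml.
  - by rewrite ltrN10 ltr01.
rewrite -(pser_cv0 ltr01 uF) /u rising0 subr0 powR1 fact0 invr1 !mulr1 => h.
have P0 : (1 - x) `^ a != 0 by rewrite gt_eqF// powR_gt0.
by apply: (mulIf P0); rewrite h powRN mulVf.
Qed.

End Binomial.

(** * Recentering power series and Pfaff's transformation *)

Section Recenter.
Context {R : realType}.
Implicit Types (u : R^nat) (f : R -> R) (a b c x y h r : R) (A : nat -> nat -> R).

Lemma ler_eq x y : x = y -> x <= y.
Proof. by move=> ->. Qed.

Lemma square_le_triangle A (B : R) :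
  (forall n, \sum_(0 <= j < n) \sum_(0 <= k < j.+1) `|A k (j - k)%N| <= B) ->
  forall n, \sum_(0 <= k < n) \sum_(0 <= m < n) `|A k m| <= B.
Proof.
move=> AB n; apply: le_trans (AB n.*2).
rewrite (triangle_sum (fun k m => `|A k m|)).
by apply: square_sum_mono => // [|k kn]; lia.
Qed.

Lemma row_cvg A (B : R) :
  (forall n, \sum_(0 <= k < n) \sum_(0 <= m < n) `|A k m| <= B) ->
  forall k, cvgn (series (A k)).
Proof.
move=> AB k; apply: normed_cvg; apply: nondecreasing_is_cvgn.
  by apply: nondecreasing_series => n _ _; exact: normr_ge0.
exists B => _ [n _ <-]; apply: le_trans (AB (maxn n k.+1)).
have kN : (k < maxn n k.+1)%N by rewrite leq_max ltnSn orbT.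
rewrite (big_cat_nat (n := k))//=; last exact: ltnW.
rewrite [X in _ <= _ + X]big_ltn//= addrCA.
rewrite /series /= (big_cat_nat (n := n) (p := maxn n k.+1))//= ?leq_maxl// -addrA lerDl.
by rewrite !addr_ge0// ?sumr_ge0// => i _; exact: sumr_ge0.
Qed.

Lemma pser_cv_normed_bound u r f x : pser_cv u r f -> `|x| < r ->
  exists B, forall n, \sum_(0 <= j < n) `|u j| * `|x| ^+ j <= B.
Proof.
move=> uf xr; have cu := pser_cv_normed uf xr.
exists (limn (pseries (fun n => `|u n|) `|x|)) => n.
apply: (nondecreasing_cvgn_le _ cu n).
by apply: nondecreasing_series => i _ _; rewrite mulr_ge0// exprn_ge0.
Qed.

(** The powers of [x0 + h] are expanded binomially and regrouped by powers of [h]; absolute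
    summability is that of the original series at |x0| + |h|. *)
Lemma pser_cv_recenter u r f x0 : `|x0| < r -> pser_cv u r f ->
  exists v, pser_cv v (r - `|x0|) (fun h => f (x0 + h)).
Proof.
move=> x0r uf.
pose b h k m := u (k + m)%N * 'C(k + m, k)%:R * x0 ^+ m * h ^+ k.
have bE h j : \sum_(0 <= k < j.+1) b h k (j - k)%N = u j * (x0 + h) ^+ j.
  rewrite exprDn mulr_sumr big_mkord; apply: eq_bigr => k _.
  have kj : (k <= j)%N by rewrite -ltnS.
  by rewrite /b subnKC// -mulr_natr; ring.
have bB h : `|h| < r - `|x0| ->
    exists B, forall n, \sum_(0 <= k < n) \sum_(0 <= m < n) `|b h k m| <= B.
  move=> hr; have xh : `| `|x0| + `|h| | < r by rewrite ger0_norm ?addr_ge0//; lra.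
  have [B uB] := pser_cv_normed_bound uf xh.
  exists B; apply: square_le_triangle => n; apply: le_trans (uB n).
  apply: ler_sum => j _; rewrite (ger0_norm (addr_ge0 (normr_ge0 x0) (normr_ge0 h))) exprDn mulr_sumr big_mkord.
  apply: ler_sum => k _; have kj : (k <= j)%N by rewrite -ltnS.
  by rewrite /b subnKC// !normrM !normrX normr_nat -mulr_natr; apply: ler_eq; ring.
pose c k m := u (k + m)%N * 'C(k + m, k)%:R * x0 ^+ m.
pose h1 := (r - `|x0|) / 2.
have h10 : 0 < h1 by rewrite /h1; lra.
(* The coefficient series do not involve [h], so a single nonzero [h1] inside the disc proves that
   they converge. *)
have cc k : cvgn (series (c k)).
  have [|B hB] := bB h1; first by rewrite gtr0_norm// /h1; lra.
  have := @row_cvg _ _ hB k.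
  have -> : series (b h1 k) = (fun n => series (c k) n * h1 ^+ k).
    by apply/funext => n; rewrite /series/= mulr_suml.
  move=> /cvg_ex[l hl]; apply/cvg_ex; exists (l / h1 ^+ k).
  have -> : series (c k) = (fun n => series (c k) n * h1 ^+ k / h1 ^+ k).
    by apply/funext => n; rewrite mulfK// expf_neq0// gt_eqF.
  exact: cvgMr_tmp.
exists (fun k => limn (series (c k))) => h hr.
have [B hB] := bB h hr.
have rowL k : series (b h k) @ \oo --> limn (series (c k)) * h ^+ k.
  have -> : series (b h k) = (fun n => series (c k) n * h ^+ k).
    by apply/funext => n; rewrite /series/= mulr_suml.
  by apply: cvgMr_tmp; exact: cc.
have [S SL SD] := double_series_diag hB rowL.
suff <- : S = f (x0 + h) by exact: SL.
have xh : `|x0 + h| < r by have := ler_normD x0 h; lra.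
rewrite -(cvg_lim _ SD)// -(cvg_lim _ (uf _ xh))//; congr (limn _).
by apply/funext => n; apply: eq_bigr => j _; rewrite bE.
Qed.

(* Taylor coefficients at 0 of h |-> (t - h)^-a S(- h / (t (t - h))), where S has
   coefficients s; t = 1 is Pfaff's transformation, general t recenters it. *)
Definition pfaff_coef (s : R^nat) a (t : R) n :=
  \sum_(0 <= k < n.+1) s k * (-1) ^+ k * t `^ (- a) * t ^- (n + k) *
     (rising (a + k%:R) (n - k) / (n - k)`!%:R).

(** The k-th power of z / (t (t - z)) times the prefactor is a monomial times a binomial series of
    exponent - (a + k) in z / t. *)
Lemma pfaff_row a t z (e : R) k : 0 < t -> `|z| < t ->
  series (fun m => e * t ^- (m + k + k) * (rising (a + k%:R) m / m`!%:R) *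
    z ^+ (k + m)) @ \oo --> e * (z / (t * (t - z))) ^+ k * (1 - z / t) `^ (- a).
Proof.
move=> t0 zt; have zt1 : `|z / t| < 1.
  by rewrite normrM normfV (gtr0_norm t0) ltr_pdivrMr// mul1r.
have tz : 0 < t - z by have := ler_norm z; lra.
have tz1 : 0 < 1 - z / t by have := ler_norm (z / t); lra.
have -> : e * (z / (t * (t - z))) ^+ k * (1 - z / t) `^ (- a) =
   e * t ^- (k + k) * z ^+ k * (1 - z / t) `^ (- (a + k%:R)).
  rewrite opprD powRD; last by rewrite (gt_eqF tz1) implybT.
  rewrite (powRN _ k%:R) powR_mulrn ?(ltW tz1)//.
  have -> : z / (t * (t - z)) = t^-1 * t^-1 * z * (1 - z / t)^-1.
    by field; rewrite subr_eq0 !gt_eqF//= -subr_gt0.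
  rewrite !exprMn !exprVn exprD invfM; ring.
have -> : series (fun m => e * t ^- (m + k + k) * (rising (a + k%:R) m / m`!%:R) *
    z ^+ (k + m)) =
   (fun n => e * t ^- (k + k) * z ^+ k *
     pseries (fun n => rising (a + k%:R) n / n`!%:R) (z / t) n).
  apply/funext => n; rewrite /pseries /series /= mulr_sumr; apply: eq_bigr => m _.
  rewrite exprMn exprVn -addnA !exprD !invfM; ring.
by have := @pser_cv_binomial R (a + k%:R) (z / t) zt1; exact: cvgMl_tmp.
Qed.

Lemma pser_cv_pfaff (s : R^nat) d (S : R -> R) a t : 0 < d -> 0 < t ->
  pser_cv s d S ->
  exists2 r, 0 < r & pser_cv (pfaff_coef s a t) r
     (fun h => (t - h) `^ (- a) * S (- (h / (t * (t - h))))).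
Proof.
move=> d0 t0 sS.
have t20 : 0 < t ^+ 2 by exact: exprn_gt0.
(* The first bound keeps t - |h| above t / 2; the second then keeps |h| / (t (t - |h|)) below
   [d]. *)
exists (Num.min (t / 2) (d * t ^+ 2 / 2)).
  by rewrite lt_min !divr_gt0// mulr_gt0.
move=> h; rewrite lt_min => /andP[ht hd].
have h0 := normr_ge0 h; have hh := ler_norm h.
have th : 0 < t - h by lra.
have ty : 0 < t - `|h| by lra.
pose A k m := s k * (-1) ^+ k * t `^ (- a) * t ^- (m + k + k) *
     (rising (a + k%:R) m / m`!%:R) * h ^+ (k + m).
have ht1 : 0 <= 1 - h / t by rewrite subr_ge0 ler_pdivrMr// mul1r; lra.
have rowA k : series (A k) @ \oo -->
    s k * (- (h / (t * (t - h)))) ^+ k * (t - h) `^ (- a).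
  have := @pfaff_row a t h (s k * (-1) ^+ k * t `^ (- a)) k t0 ltac:(lra).
  rewrite [X in _ --> X](_ : _ = s k * (- (h / (t * (t - h)))) ^+ k * (t - h) `^ (- a))//.
  set X := h / (t * (t - h)); rewrite -[- X]mulN1r [(-1 * X) ^+ k]exprMn.
  have -> : (t - h) `^ (- a) = t `^ (- a) * (1 - h / t) `^ (- a).
    by rewrite -(powRM _ (ltW t0) ht1); congr (_ `^ _); field; rewrite gt_eqF.
  by ring.
pose rho := `|h| / (t * (t - `|h|)).
have rho0 : 0 <= rho by rewrite divr_ge0// mulr_ge0// ltW.
have rhod : `|rho| < d.
  rewrite ger0_norm// ltr_pdivrMr ?mulr_gt0//; nra.
have [B sB] := pser_cv_normed_bound sS rhod.
have AB : forall n, \sum_(0 <= k < n) \sum_(0 <= m < n) `|A k m| <=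
    t `^ (- a) * (1 - `|h| / t) `^ (- `|a|) * B.
  move=> n; apply: le_trans (ler_wpM2l _ (sB n)); last by rewrite mulr_ge0 ?powR_ge0.
  rewrite mulr_sumr; apply: ler_sum => k _.
  (* Majorant obtained by replacing [a] and [h] with their absolute values; its row sums are again
     given by [pfaff_row]. *)
  pose bd m := `|s k| * t `^ (- a) * t ^- (m + k + k) *
     (rising (`|a| + k%:R) m / m`!%:R) * `|h| ^+ (k + m).
  apply: (@le_trans _ _ (series bd n)).
    apply: ler_sum => m _; rewrite /A /bd !normrM !normrX normrN1 expr1n mulr1.
    rewrite (ger0_norm (powR_ge0 _ _)) (@ger0_norm _ (t ^- _)) ?invr_ge0 ?exprn_ge0 ?(ltW t0)//.
    rewrite ler_wpM2r ?exprn_ge0// ler_wpM2l//.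
      by rewrite !mulr_ge0 ?powR_ge0 ?invr_ge0 ?exprn_ge0 ?(ltW t0).
    rewrite (@ger0_norm _ _^-1) ?invr_ge0// ler_wpM2r ?invr_ge0//.
    apply: le_trans (ler_norm_rising _ _) _; apply: ler_rising => //.
    by apply: le_trans (ler_normD _ _) _; rewrite normr_nat.
  have := @pfaff_row `|a| t `|h| (`|s k| * t `^ (- a)) k t0.
  rewrite normr_id => /(_ ltac:(lra)) bdl.
  have -> : t `^ (- a) * (1 - `|h| / t) `^ (- `|a|) * (`|s k| * `|rho| ^+ k) =
     `|s k| * t `^ (- a) * (`|h| / (t * (t - `|h|))) ^+ k * (1 - `|h| / t) `^ (- `|a|).
    by rewrite (ger0_norm rho0) /rho; ring.
  rewrite -(cvg_lim _ bdl)//; apply: nondecreasing_cvgn_le.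
    apply: nondecreasing_series => m _ _; rewrite /bd.
    by rewrite !mulr_ge0 ?invr_ge0 ?exprn_ge0 ?(ltW t0) ?powR_ge0 ?rising_ge0 ?addr_ge0.
  by apply/cvg_ex; eexists; exact: bdl.
have [S' SL SD] := double_series_diag AB rowA.
have -> : (t - h) `^ (- a) * S (- (h / (t * (t - h)))) = S'.
  rewrite -(cvg_lim _ SL)//; apply/esym/cvg_lim => //.
  have -> : series (fun k => s k * (- (h / (t * (t - h)))) ^+ k * (t - h) `^ (- a)) =
     (fun n => (t - h) `^ (- a) * pseries s (- (h / (t * (t - h)))) n).
    by apply/funext => n; rewrite /series/= mulr_sumr; apply: eq_bigr => i _; rewrite mulrC.
  apply: cvgMl_tmp; apply: sS; apply: le_lt_trans rhod.
  rewrite normrN /rho !normrM !normfV !normrM !normr_id (gtr0_norm t0) (gtr0_norm th) (gtr0_norm ty).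
  by rewrite ler_wpM2l// lef_pV2 ?posrE ?mulr_gt0// ler_wpM2l ?(ltW t0)//; lra.
have -> // : pseries (pfaff_coef s a t) h =
  series (fun n => \sum_(0 <= k < n.+1) A k (n - k)%N).
apply/funext => n; apply: eq_bigr => j _; rewrite /pfaff_coef /= mulr_suml.
apply: eq_big_nat => k /andP[_ kj].
by rewrite /A subnKC// subnK// addnC; ring.
Qed.

End Recenter.

(** * The hypergeometric function *)

Section Hypergeometric.
Context {R : realType}.
Implicit Types (f : R -> R) (a b c x y : R).

Definition gauss a b c x : R := limn (pseries (hyp2F1_coef a b c) x).

Definition pfaff a b c x : R := (1 - x) `^ (- a) * gauss a (c - b) c (x / (x - 1)).

(** Coefficientwise, Pfaff's transformation is the Chu-Vandermonde sum with [d = c - b]. *)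
Lemma pfaff_coef_gauss a b c : 0 < c ->
  pfaff_coef (hyp2F1_coef a (c - b) c) a 1 = hyp2F1_coef a b c.
Proof.
move=> c0; apply/funext => n; rewrite /pfaff_coef.
have n0 m : m`!%:R != 0 :> R by rewrite pnatr_eq0 -lt0n fact_gt0.
have -> : hyp2F1_coef a b c n = rising a n / n`!%:R / rising c n *
    rising (c - (c - b)) n.
  by rewrite opprB addrC subrK /hyp2F1_coef invfM; ring.
rewrite -chu_vandermonde mulr_sumr; apply: eq_big_nat => k /andP[_ kn].
rewrite ltnS in kn.
rewrite powR1 expr1n invr1 !mulr1 /hyp2F1_coef.
have ra s : rising s n = rising s k * rising (s + k%:R) (n - k) :> R.
  by rewrite -risingD subnKC.
rewrite (ra a) (ra c).
have c1 := rising_neq0 k c0.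
have c2 : rising (c + k%:R) (n - k) != 0 by rewrite rising_neq0// ltr_pwDl.
have -> : n`!%:R = 'C(n, k)%:R * (k`!%:R * (n - k)`!%:R) :> R.
  by rewrite -!natrM bin_fact.
have cn : 'C(n, k)%:R != 0 :> R by rewrite pnatr_eq0 -lt0n bin_gt0.
by field; rewrite !n0 c1 c2 cn.
Qed.

Lemma gauss_analytic a b c x : 0 < c -> `|x| < 1 -> real_analytic_at (gauss a b c) x.
Proof.
move=> c0 x1; apply/real_analytic_atP.
have [v hv] := pser_cv_recenter x1 (@pser_cv_hyp2F1_coef _ a b c c0).
by exists v, (1 - `|x|); split => //; lra.
Qed.

Lemma pfaff_arg x : x < 1 / 2 -> `|x / (x - 1)| < 1.
Proof.
move=> x2; rewrite normrM normfV ltr_pdivrMr ?normr_gt0; last by rewrite lt_eqF//; lra.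
by rewrite mul1r (ltr0_norm (_ : x - 1 < 0)); [rewrite ltr_norml; apply/andP; split|]; lra.
Qed.

(** Two facts are needed together: analyticity at every point below 1/2, and, at 0, the knowledge
    that the Taylor coefficients are those of Gauss. *)
Lemma pfaff_local a b c x0 : 0 < c -> x0 < 1 / 2 -> exists2 v, 
  (x0 = 0 -> v = hyp2F1_coef a b c) &
  exists2 r, 0 < r & pser_cv v r (fun h => pfaff a b c (x0 + h)).
Proof.
move=> c0 x2; have u1 := pfaff_arg x2.
have S0 := @pser_cv_hyp2F1_coef _ a (c - b) c c0.
have t0 : 0 < 1 - x0 by lra.
have [v [vE vS]] : exists v, (x0 = 0 -> v = hyp2F1_coef a (c - b) c) /\
   pser_cv v (1 - `|x0 / (x0 - 1)|) (fun h => gauss a (c - b) c (x0 / (x0 - 1) + h)).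
  (* Recentering at 0 would return coefficients not known to be the original ones, so this case is
     kept apart. *)
  have [x00|x00] := pselect (x0 = 0).
    exists (hyp2F1_coef a (c - b) c); split => // h.
    by rewrite x00 mul0r normr0 subr0 add0r; exact: S0.
  have [v hv] := pser_cv_recenter u1 S0.
  by exists v.
have d0 : 0 < 1 - `|x0 / (x0 - 1)| by lra.
have [r r0 hr] := pser_cv_pfaff a d0 t0 vS.
exists (pfaff_coef v a (1 - x0)).
  by move=> x00; rewrite vE// x00 subr0 pfaff_coef_gauss.
exists (Num.min r (1 - x0)); first by rewrite lt_min r0.
move=> h; rewrite lt_min => /andP[hr1 hx].
have := hr h hr1; rewrite /pfaff.
rewrite (_ : 1 - x0 - h = 1 - (x0 + h)); last by ring.
rewrite [X in gauss _ _ _ X](_ : _ = (x0 + h) / (x0 + h - 1))//.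
have hh := ler_norm h.
(* When [x0] moves by [h], the point x / (x - 1) moves by exactly - h / (t (t - h)) with t = 1 - x0,
   the argument used in [pser_cv_pfaff]. *)
have mob (p q : R) : p != 0 -> q != 0 ->
    (1 - p) / - p - (p - q) / (p * q) = (1 - q) / - q.
  by move=> p0 q0; field; rewrite p0 q0.
have := mob (1 - x0) (1 - (x0 + h)); rewrite !opprB !subrKC => mob1.
rewrite -mob1 ?gt_eqF//; last lra.
by congr (_ - _ / _); ring.
Qed.

(** Equal Taylor coefficients at 0, propagated along the interval where both functions are
    analytic. *)
Lemma pfaff_gauss a b c x : 0 < c -> -1 < x < 1 / 2 -> pfaff a b c x = gauss a b c x.
Proof.
move=> c0; apply: (@real_analytic_eq _ (-1) (1 / 2) 0); first lra.
- move=> y /andP[_ y2]; apply/real_analytic_atP.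
  by have [v _ [r r0 hv]] := pfaff_local a b c0 y2; exists v, r.
- by move=> y y2; apply: gauss_analytic => //; rewrite ltr_norml; lra.
have [v v0 [r r0 hv]] := @pfaff_local a b c 0 c0 ltac:(lra).
exists (Num.min r 1); first by rewrite /= lt_min r0 ltr01.
move=> y; rewrite /ball_/= sub0r normrN lt_min => /andP[yr y1].
have := hv y yr; rewrite v0// add0r => h1.
by rewrite -(cvg_lim _ h1).
Qed.

(* The Gauss series and its Pfaff transform overlap on ]-1, 1/2[, so two pieces
   cover ]-oo, 1[. *)
Definition hyp2F1_cont a b c x : R :=
  if 1 <= x then 0 else if x < 1 / 2 then pfaff a b c x else gauss a b c x.

Lemma is_hyp2F1_cont a b c : 0 < c -> is_hyp2F1 a b c (hyp2F1_cont a b c).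
Proof.
move=> c0; have gE x : `|x| < 1 -> hyp2F1_cont a b c x = gauss a b c x.
  rewrite ltr_norml /hyp2F1_cont => /andP[x1 x2]; rewrite leNgt x2/=.
  by case: ifP => // x3; rewrite pfaff_gauss// x1.
split.
- by move=> x x1; rewrite gE//; exact: pser_cv_hyp2F1_coef.
- move=> x x1; have [x2|x2] := ltP x (1 / 2).
    apply: (@near_real_analytic_at _ (pfaff a b c)).
      near=> y; have y2 : y < 1 / 2 by near: y; exact: lt_nbhsl.
      by rewrite /hyp2F1_cont y2 leNgt (_ : y < 1)//; lra.
    apply/real_analytic_atP.
    by have [v _ [r r0 hv]] := pfaff_local a b c0 x2; exists v, r.
  have x1' : `|x| < 1 by rewrite ltr_norml; lra.
  apply: (@near_real_analytic_at _ (gauss a b c)); last exact: gauss_analytic.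
  near=> y; rewrite gE//; near: y; exact: open_norm_lt.
- by move=> x x1; rewrite /hyp2F1_cont x1.
Unshelve. all: by end_near. Qed.

Lemma is_hyp2F1_unique a b c f g : is_hyp2F1 a b c f -> is_hyp2F1 a b c g -> f = g.
Proof.
move=> [f1 f2 f3] [g1 g2 g3]; apply/funext => x.
have [x1|x1] := leP 1 x; first by rewrite f3// g3.
(* Left end of an interval that contains both [x] and 0, where the series fixes the function. *)
have [p0 px] : Num.min x 0 - 1 < 0 /\ Num.min x 0 - 1 < x by case: (leP x 0); lra.
have nb : \forall y \near (0 : R), `|y| < 1 by apply: open_norm_lt; rewrite normr0.
apply: (@real_analytic_eq _ (Num.min x 0 - 1) 1 0) => //.
- by rewrite p0 ltr01.
- by move=> y /andP[_ y1]; exact: f2.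
- by move=> y /andP[_ y1]; exact: g2.
- near=> y; have y1 : `|y| < 1 by near: y; exact: nb.
  by rewrite -(cvg_lim _ (f1 _ y1))// -(cvg_lim _ (g1 _ y1)).
- by rewrite px x1.
Unshelve. all: by end_near. Qed.

Lemma is_hyp2F1_hyp2F1 a b c : 0 < c -> is_hyp2F1 a b c (hyp2F1 a b c).
Proof.
move=> c0; rewrite /hyp2F1.
by case: xgetP => [f -> //|/(_ (hyp2F1_cont a b c))]; case; exact: is_hyp2F1_cont.
Qed.

Lemma hyp2F1_contE a b c : 0 < c -> hyp2F1 a b c = hyp2F1_cont a b c.
Proof.
move=> c0; apply: is_hyp2F1_unique; [exact: is_hyp2F1_hyp2F1|exact: is_hyp2F1_cont].
Qed.

Lemma hyp2F1_gauss a b c x : 0 < c -> `|x| < 1 ->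
  pseries (hyp2F1_coef a b c) x @ \oo --> hyp2F1 a b c x.
Proof. by move=> c0 x1; have [h _ _] := is_hyp2F1_hyp2F1 a b c0; exact: h. Qed.

Lemma hyp2F1_pfaff a b c x : 0 < c -> x < 1 / 2 ->
  hyp2F1 a b c x = (1 - x) `^ (- a) * hyp2F1 a (c - b) c (x / (x - 1)).
Proof.
move=> c0 x2; have x1 := pfaff_arg x2.
rewrite hyp2F1_contE// /hyp2F1_cont x2 leNgt (_ : x < 1)/=; last lra.
by rewrite /pfaff; congr (_ * _); apply: cvg_lim => //; exact: hyp2F1_gauss.
Qed.

Lemma hyp2F1C a b c : hyp2F1 a b c = hyp2F1 b a c.
Proof.
have E : hyp2F1_coef a b c = hyp2F1_coef b a c.
  by apply/funext => n; rewrite /hyp2F1_coef (mulrC (rising a n)).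
rewrite /hyp2F1; congr (xget _ _); apply/funext => f.
by rewrite /is_hyp2F1 E.
Qed.

Lemma measurable_hyp2F1 a b c : 0 < c -> measurable_fun setT (hyp2F1 a b c).
Proof.
move=> c0; have [_ h2 h3] := is_hyp2F1_hyp2F1 a b c0.
rewrite -(setUv [set` `]-oo, (1 : R)[ ]); apply/measurable_funU => //.
  exact: measurableC.
split.
  apply: open_continuous_measurable_fun => // x.
  by rewrite inE/= in_itv/= => x1; apply: real_analytic_at_continuous; exact: h2.
have : measurable_fun (~` [set` `]-oo, (1 : R)[ ]) (cst 0 : R -> R) by [].
apply: eq_measurable_fun => x.
by rewrite inE/= in_itv/= => /negP; rewrite -leNgt => x1; rewrite h3.
Qed.

End Hypergeometric.

Section Measurability.
Context {R : realType}.

Lemma measurable_funV : measurable_fun setT (fun x : R => x^-1).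
Proof.
have oD : open (~` [set (0 : R)]).
  rewrite (_ : ~` _ = [set` `]-oo, (0 : R)[ ] `|` [set` `]0, +oo[ ]).
    by apply: openU; exact: interval_open.
  apply/seteqP; split => x /=; rewrite !in_itv/= ?andbT.
    by move/eqP; rewrite neq_lt => /orP.
  by case=> [x0 xE|x0 xE]; rewrite xE ltxx in x0.
rewrite -(setUv [set (0 : R)]); apply/measurable_funU => //.
  exact: measurableC.
split.
  apply: (@eq_measurable_fun _ _ _ _ _ (cst (0 : R))) => [x|//].
  by rewrite inE /= => ->; rewrite invr0.
apply: open_continuous_measurable_fun => // x.
by rewrite inE /= => /eqP x0; exact: inv_continuous.
Qed.

Lemma measurable_funTV d (T : measurableType d) (D : set T) (f : T -> R) :
  measurable_fun D f -> measurable_fun D (fun x => (f x)^-1).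
Proof. by move=> mf; exact: (measurableT_comp measurable_funV mf). Qed.

Lemma measurable_funTpowR d (T : measurableType d) (D : set T) (f : T -> R) p :
  measurable_fun D f -> measurable_fun D (fun x => f x `^ p).
Proof. by move=> mf; exact: (measurableT_comp (@measurable_powR R p) mf). Qed.

Lemma measurable_funTexpR d (T : measurableType d) (D : set T) (f : T -> R) :
  measurable_fun D f -> measurable_fun D (fun x => expR (f x)).
Proof. by move=> mf; exact: (measurableT_comp (@measurable_expR R) mf). Qed.

Lemma measurable_funTN d (T : measurableType d) (D : set T) (f : T -> R) :
  measurable_fun D f -> measurable_fun D (fun x => - f x).
Proof. by move=> mf; exact: measurableT_comp mf. Qed.

Lemma measurable_funTfst d (T : measurableType d) (D : set T) (f : T -> R * R) :
  measurable_fun D f -> measurable_fun D (fun x => (f x).1).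
Proof. by move=> mf; exact: measurableT_comp mf. Qed.

Lemma measurable_funTsnd d (T : measurableType d) (D : set T) (f : T -> R * R) :
  measurable_fun D f -> measurable_fun D (fun x => (f x).2).
Proof. by move=> mf; exact: measurableT_comp mf. Qed.

End Measurability.

Ltac mfun := repeat first [done | apply: measurable_funTV
  | apply: measurable_funTexpR | apply: measurable_funTN
  | apply: measurable_funM | apply: measurable_funB | apply: measurable_funD
  | apply: measurable_funX | apply: measurable_funTpowR
  | apply: measurable_fun_pair
  | apply: measurable_funTfst | apply: measurable_funTsnd ].

(** * Integrals on the half-line and the Gamma function *)

Section Density.
Local Open Scope ereal_scope.
Context d (T : measurableType d) (R : realType).
Variables (mu nu : {measure set T -> \bar R}) (k : T -> R).
Hypotheses (mk : measurable_fun setT k) (k0 : forall x, (0 <= k x)%R).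
Hypothesis nuE : forall A, measurable A -> nu A = \int[mu]_(x in A) (k x)%:E.

Import HBNNSimple.

Let mkE : measurable_fun setT (EFin \o k).
Proof. exact/measurable_EFinP. Qed.

Let integral_density_nnsfun (f : {nnsfun T >-> R}) :
  \int[nu]_x (f x)%:E = \int[mu]_x ((f x)%:E * (k x)%:E).
Proof.
under [LHS]eq_integral do rewrite fimfunE -fsumEFin//.
rewrite [LHS]ge0_integral_fsum//; last 2 first.
  - by move=> r; exact/measurable_EFinP/measurableT_comp.
  - by move=> n x _; rewrite EFinM nnfun_muleindic_ge0.
under [RHS]eq_integral.
  move=> x xD; rewrite fimfunE -fsumEFin// muleC ge0_mule_fsumr; last first.
    by move=> r; rewrite EFinM nnfun_muleindic_ge0.
  over.
rewrite [RHS]ge0_integral_fsum//; last 2 first.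
  - move=> r; apply: emeasurable_funM => //.
    by apply/measurable_EFinP; exact/measurableT_comp.
  - move=> n x _; apply: mule_ge0; first by rewrite lee_fin.
    by rewrite EFinM nnfun_muleindic_ge0.
apply: eq_fsbigr => r _.
have mfr : measurable (f @^-1` [set r]) by exact: measurable_funPTI.
rewrite integralZl_indic_nnsfun//= integral_indic// setIT nuE//.
have [r0|r0] := ltP r 0%R.
  rewrite preimage_nnfun0// integral_set0 mule0 integral0_eq// => x _.
  by rewrite indic0 mulr0 mule0.
rewrite [X in _ * X]integral_mkcond -ge0_integralZl//; last 2 first.
- by apply/(measurable_restrictT _ _).1 => //; exact/measurable_funTS.
- by move=> x _; rewrite patchE; case: ifP; rewrite ?lee_fin.
apply: eq_integral => x _; rewrite patchE indicE.
by case: ifPn => _; rewrite ?mulr1 ?mulr0 ?mule0 // muleC.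
Qed.

Lemma integral_density (f : T -> \bar R) : measurable_fun setT f ->
  (forall x, 0 <= f x) -> \int[nu]_x f x = \int[mu]_x (f x * (k x)%:E).
Proof.
move=> mf f0; pose f_ := nnsfun_approx measurableT mf.
have cf x : (f_ n x)%:E @[n --> \oo] --> f x.
  by apply: cvg_nnsfun_approx => // y _.
have ndf x m n : (m <= n)%N -> (f_ m x)%:E <= (f_ n x)%:E.
  by move=> mn; rewrite lee_fin; exact/lefP/nd_nnsfun_approx.
have mf_ n : measurable_fun setT (fun x => (f_ n x)%:E).
  exact/measurable_EFinP.
transitivity (limn (fun n => \int[nu]_x (f_ n x)%:E)).
  rewrite -monotone_convergence//=.
  - by apply: eq_integral => x _; apply/esym/cvg_lim => //; exact: cf.
  - by move=> n x _; rewrite lee_fin.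
  - by move=> x _ m n mn; exact: ndf.
transitivity (limn (fun n => \int[mu]_x ((f_ n x)%:E * (k x)%:E))).
  by apply: congr_lim; apply/funext => n; exact: integral_density_nnsfun.
rewrite -monotone_convergence//=.
- by apply: eq_integral => x _; apply/cvg_lim => //; exact: cvgeZr.
- by move=> n; exact: emeasurable_funM.
- by move=> n x _; rewrite mule_ge0// lee_fin.
- by move=> x _ m n mn; apply: lee_wpmul2r; [rewrite lee_fin|exact: ndf].
Qed.

End Density.

Section Scaling.
Context {R : realType}.
Local Notation mu := (@lebesgue_measure R).
Local Open Scope ereal_scope.

(** Uniqueness of Lebesgue measure: the rescaled pushforward gives half-open intervals their
    length. *)
Lemma lebesgue_measure_scale (c : R) (A : set R) : (0 < c)%R -> measurable A ->
  mu A = c%:E * mu ((fun x => c * x)%R @^-1` A).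
Proof.
move=> c0 mA.
have mc : @measurable_fun _ _ (measurableTypeR R) (measurableTypeR R) setT
    (fun x : R => (c * x)%R) by mfun.
pose m := measure_function_mscale__canonical__measure_function_Measure (NngNum (ltW c0))
  (measure_function_pushforward__canonical__measure_function_Measure mu mc).
rewrite (@lebesgue_measure_unique R m)// => X [[a b] _ <-] /=.
rewrite /m /mscale /= /pushforward.
rewrite (_ : _ @^-1` _ = [set` `]a / c, b / c]%R]); last first.
  by apply/seteqP; split => x /=; rewrite !in_itv/= ltr_pdivrMr// ler_pdivlMr// [(x * c)%R]mulrC.
rewrite !lebesgue_measure_itv/= !lte_fin ltr_pM2r ?invr_gt0//.
case: ifPn => _; last by rewrite mule0.
by rewrite -!EFinB -EFinM -mulrBl mulrCA divff ?mulr1// gt_eqF.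
Qed.

Lemma ge0_integral_scale (c : R) (f : R -> \bar R) : (0 < c)%R ->
  measurable_fun setT f -> (forall x, 0 <= f x) ->
  \int[mu]_x f x = c%:E * \int[mu]_x f (c * x)%R.
Proof.
move=> c0 mf f0.
have mc : @measurable_fun _ _ (measurableTypeR R) (measurableTypeR R) setT
    (fun x : R => (c * x)%R) by mfun.
pose m := measure_function_mscale__canonical__measure_function_Measure (NngNum (ltW c0))
  (measure_function_pushforward__canonical__measure_function_Measure mu mc).
rewrite (@eq_measure_integral _ _ _ setT m); last first.
  by move=> A mA _; exact: lebesgue_measure_scale.
rewrite ge0_integral_mscale//; congr (_ * _).
by rewrite ge0_integral_pushforward//= preimage_setT.
Qed.

Local Notation pos := [set` `](0 : R)%R, +oo[ ].

Lemma ge0_integral_pos_scale (c : R) (f : R -> \bar R) : (0 < c)%R ->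
  measurable_fun pos f -> (forall x, (0 < x)%R -> 0 <= f x) ->
  \int[mu]_(x in pos) f x = c%:E * \int[mu]_(x in pos) f (c * x)%R.
Proof.
move=> c0 mf f0; rewrite integral_mkcond (ge0_integral_scale c0); last 2 first.
- exact/(measurable_restrictT _ _).1.
- by move=> x; rewrite patchE; case: ifPn => //; rewrite inE/= in_itv/= andbT; exact: f0.
congr (_ * _); rewrite [RHS]integral_mkcond; apply: eq_integral => x _.
rewrite !patchE; congr (if _ then _ else _).
by apply/idP/idP; rewrite !inE/= !in_itv/= !andbT pmulr_rgt0.
Qed.

End Scaling.

(** * Improper integrals from antiderivatives *)

Section ImproperFTC.
Context {R : realType}.
Local Notation mu := (@lebesgue_measure R).

Lemma FTC_cc (f F : R -> R) (a b : R) : a < b ->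
  (forall x, a <= x <= b -> {for x, continuous f} /\ is_derive x (1 : R) F (f x)) ->
  (\int[mu]_(x in [set` `[a, b] ]) (f x)%:E = (F b - F a)%:E)%E.
Proof.
move=> ab fF; rewrite EFinB; apply: continuous_FTC2 => //.
- apply: continuous_in_subspaceT => x; rewrite inE/= in_itv/= => xab.
  by have [] := fF x xab.
- have dF x : a <= x <= b -> derivable F x 1 by move=> xab; have [_ []] := fF x xab.
  split.
  + by move=> x; rewrite in_itv/= => /andP[/ltW ax /ltW xb]; apply: dF; rewrite ax xb.
  + apply: cvg_at_right_filter; apply/differentiable_continuous/derivable1_diffP.
    by apply: dF; rewrite lexx ltW.
  + apply: cvg_at_left_filter; apply/differentiable_continuous/derivable1_diffP.
    by apply: dF; rewrite lexx ltW.
- move=> x; rewrite in_itv/= => /andP[/ltW ax /ltW xb]; rewrite derive1E.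
  by have [_ []] := fF x ltac:(by rewrite ax xb).
Qed.

(** Monotone convergence along compact intervals that exhaust [D]; nonnegativity replaces any prior
    integrability. The open set [O] gives two-sided derivatives at the end points of these intervals
    as well. *)
Lemma ge0_FTC_improper (f F : R -> R) (D O : set R) (u v : R^nat) (l m : R) :
  open O -> D `<=` O ->
  (forall x, O x -> 0 <= f x /\ {for x, continuous f} /\ is_derive x (1 : R) F (f x)) ->
  (forall n, u n < v n) -> (forall n, u n.+1 <= u n) -> (forall n, v n <= v n.+1) ->
  D = \bigcup_n [set` `[u n, v n]] ->
  F (v n) @[n --> \oo] --> m -> F (u n) @[n --> \oo] --> l ->
  (\int[mu]_(x in D) (f x)%:E = (m - l)%:E)%E.
Proof.
move=> oO DO fF uv ud vi DE Fm Fl.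
have sub n : [set` `[u n, v n]] `<=` O.
  by move=> x xuv; apply: DO; rewrite DE; exists n.
have mD n : measurable [set` `[u n, v n]] by exact: measurable_itv.
have cf n : {within [set` `[u n, v n]], continuous f}.
  apply: continuous_in_subspaceT => x; rewrite inE => /sub Ox.
  by have [_ []] := fF x Ox.
have IE n : (\int[mu]_(x in [set` `[u n, v n]]) (f x)%:E = (F (v n) - F (u n))%:E)%E.
  apply: FTC_cc => // x xuv.
  by have [_] := fF x (sub n x ltac:(by rewrite /= in_itv/=)).
have := @ge0_nondecreasing_set_cvg_integral _ (measurableTypeR R) R (fun n => [set` `[u n, v n]])
   (EFin \o f) mu.
rewrite -DE => H.
have lim1 : (\int[mu]_(x in [set` `[u n, v n]]) (f x)%:E)%E @[n --> \oo] -->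
    (m - l)%:E.
  under eq_fun do rewrite IE.
  by apply: cvg_EFin; [near=> n|apply: cvgB].
rewrite -(cvg_lim _ lim1)//; apply/esym/cvg_lim => //; apply: H.
- apply/nondecreasing_seqP => n; rewrite subsetEset => x /=.
  by rewrite !in_itv/= => /andP[ux xv]; rewrite (le_trans _ ux)// (le_trans xv).
- by [].
- by move=> n; apply/measurable_EFinP; exact: subspace_continuous_measurable_fun (cf n).
- by move=> n x /sub /fF[f0 _]; rewrite lee_fin.
Unshelve. all: by end_near. Qed.

End ImproperFTC.

Section TriangleTonelli.
Context {R : realType}.
Local Notation mu := (@lebesgue_measure R).
Local Notation pos := [set` `](0 : R)%R, +oo[ ].
Local Open Scope ereal_scope.

Lemma set_tonelli (D E : set R) (f : R * R -> \bar R) : measurable D -> measurable E ->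
  measurable_fun setT f -> (forall x y, D x -> E y -> 0 <= f (x, y)) ->
  \int[mu]_(x in D) \int[mu]_(y in E) f (x, y) =
  \int[mu]_(y in E) \int[mu]_(x in D) f (x, y).
Proof.
move=> mD mE mf f0.
pose g := f \_ (D `*` E).
have mg : measurable_fun setT g.
  apply/(measurable_restrictT _ _).1; first exact: measurableX.
  exact: measurable_funTS.
have g0 x : 0 <= g x.
  rewrite /g patchE; case: ifPn => //; rewrite inE => -[]/=.
  by case: x => x y /=; exact: f0.
have := @fubini_tonelli _ _ _ _ R mu mu g mg g0.
have gE1 x : \int[mu]_y g (x, y) = ((fun x => \int[mu]_(y in E) f (x, y)) \_ D) x.
  rewrite patchE; case: ifPn => xp.
    rewrite [RHS]integral_mkcond; apply: eq_integral => y _; rewrite /g !patchE.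
    congr (if _ then _ else _); apply/idP/idP; rewrite !inE/=; first by case.
    by move=> yp; split => //=; rewrite inE in xp.
  apply: integral0_eq => y _; rewrite /g patchE; case: ifPn => //.
  by rewrite inE => -[/= xp' _]; rewrite notin_setE in xp.
have gE2 y : \int[mu]_x g (x, y) = ((fun y => \int[mu]_(x in D) f (x, y)) \_ E) y.
  rewrite patchE; case: ifPn => yp.
    rewrite [RHS]integral_mkcond; apply: eq_integral => x _; rewrite /g !patchE.
    congr (if _ then _ else _); apply/idP/idP; rewrite !inE/=; first by case.
    by move=> xp; split => //=; rewrite inE in yp.
  apply: integral0_eq => x _; rewrite /g patchE; case: ifPn => //.
  by rewrite inE => -[/= _ yp']; rewrite notin_setE in yp.
under eq_integral do rewrite gE1.
under [in RHS]eq_integral do rewrite gE2.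
by rewrite -!integral_mkcond.
Qed.

Lemma pos_tonelli (f : R * R -> \bar R) : measurable_fun setT f ->
  (forall x y, (0 < x)%R -> (0 < y)%R -> 0 <= f (x, y)) ->
  \int[mu]_(x in pos) \int[mu]_(y in pos) f (x, y) =
  \int[mu]_(y in pos) \int[mu]_(x in pos) f (x, y).
Proof.
move=> mf f0; apply: set_tonelli; [exact: measurable_itv|exact: measurable_itv|exact: mf|].
by move=> x y /=; rewrite !in_itv/= !andbT; exact: f0.
Qed.

Lemma triangle_tonelli (f : R * R -> \bar R) : measurable_fun setT f ->
  (forall x y, (0 < x)%R -> (0 < y)%R -> 0 <= f (x, y)) ->
  \int[mu]_(x in pos) \int[mu]_(y in [set` `]0%R, x[]) f (x, y) =
  \int[mu]_(y in pos) \int[mu]_(x in [set` `]y, +oo[]) f (x, y).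
Proof.
move=> mf f0.
pose D := [set z : R * R | (z.2 < z.1)%R].
have mD : measurable D.
  rewrite (_ : D = (fun z => z.1 - z.2)%R @^-1` pos); last first.
    by apply/seteqP; split => z; rewrite /D /= in_itv/= andbT subr_gt0.
  rewrite -[X in measurable X]setTI.
  have : measurable_fun setT (fun z : R * R => z.1 - z.2)%R by mfun.
  by apply => //; exact: measurable_itv.
have h1 x : (0 < x)%R -> \int[mu]_(y in [set` `]0%R, x[]) f (x, y) =
    \int[mu]_(y in pos) (f \_ D) (x, y).
  move=> x0; rewrite integral_mkcond [RHS]integral_mkcond.
  apply: eq_integral => y _; rewrite !patchE -if_and.
  congr (if _ then _ else _); apply/idP/andP; rewrite !inE/= !in_itv/= andbT.
    by move=> /andP[].
  by case=> -> ->.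
have h2 y : (0 < y)%R -> \int[mu]_(x in [set` `]y, +oo[]) f (x, y) =
    \int[mu]_(x in pos) (f \_ D) (x, y).
  move=> y0; rewrite integral_mkcond [RHS]integral_mkcond.
  apply: eq_integral => x _; rewrite !patchE -if_and.
  congr (if _ then _ else _); apply/idP/andP; rewrite !inE/= !in_itv/= !andbT.
    by move=> yx; split => //; exact: lt_trans yx.
  by case.
transitivity (\int[mu]_(x in pos) \int[mu]_(y in pos) (f \_ D) (x, y)).
  by apply: eq_integral => x; rewrite inE/= in_itv/= andbT => /h1.
rewrite pos_tonelli; last 2 first.
- by apply/(measurable_restrictT _ _).1 => //; exact: measurable_funTS.
- by move=> x y x0 y0; rewrite patchE; case: ifP => // _; exact: f0.
by apply: eq_integral => y; rewrite inE/= in_itv/= andbT => /h2.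
Qed.

End TriangleTonelli.

Section RealIntegrals.
Context {R : realType}.
Local Notation mu := (@lebesgue_measure R).
Implicit Types (D : set R) (f g : R -> R).

Lemma eq_Rint D f g : (forall x, D x -> f x = g x) ->
  (\int[mu]_(x in D) (f x)%:E = \int[mu]_(x in D) (g x)%:E)%E.
Proof. by move=> fg; apply: eq_integral => x; rewrite inE => /fg ->. Qed.

Lemma Rint_Zl D f (k : R) : measurable D -> 0 <= k -> measurable_fun setT f ->
  (forall x, D x -> 0 <= f x) ->
  (\int[mu]_(x in D) (k * f x)%:E = k%:E * \int[mu]_(x in D) (f x)%:E)%E.
Proof.
move=> mD k0 mf f0; rewrite -ge0_integralZl//.
by apply/measurable_EFinP; exact: measurable_funTS.
Qed.

Lemma Rint_D D f g : measurable D -> measurable_fun setT f -> measurable_fun setT g ->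
  (forall x, D x -> 0 <= f x) -> (forall x, D x -> 0 <= g x) ->
  (\int[mu]_(x in D) (f x + g x)%:E =
   \int[mu]_(x in D) (f x)%:E + \int[mu]_(x in D) (g x)%:E)%E.
Proof.
move=> mD mf mg f0 g0; rewrite -ge0_integralD//.
  by apply/measurable_EFinP; exact: measurable_funTS.
by apply/measurable_EFinP; exact: measurable_funTS.
Qed.

Lemma Rint_le D f g : measurable D -> measurable_fun setT f -> measurable_fun setT g ->
  (forall x, D x -> 0 <= f x <= g x) ->
  (\int[mu]_(x in D) (f x)%:E <= \int[mu]_(x in D) (g x)%:E)%E.
Proof.
move=> mD mf mg fg; apply: ge0_le_integral => //.
- by move=> x /fg/andP[].
- by apply/measurable_EFinP; exact: measurable_funTS.
- by apply/measurable_EFinP; exact: measurable_funTS.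
- by move=> x /fg/andP[].
Qed.

Lemma Rint_subset D (E : set R) f : measurable D -> measurable E -> measurable_fun setT f ->
  (forall x, E x -> 0 <= f x) -> D `<=` E ->
  (\int[mu]_(x in D) (f x)%:E <= \int[mu]_(x in E) (f x)%:E)%E.
Proof.
move=> mD mE mf f0 DE; apply: ge0_subset_integral => //.
by apply/measurable_EFinP; exact: measurable_funTS.
Qed.

Lemma Rint_ge0 D f : (forall x, D x -> 0 <= f x) ->
  (0 <= \int[mu]_(x in D) (f x)%:E)%E.
Proof. by move=> f0; apply: integral_ge0 => x /f0; rewrite lee_fin. Qed.

End RealIntegrals.

Section FTC.
Context {R : realType}.
Local Notation mu := (@lebesgue_measure R).
Local Notation pos := [set` `](0 : R)%R, +oo[ ].

Lemma cvg_addr_invn (a c : R) : 0 < c -> (a + c / n.+2%:R) @[n --> \oo] --> a^'+.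
Proof.
move=> c0 A [e /= e0 Ae].
have : harmonic n.+1 @[n --> \oo] --> (0 : R).
  by rewrite (cvg_shiftS (@harmonic R)); exact: cvg_harmonic.
move/cvgrPdist_lt => /(_ (e / c)); rewrite divr_gt0// => /(_ isT) [N _ NP].
exists N => // n /= Nn; apply: Ae; last by rewrite /= ltrDl divr_gt0.
have := NP n Nn; rewrite /harmonic /= !sub0r !normrN opprD addrA subrr sub0r normrN.
rewrite !ger0_norm ?invr_ge0//; last by rewrite divr_ge0// ltW.
by rewrite ltr_pdivlMr// mulrC.
Qed.

Lemma powR_cvgy (p : R) : 0 < p -> x `^ (- p) @[x --> +oo] --> (0 : R).
Proof.
move=> p0; apply/cvgrPdist_le => e e0.
pose M := (e^-1) `^ (p^-1).
near=> x; have xM : M < x by near: x; apply: nbhs_pinfty_gt; rewrite num_real.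
have M0 : 0 < M by rewrite powR_gt0// invr_gt0.
have x0 : 0 < x by exact: lt_trans xM.
rewrite sub0r normrN ger0_norm ?powR_ge0// powRN invf_ple ?posrE ?powR_gt0//.
have -> : e^-1 = M `^ p.
  by rewrite /M -powRrM mulVf ?gt_eqF// powRr1// invr_ge0 ltW.
by apply: ge0_ler_powR; rewrite ?nnegrE ?ltW// (lt_trans M0).
Unshelve. all: by end_near. Qed.

Lemma ge0_FTC_oc (f F : R -> R) (a x l : R) : a < x ->
  (forall y, a < y -> 0 <= f y /\ {for y, continuous f} /\ is_derive y (1 : R) F (f y)) ->
  F y @[y --> a^'+] --> l ->
  (\int[mu]_(y in [set` `]a, x] ]) (f y)%:E = (F x - l)%:E)%E.
Proof.
move=> ax fF Fl; have xa : 0 < x - a by rewrite subr_gt0.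
apply: (@ge0_FTC_improper _ f F _ [set` `]a, +oo[] (fun n => a + (x - a) / n.+2%:R) (fun=> x)).
- exact: interval_open.
- by move=> y /=; rewrite !in_itv/= andbT => /andP[].
- by move=> y /=; rewrite in_itv/= andbT; exact: fF.
- move=> n; rewrite -ltrBrDl ltr_pdivrMr// ltr_pMr//; rewrite ltr1n//.
- move=> n; rewrite lerD2l ler_wpM2l ?(ltW xa)// lef_pV2 ?posrE// ler_nat//.
- by [].
- apply/seteqP; split => y /=; rewrite in_itv/=.
    move=> /andP[ay yx].
    have [N _ NP] : \forall n \near \oo, a + (x - a) / n.+2%:R < y.
      exact: (@cvg_addr_invn a (x - a) xa _ (nbhs_right_lt ay)).
    by exists N => //=; rewrite in_itv/= yx andbT ltW//; apply: NP => /=.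
  by move=> [n _ /=]; rewrite in_itv/= => /andP[h ->]; rewrite (lt_le_trans _ h)// ltrDl divr_gt0.
- exact: cvg_cst.
- by apply: cvg_comp Fl; exact: cvg_addr_invn.
Qed.

Lemma cvg_addr_natn (y : R) : (y + n.+1%:R) @[n --> \oo] --> +oo.
Proof.
apply/cvgryPge => A; near=> n; rewrite -lerBlDl.
apply: (@le_trans _ _ n%:R); last by rewrite ler_nat.
by near: n; exact: nbhs_infty_ger.
Unshelve. all: by end_near. Qed.

Lemma ge0_FTC_ray (f F : R -> R) (c y m : R) : c < y ->
  (forall x, c < x -> 0 <= f x /\ {for x, continuous f} /\ is_derive x (1 : R) F (f x)) ->
  F x @[x --> +oo] --> m ->
  (\int[mu]_(x in [set` `]y, +oo[]) (f x)%:E = (m - F y)%:E)%E.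
Proof.
move=> cy fF Fm; rewrite integral_itv_obnd_cbnd; last first.
  apply/measurable_EFinP; apply: open_continuous_measurable_fun; first exact: interval_open.
  move=> x; rewrite inE/= in_itv/= andbT => yx.
  by have [_ []] := fF x (lt_trans cy yx).
apply: (@ge0_FTC_improper _ f F _ [set` `]c, +oo[] (fun=> y) (fun n => y + n.+1%:R)).
- exact: interval_open.
- by move=> x /=; rewrite !in_itv/= !andbT; exact: lt_le_trans.
- by move=> x /=; rewrite in_itv/= andbT; exact: fF.
- by move=> n; rewrite ltrDl.
- by [].
- by move=> n; rewrite lerD2l ler_nat.
- apply/seteqP; split => x /=; rewrite in_itv/= andbT; last first.
    by move=> [n _ /=]; rewrite in_itv/= => /andP[].
  move=> yx; exists (Num.truncn (x - y)) => //=; rewrite in_itv/= yx/=.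
  by rewrite -lerBlDl ltW// truncnS_gt.
- by apply: cvg_comp Fm; exact: cvg_addr_natn.
- exact: cvg_cst.
Qed.

Lemma powR_continuous (p x : R) : 0 < x -> {for x, continuous (fun y => y `^ p)}.
Proof.
move=> x0; have [+ _] := is_derive_powR p x0.
by move/derivable1_diffP/differentiable_continuous.
Qed.

Lemma integral_powR_0 (p x : R) : 0 < p -> 0 < x ->
  (\int[mu]_(y in [set` `]0%R, x] ]) (y `^ (p - 1))%:E = (x `^ p / p)%:E)%E.
Proof.
move=> p0 x0; rewrite (@ge0_FTC_oc (fun y => y `^ (p - 1)) (fun y => y `^ p / p) 0 x 0)//.
- by rewrite subr0.
- move=> y y0; rewrite powR_ge0; split=> //; split; first exact: powR_continuous.
  have -> : (fun y => y `^ p / p) = p^-1 \*: (fun y : R => y `^ p).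
    by apply/funext => z; rewrite /= mulrC.
  apply: (is_derive_eq (is_deriveZ _ (is_derive_powR p y0))).
  by rewrite /GRing.scale/= mulrA mulVf ?mul1r// gt_eqF.
- by rewrite -[X in _ --> X](mul0r p^-1); apply: cvgMr_tmp; exact: powR_cvg0.
Qed.

Lemma integral_powR_y (p x : R) : 0 < p -> 0 < x ->
  (\int[mu]_(y in [set` `]x, +oo[]) (y `^ (- p - 1))%:E = (x `^ (- p) / p)%:E)%E.
Proof.
move=> p0 x0; rewrite (@ge0_FTC_ray (fun y => y `^ (- p - 1)) (fun y => - p^-1 * y `^ (- p)) 0 x 0); [|exact: x0| |].
- by rewrite sub0r mulNr opprK mulrC.
- move=> y y0; rewrite powR_ge0; split=> //; split; first exact: powR_continuous.
  have -> : (fun y => - p^-1 * y `^ (- p)) = (- p^-1) \*: (fun y : R => y `^ (- p)) by [].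
  apply: (is_derive_eq (is_deriveZ _ (is_derive_powR (- p) y0))).
  by rewrite /GRing.scale/= mulrA mulrNN mulVf ?mul1r// gt_eqF.
- by rewrite -[X in _ --> X](mulr0 (- p^-1)); apply: cvgMl_tmp; exact: powR_cvgy.
Qed.

Lemma pos_integral_lty (f : R -> R) (p q K : R) : 0 < p -> 0 < q ->
  measurable_fun setT f ->
  (forall x, 0 < x <= 1 -> 0 <= f x <= K * x `^ (p - 1)) ->
  (forall x, 1 < x -> 0 <= f x <= K * x `^ (- q - 1)) ->
  (\int[mu]_(x in pos) (f x)%:E < +oo)%E.
Proof.
move=> p0 q0 mf f1 f2.
have mfD D : measurable_fun D (EFin \o f) by exact/measurable_EFinP/measurable_funTS.
have -> : pos = [set` `]0, (1 : R)] ] `|` [set` `](1 : R), +oo[].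
  apply/seteqP; split => x /=; rewrite !in_itv/= !andbT; last first.
    by case=> [/andP[]//|]; exact: lt_trans.
  by move=> ->/=; case: (leP x 1); [left|right].
have K0 : 0 <= K.
  by have := f1 1; rewrite ltr01 lexx => /(_ isT) /andP[/le_trans h /h]; rewrite powR1 mulr1.
rewrite ge0_integral_setU//=; last 3 first.
- by apply/measurable_EFinP; exact: measurable_funTS.
- move=> x [|] /=; rewrite in_itv/= ?andbT => xx; rewrite lee_fin.
    by have /andP[] := f1 _ xx.
  by have /andP[] := f2 _ xx.
- rewrite disj_set2E; apply/eqP/seteqP; split => x //=; rewrite !in_itv/= andbT.
  by case=> /andP[_ x1] /(le_lt_trans x1); rewrite ltxx.
apply: lte_add_pinfty.
  apply: (@le_lt_trans _ _ (\int[mu]_(x in [set` `]0%R, 1%R] ]) (K * x `^ (p - 1))%:E)%E).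
    apply: Rint_le; [exact: measurable_itv|exact: mf|by mfun|].
    by move=> x; rewrite /= in_itv/= => /f1.
  rewrite (Rint_Zl _ K0) ?integral_powR_0//; last by move=> x _; exact: powR_ge0.
  by rewrite -EFinM ltry.
apply: (@le_lt_trans _ _ (\int[mu]_(x in [set` `]1%R, +oo[ ]) (K * x `^ (- q - 1))%:E)%E).
  apply: Rint_le; [exact: measurable_itv|exact: mf|by mfun|].
  by move=> x; rewrite /= in_itv/= andbT => /f2.
rewrite (Rint_Zl _ K0) ?integral_powR_y//; last by move=> x _; exact: powR_ge0.
by rewrite -EFinM ltry.
Qed.

End FTC.

(** * Gamma and beta integrals *)

Section GammaFunction.
Context {R : realType}.
Local Notation mu := (@lebesgue_measure R).
Local Notation pos := [set` `](0 : R)%R, +oo[ ].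
Implicit Types (s p q a b : R).

Lemma gamma_integral_lty s : 0 < s ->
  (\int[mu]_(t in pos) (t `^ (s - 1) * expR (- t))%:E < +oo)%E.
Proof.
move=> s0; pose n := (Num.truncn (s + 1)).
have sn : s + 1 <= n.+1%:R by rewrite ltW// truncnS_gt.
(* By the exponential series x^(n+1) <= K exp(x), and s + 1 <= n + 1, so beyond 1 the integrand is
   at most K x^(-2). *)
pose K : R := n.+1`!%:R.
have K1 : 1 <= K by rewrite ler1n fact_gt0.
apply: (@pos_integral_lty _ _ s 1 K) => //.
- by mfun.
- move=> x /andP[x0 x1]; rewrite mulr_ge0 ?powR_ge0 ?expR_ge0//= mulrC.
  rewrite ler_wpM2r ?powR_ge0// (le_trans _ K1)//.
  by rewrite expR_le1 oppr_le0 ltW.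
- move=> x x1; have x0 : 0 < x by rewrite (lt_trans _ x1).
  rewrite mulr_ge0 ?powR_ge0 ?expR_ge0//= expRN ler_pdivrMr ?expR_gt0//.
  have h : x `^ (s + 1) <= K * expR x.
    apply: (@le_trans _ _ (x ^+ n.+1)).
      by rewrite -powR_mulrn ?(ltW x0)//; apply: ler_powR => //; exact: ltW.
    have := expR_ge1Dxn n (ltW x0); rewrite -/K => h.
    rewrite mulrC -ler_pdivrMr; last by rewrite (lt_le_trans ltr01).
    by apply: le_trans h; rewrite lerDr.
  have -> : s - 1 = (s + 1) + (-1 - 1) by ring.
  rewrite powRD; last by rewrite (gt_eqF x0) implybT.
  by rewrite [leRHS]mulrAC ler_wpM2r ?powR_ge0.
Qed.

Lemma GammaE s : 0 < s ->
  (\int[mu]_(t in pos) (t `^ (s - 1) * expR (- t))%:E = (Gamma s)%:E)%E.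
Proof.
move=> s0; have -> : Gamma s = Gamma_int s.
  rewrite /Gamma; have -> : Num.truncn (1 - s) = 0%N.
    by apply/truncn0Pn; rewrite -ltNge; lra.
  by rewrite addr0 rising0 divr1.
rewrite /Gamma_int /Rintegral fineK// ge0_fin_numE ?gamma_integral_lty//.
by apply: integral_ge0 => x _; rewrite lee_fin mulr_ge0 ?powR_ge0 ?expR_ge0.
Qed.

Lemma Gamma_gt0 s : 0 < s -> 0 < Gamma s.
Proof.
move=> s0; rewrite -lte_fin -GammaE//.
pose c : R := Num.min (1 `^ (s - 1)) (2 `^ (s - 1)) * expR (- 2).
have c0 : 0 < c by rewrite mulr_gt0 ?expR_gt0// lt_min !powR_gt0.
have mf : measurable_fun setT (fun t => t `^ (s - 1) * expR (- t)) by mfun.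
apply: lt_le_trans (@Rint_subset _ [set` `](1 : R), 2] ] pos _ _ _ mf _ _) => //.
- apply: lt_le_trans (@Rint_le _ _ (fun=> c) _ _ _ mf _) => //.
    rewrite integral_cst//= lebesgue_measure_itv/= lte_fin ltr1n/=.
    by rewrite -EFinB -EFinM lte_fin mulr_gt0// subr_gt0 ltr1n.
  move=> x; rewrite /= in_itv/= => /andP[x1 x2]; rewrite (ltW c0)/=.
  apply: ler_pM.
  + by rewrite le_min !powR_ge0.
  + exact: expR_ge0.
  + rewrite ge_min; apply/orP; have [s1|s1] := leP 0 (s - 1).
      by left; apply: ge0_ler_powR; rewrite ?nnegrE//; lra.
    right; rewrite -[s - 1]opprK !(powRN _ (- (s - 1))) lef_pV2 ?posrE ?powR_gt0//; last lra.
    by apply: ge0_ler_powR; rewrite ?nnegrE//; lra.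
  + by rewrite ler_expR lerN2.
- by move=> x _; rewrite mulr_ge0 ?powR_ge0 ?expR_ge0.
- by move=> x /=; rewrite !in_itv/= andbT => /andP[x1 _]; rewrite (lt_trans _ x1).
Qed.

Lemma gamma_integral_rate s (theta : R) : 0 < s -> 0 < theta ->
  (\int[mu]_(t in pos) (t `^ (s - 1) * expR (- (theta * t)))%:E =
    (Gamma s * theta `^ (- s))%:E)%E.
Proof.
move=> s0 t0; have t1 : 0 < theta^-1 by rewrite invr_gt0.
rewrite (@ge0_integral_pos_scale _ theta^-1)//; last 2 first.
- by apply/measurable_EFinP; mfun.
- by move=> x x0; rewrite lee_fin mulr_ge0 ?powR_ge0 ?expR_ge0.
rewrite (@eq_Rint _ _ _ (fun t => theta `^ (- (s - 1)) * (t `^ (s - 1) * expR (- t)))); last first.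
  move=> x; rewrite /= in_itv/= andbT => x0.
  rewrite mulVKf ?gt_eqF// powRM ?(ltW x0) ?(ltW t1)// mulrA.
  by rewrite -[in LHS]powR_inv1 ?(ltW t0)// -powRrM mulN1r.
rewrite Rint_Zl ?powR_ge0//; last 2 first.
- by mfun.
- by move=> x _; rewrite mulr_ge0 ?powR_ge0 ?expR_ge0.
rewrite GammaE// -!EFinM; congr (_%:E).
rewrite mulrA -powR_inv1 ?(ltW t0)// -powRD; last by rewrite (gt_eqF t0) implybT.
by rewrite mulrC; congr (_ * _ `^ _); ring.
Qed.

(** Substituting y = x z and integrating out x leaves a Gamma integral of order A + B and rate t1 +
    t2 z. This reduces expectations under the product law to integrals over the ratio z. *)
Lemma polar (A B t1 t2 : R) (h : R -> R) : 0 < A + B -> 0 < t1 -> 0 < t2 ->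
  measurable_fun setT h -> (forall z, 0 < z -> 0 <= h z) ->
  (\int[mu]_(x in pos) \int[mu]_(y in pos)
     (x `^ (A - 1) * y `^ (B - 1) * h (y / x) * expR (- (t1 * x + t2 * y)))%:E =
   (Gamma (A + B))%:E * \int[mu]_(z in pos)
     (h z * z `^ (B - 1) * (t1 + t2 * z) `^ (- (A + B)))%:E)%E.
Proof.
move=> AB0 t10 t20 mh h0.
transitivity (\int[mu]_(x in pos) \int[mu]_(z in pos)
  (x `^ (A + B - 1) * z `^ (B - 1) * h z * expR (- ((t1 + t2 * z) * x)))%:E)%E.
  apply: eq_integral => x; rewrite inE/= in_itv/= andbT => x0.
  rewrite (@ge0_integral_pos_scale _ x)//; last 2 first.
  - apply/measurable_EFinP; mfun.
    apply: (measurableT_comp mh); mfun.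
  - by move=> y y0; rewrite lee_fin !mulr_ge0 ?powR_ge0 ?expR_ge0// h0 ?divr_gt0.
  rewrite -ge0_integralZl//=; last 3 first.
  - apply/measurable_EFinP; mfun; apply: (measurableT_comp mh); mfun.
  - move=> y; rewrite in_itv/= andbT => y0.
    by rewrite lee_fin !mulr_ge0 ?powR_ge0 ?expR_ge0// h0 ?divr_gt0 ?mulr_gt0.
  - by rewrite lee_fin ltW.
  apply: eq_integral => z; rewrite inE/= in_itv/= andbT => z0.
  rewrite -EFinM; congr (_%:E); rewrite (_ : x * z / x = z); last by field; rewrite gt_eqF.
  rewrite powRM ?(ltW x0) ?(ltW z0)//.
  have -> : t1 * x + t2 * (x * z) = (t1 + t2 * z) * x by ring.
  have -> : x `^ (A + B - 1) = x * x `^ (A - 1) * x `^ (B - 1).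
    rewrite -mulrA -powRD ?(gt_eqF x0) ?implybT//.
    by rewrite (_ : A - 1 + (B - 1) = (A + B - 1) - 1) ?powR_split//; ring.
  by ring.
rewrite (@pos_tonelli _ (fun u => (u.1 `^ (A + B - 1) * u.2 `^ (B - 1) * h u.2 *
   expR (- ((t1 + t2 * u.2) * u.1)))%:E))/=; last 2 first.
- by apply/measurable_EFinP; mfun; apply: (measurableT_comp mh); mfun.
- by move=> x y x0 y0; rewrite lee_fin !mulr_ge0 ?powR_ge0 ?expR_ge0 ?h0.
rewrite -ge0_integralZl//=; last 3 first.
- by apply/measurable_EFinP; mfun; exact: measurable_funTS.
- by move=> y; rewrite in_itv/= andbT => y0; rewrite lee_fin !mulr_ge0 ?powR_ge0 ?h0.
- by rewrite lee_fin ltW// Gamma_gt0.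
apply: eq_integral => z; rewrite inE/= in_itv/= andbT => z0.
have tz : 0 < t1 + t2 * z by rewrite addr_gt0// mulr_gt0.
rewrite (@eq_Rint _ _ _ (fun x => (z `^ (B - 1) * h z) *
   (x `^ (A + B - 1) * expR (- ((t1 + t2 * z) * x))))); last by move=> x _; ring.
rewrite Rint_Zl ?mulr_ge0 ?powR_ge0 ?h0//; last 2 first.
- by mfun.
- by move=> x _; rewrite mulr_ge0 ?powR_ge0 ?expR_ge0.
by rewrite gamma_integral_rate// -!EFinM; congr (_%:E); ring.
Qed.

(** This is [polar] with [h = 1], whose left side factors into two Gamma integrals. *)
Lemma beta_integral p q (t1 t2 : R) : 0 < p -> 0 < q -> 0 < t1 -> 0 < t2 ->
  (\int[mu]_(z in pos) (z `^ (p - 1) * (t1 + t2 * z) `^ (- (p + q)))%:E =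
   (Gamma p * Gamma q / Gamma (p + q) * t2 `^ (- p) * t1 `^ (- q))%:E)%E.
Proof.
move=> p0 q0 t10 t20.
have pq0 : 0 < q + p by rewrite addr_gt0.
have G0 := Gamma_gt0 pq0.
have := @polar q p t1 t2 (cst 1) pq0 t10 t20 ltac:(by []) ltac:(by []).
have inner x : 0 < x -> (\int[mu]_(y in pos)
     (x `^ (q - 1) * y `^ (p - 1) * cst 1 (y / x) * expR (- (t1 * x + t2 * y)))%:E =
    (Gamma p * t2 `^ (- p) * (x `^ (q - 1) * expR (- (t1 * x))))%:E)%E.
  move=> x0; rewrite (@eq_Rint _ _ _ (fun y => (x `^ (q - 1) * expR (- (t1 * x))) *
    (y `^ (p - 1) * expR (- (t2 * y))))); last first.
    by move=> y _; rewrite opprD expRD /=; ring.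
  rewrite Rint_Zl ?mulr_ge0 ?powR_ge0 ?expR_ge0//; last 2 first.
  - by mfun.
  - by move=> y _; rewrite mulr_ge0 ?powR_ge0 ?expR_ge0.
  by rewrite gamma_integral_rate// -EFinM mulrC.
under eq_integral => x.
  rewrite inE/= in_itv/= andbT => x0; rewrite inner//; over.
rewrite Rint_Zl//; last 3 first.
- by rewrite mulr_ge0 ?powR_ge0 ?(ltW (Gamma_gt0 p0)).
- by mfun.
- by move=> y _; rewrite mulr_ge0 ?powR_ge0 ?expR_ge0.
rewrite gamma_integral_rate// => h.
rewrite (@eq_Rint _ _ _ (fun z => cst 1 z * z `^ (p - 1) * (t1 + t2 * z) `^ (- (q + p)))); last first.
  by move=> z _; rewrite mul1r [q + p]addrC.
transitivity ((Gamma (q + p))^-1%:E *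
    ((Gamma p * t2 `^ (- p))%:E * (Gamma q * t1 `^ (- q))%:E))%E.
  by rewrite h muleA -EFinM mulVf ?gt_eqF// mul1e.
by rewrite -!EFinM [p + q]addrC; congr (_%:E); field; rewrite gt_eqF.
Qed.

Lemma Gamma1 : Gamma 1 = 1 :> R.
Proof.
apply: EFin_inj; rewrite -GammaE// (@eq_Rint _ _ _ (fun t => expR (- t))); last first.
  by move=> x; rewrite /= in_itv/= andbT => x0; rewrite subrr powRr0 mul1r.
rewrite (@ge0_FTC_ray _ (fun t => expR (- t)) (fun t => - expR (- t)) (-1) 0 0)//.
- by rewrite sub0r opprK oppr0 expR0.
- move=> x _; rewrite expR_ge0; split => //.
  have d : is_derive x (1 : R) (fun t => expR (- t)) (- expR (- x)).
    by apply: is_derive_eq; rewrite /GRing.scale/= mulrN1.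
  split; last by apply: (is_derive_eq (is_deriveN d)); rewrite opprK.
  by case: d => /derivable1_diffP/differentiable_continuous.
- by rewrite -[X in _ --> X]oppr0; apply: cvgN; exact: cvgr_expR.
Qed.

(** No integration by parts: the beta integral with p = 1 has an elementary antiderivative and
    equals 1 / s, while its general value is Gamma s / Gamma (s + 1). *)
Lemma GammaS s : 0 < s -> Gamma (s + 1) = s * Gamma s.
Proof.
move=> s0; have := @beta_integral 1 s 1 1 ltr01 s0 ltr01 ltr01.
rewrite (@eq_Rint _ _ _ (fun z => (1 + z) `^ (- s - 1))); last first.
  by move=> z _; rewrite subrr powRr0 !mul1r; congr (_ `^ _); ring.
rewrite (@ge0_FTC_ray _ (fun t => (1 + t) `^ (- s - 1)) (fun t => - s^-1 * (1 + t) `^ (- s)) (-1) 0 0)//.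
- rewrite !powR1 !mulr1 addr0 powR1 sub0r mulr1 opprK Gamma1 mul1r [1 + s]addrC => -[] h.
  have G0 : Gamma (s + 1) != 0 by rewrite gt_eqF// Gamma_gt0// addr_gt0.
  have := congr1 (fun t => t * s * Gamma (s + 1)) h.
  rewrite mulVf ?gt_eqF// mul1r => ->.
  by field.
- move=> x x1; have x10 : 0 < 1 + x by lra.
  have d a : is_derive x (1 : R) (fun t => (1 + t) `^ a) (a * (1 + x) `^ (a - 1)).
    have d1 : is_derive x (1 : R) (fun t => 1 + t) 1.
      have -> : (fun t => 1 + t) = cst 1 + id :> (R -> R) by [].
      by apply: is_derive_eq; rewrite add0r.
    apply: (is_derive_eq (@is_derive1_comp _ (fun y => y `^ a) (fun t => 1 + t) x _ _ (is_derive_powR a x10) d1)).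
    by rewrite mulr1.
  rewrite powR_ge0; split=> //; split.
    by have [/derivable1_diffP/differentiable_continuous] := d (- s - 1).
  have -> : (fun t => - s^-1 * (1 + t) `^ (- s)) = (- s^-1) \*: (fun t : R => (1 + t) `^ (- s)) by [].
  apply: (is_derive_eq (is_deriveZ _ (d (- s)))).
  by rewrite /GRing.scale/= mulrA mulrNN mulVf ?mul1r// gt_eqF.
- rewrite -[X in _ --> X](mulr0 (- s^-1)); apply: cvgMl_tmp.
  apply: (@cvg_comp _ _ _ (fun t => 1 + t) (fun t => t `^ (- s))); last exact: powR_cvgy.
  apply/cvgryPge => A; near=> x; rewrite -lerBlDl.
  by near: x; apply: nbhs_pinfty_ge; rewrite num_real.
Unshelve. all: by end_near. Qed.

End GammaFunction.

(** * Stieltjes transforms of hypergeometric kernels *)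

Section IncompleteBeta.
Context {R : realType}.
Local Notation mu := (@lebesgue_measure R).
Local Notation pos := [set` `](0 : R)%R, +oo[ ].
Implicit Types (N p q z u : R).

Lemma is_derive_cD (c y : R) : is_derive y (1 : R) (fun t => c + t) 1.
Proof.
have -> : (fun t => c + t) = cst c + id :> (R -> R) by [].
by apply: is_derive_eq; rewrite add0r.
Qed.

Lemma is_derive_cDpowR (c a y : R) : 0 < c + y ->
  is_derive y (1 : R) (fun t => (c + t) `^ a) (a * (c + y) `^ (a - 1)).
Proof.
move=> y1.
apply: (is_derive_eq (@is_derive1_comp _ (fun y => y `^ a) (fun t => c + t) y _ _
  (is_derive_powR a y1) (is_derive_cD c y))).
by rewrite mulr1.
Qed.

Lemma is_derive_continuous (f : R -> R) (y d : R) : is_derive y (1 : R) f d ->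
  {for y, continuous f}.
Proof. by case=> /derivable1_diffP/differentiable_continuous. Qed.

Lemma is_derive_div1D (y : R) : 0 < 1 + y ->
  is_derive y (1 : R) (fun t => t / (1 + t)) ((1 + y) ^- 2).
Proof.
move=> y1; have dV := is_deriveV (lt0r_neq0 y1) (is_derive_cD 1 y).
apply: (is_derive_eq (is_deriveM (is_derive_id (y : R) (1 : R)) dV)).
by rewrite /GRing.scale /=; field; rewrite gt_eqF.
Qed.

Lemma pser_cv_tail (c : R^nat) (r : R) (f : R -> R) : 0 < r -> pser_cv c r f ->
  exists2 h : R -> R, pser_cv (fun n => c n.+1) r h &
    forall x, `|x| < r -> f x = c 0%N + x * h x.
Proof.
move=> r0 cf; pose c' n := if n is n'.+1 then c n else 0.
have cf' : pser_cv c' r (fun x => f x - c 0%N).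
  move=> x xr; rewrite -cvg_shiftS.
  have -> : (fun n => pseries c' x n.+1) = (fun n => pseries c x n.+1 - c 0%N).
    apply/funext => n; rewrite /pseries /series /= !big_nat_recl//= mul0r add0r expr0 mulr1.
    by rewrite addrAC subrr add0r.
  apply: cvgB; last exact: cvg_cst.
  by rewrite (cvg_shiftS (pseries c x)); exact: cf.
have [|h hc hf] := @pser_cv_shift _ c' r _ 1 r0 cf'; first by case.
exists h => [x xr|x xr].
  by have := hc x xr; rewrite (_ : (fun n => c' (n + 1)%N) = (fun n => c n.+1))//; apply/funext => n; rewrite addn1.
by have := hf x xr; rewrite expr1 => <-; rewrite addrC subrK.
Qed.

Lemma hyp2F1_1_coef N p n : 0 < p ->
  hyp2F1_coef 1 N p n = rising N n / rising p n.
Proof.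
move=> p0; rewrite /hyp2F1_coef rising1.
have h2 : n`!%:R != 0 :> R by rewrite pnatr_eq0 -lt0n fact_gt0.
by field; rewrite h2 rising_neq0.
Qed.

(** The upper parameter 1 cancels the factorial, so the coefficients satisfy (p + n) g (n+1) = (N +
    n) g n, and the hypergeometric equation drops to an inhomogeneous equation of first order. *)
Lemma hyp2F1_1_ode N p u : 0 < p -> `|u| < 1 -> exists2 d : R,
  is_derive u (1 : R) (hyp2F1 1 N p) d &
  u * (1 - u) * d + (p - 1 - N * u) * hyp2F1 1 N p u = p - 1.
Proof.
move=> p0 u1; set g := hyp2F1_coef 1 N p; set G := hyp2F1 1 N p.
have gG : pser_cv g 1 G by move=> x x1; exact: hyp2F1_gauss.
exists (limn (pseries (pseries_diffs g) u)); first exact: pser_cv_is_derive gG u1.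
set d := limn _.
have gS n : (p + n%:R) * g n.+1 = (N + n%:R) * g n.
  rewrite /g !hyp2F1_1_coef// !risingS.
  have h1 := rising_neq0 n p0.
  have h2 : p + n%:R != 0 by rewrite gt_eqF// ltr_pwDl.
  by field; rewrite h1 h2.
have th := pser_cv_theta gG u1; rewrite -/d in th.
have A : (fun n => pseries (fun n => n%:R * g n) u n + (p - 1) * pseries g u n - (p - 1))
    @ \oo --> u * d + (p - 1) * G u - (p - 1).
  apply: cvgB; last exact: cvg_cst.
  by apply: cvgD; [exact: th|apply: cvgMl_tmp; exact: gG].
have B : (fun n => u * (N * pseries g u n + pseries (fun n => n%:R * g n) u n))
    @ \oo --> u * (N * G u + u * d).
  apply: cvgMl_tmp; apply: cvgD; last exact: th.
  by apply: cvgMl_tmp; exact: gG.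
rewrite -cvg_shiftS in A.
have E : u * d + (p - 1) * G u - (p - 1) = u * (N * G u + u * d).
  rewrite -(cvg_lim _ A)// -(cvg_lim _ B)//; congr (limn _); apply/funext => n.
  rewrite /pseries /series /= !big_nat_recl//= mul0r mul0r add0r expr0 mulr1.
  have -> : g 0%N = 1 by rewrite /g hyp2F1_1_coef// !rising0 divr1.
  rewrite mulrDr mulr1 addrCA addrAC subrr add0r !mulr_sumr -!big_split/= mulr_sumr.
  apply: eq_bigr => i _; rewrite exprS.
  have := gS i; rewrite -natr1 => h.
  have -> : u * (N * (g i * u ^+ i) + i%:R * g i * u ^+ i) = u * u ^+ i * ((N + i%:R) * g i) by ring.
  by rewrite -h; ring.
have -> : u * (1 - u) * d + (p - 1 - N * u) * G u =
    (u * d + (p - 1) * G u - (p - 1)) - u * (N * G u + u * d) + (p - 1) by ring.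
by rewrite E subrr add0r.
Qed.

(** Closed form of the incomplete beta integral in [incbetaE], arranged so that it can be solved for
    F(1, p - N + 1; p; -z), as is done in [kernel_funE]. *)
Definition incbeta N p z : R :=
  (1 + z) `^ (1 - N) * z `^ (p - 1) * ((1 + z) * hyp2F1 1 (p - N + 1) p (- z) - 1) / (N - 1).

Lemma incbeta_pfaff N p z : 0 < p -> 0 < z ->
  (1 + z) * hyp2F1 1 (p - N + 1) p (- z) = hyp2F1 1 (N - 1) p (z / (1 + z)).
Proof.
move=> p0 z0; have z1 : 0 < 1 + z by lra.
rewrite hyp2F1_pfaff//; last lra.
rewrite opprK powR_inv1 ?(ltW z1)// mulrA mulfV ?gt_eqF// mul1r.
have -> : p - (p - N + 1) = N - 1 by ring.
congr (hyp2F1 _ _ _ _).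
by rewrite -opprD invrN mulrNN [z + 1]addrC.
Qed.

(** In Pfaff's variable z / (1 + z) the derivative of the closed form is computed from the
    first-order equation [hyp2F1_1_ode]. The lower end 0 is reached by a limit, since z^(p-1) may
    blow up there. *)
Lemma incbetaE N p z : 1 < N -> 0 < p -> 0 < z ->
  (\int[mu]_(s in [set` `]0%R, z] ]) (s `^ (p - 1) * (1 + s) `^ (- N))%:E =
   (incbeta N p z)%:E)%E.
Proof.
move=> N1 p0 z0.
pose G := hyp2F1 1 (N - 1) p.
pose F (z : R) := (N - 1)^-1 * ((1 + z) `^ (1 - N) * (z `^ (p - 1) * (G (z / (1 + z)) - 1))).
have FE y : 0 < y -> F y = incbeta N p y.
  by move=> y0; rewrite /incbeta incbeta_pfaff// /F -/G; ring.
rewrite (@ge0_FTC_oc _ (fun s => s `^ (p - 1) * (1 + s) `^ (- N)) F 0 z 0)//.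
- by rewrite subr0 FE.
- move=> y y0; have y1 : 0 < 1 + y by lra.
  rewrite mulr_ge0 ?powR_ge0; split => //.
  have d1 := is_derive_cD 1 y.
  have d2 a := @is_derive_cDpowR 1 a y y1.
  split.
    apply: (@continuousM _ _ (fun s : R => s `^ (p - 1)) (fun s : R => (1 + s) `^ (- N))).
      exact: powR_continuous.
    exact: is_derive_continuous (d2 (- N)).
  have u1 : `|y / (1 + y)| < 1.
    by rewrite ger0_norm ?divr_ge0 ?(ltW y0) ?(ltW y1)// ltr_pdivrMr//; lra.
  have [d dG ode] := hyp2F1_1_ode (N - 1) p0 u1.
  have d3 := is_derive_div1D y1.
  have d4 := @is_derive1_comp _ G (fun t => t / (1 + t)) y _ _ dG d3.
  have d5 : is_derive y (1 : R) (fun t => G (t / (1 + t)) - 1) (d * (1 + y) ^- 2).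
    have -> : (fun t => G (t / (1 + t)) - 1) = (G \o (fun t => t / (1 + t))) - cst 1 by [].
    have dc : is_derive y (1 : R) (cst 1 : R -> R) 0 by exact: is_derive_cst.
    by apply: (is_derive_eq (is_deriveB d4 dc)); rewrite subr0.
  have d6 := is_deriveM (is_derive_powR (p - 1) y0) d5.
  have d7 := is_deriveZ (N - 1)^-1 (is_deriveM (d2 (1 - N)) d6).
  apply: (is_derive_eq d7); rewrite /GRing.scale /= !fctE /=.
  have Y p' : y `^ (p' - 1) = y * y `^ (p' - 1 - 1) by rewrite powR_split.
  have Z : (1 + y) `^ (1 - N) = (1 + y) * (1 + y) `^ (- N).
    by rewrite -(powR_split (1 - N) y1); congr (_ * _ `^ _); ring.
  have Z' : (1 + y) `^ (1 - N - 1) = (1 + y) `^ (- N) by congr (_ `^ _); ring.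
  rewrite Z' Z (Y p).
  set W := y `^ (p - 1 - 1); set V := (1 + y) `^ (- N).
  move: ode; rewrite -/G; set Gu := G _ => ode.
  have N10 : N - 1 != 0 by rewrite gt_eqF//; lra.
  have y10 : 1 + y != 0 by rewrite gt_eqF.
  have ode' : y * d = (1 + y) ^+ 2 * (p - 1 - (p - 1 - (N - 1) * (y / (1 + y))) * Gu).
    by rewrite -[p - 1 in X in _ * (X - _)]ode; field.
  have -> : (N - 1)^-1 * ((1 + y) * V * (y * W * (d * (1 + y) ^- 2) + (Gu - 1) * ((p - 1) * W)) +
     y * W * (Gu - 1) * ((1 - N) * V)) = (N - 1)^-1 * V * W *
      ((1 + y)^-1 * (y * d) + (1 + y) * ((Gu - 1) * (p - 1)) + y * (Gu - 1) * (1 - N)).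
    by field; rewrite N10 y10.
  by rewrite ode'; field; rewrite N10 y10.
(* [G - 1] vanishes at 0 and supplies a factor y / (1 + y), which turns y^(p-1) into y^p. *)
- have gG : pser_cv (hyp2F1_coef 1 (N - 1) p) 1 G by move=> x; exact: hyp2F1_gauss.
  have [h hG Gh] := pser_cv_tail ltr01 gG.
  have g0 : hyp2F1_coef 1 (N - 1) p 0 = 1 by rewrite hyp2F1_1_coef// !rising0 divr1.
  pose k y := (N - 1)^-1 * (1 + y) `^ (- N) * h (y / (1 + y)) * y `^ p.
  apply: (@cvg_trans _ (k y @[y --> 0^'+])).
    apply: near_eq_cvg; near=> y.
    have y0 : 0 < y by near: y; exact: nbhs_right_gt.
    have y1 : 0 < 1 + y by lra.
    have u1 : `|y / (1 + y)| < 1.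
      by rewrite ger0_norm ?divr_ge0 ?(ltW y0) ?(ltW y1)// ltr_pdivrMr//; lra.
    rewrite /k /F Gh// g0 addrAC subrr add0r.
    rewrite -(powR_split p y0) -(powR_split (1 - N) y1).
    by rewrite (_ : 1 - N - 1 = - N); [field; rewrite !gt_eqF//; lra|ring].
  have d3 := @is_derive_div1D 0 ltac:(by rewrite addr0).
  have hc : {for (0 : R) / (1 + 0), continuous h}.
    by rewrite mul0r; apply: (pser_cv_continuous hG); rewrite normr0.
  have d2 := @is_derive_cDpowR 1 (- N) 0 ltac:(by rewrite addr0).
  suff : k y @[y --> 0^'+] --> (N - 1)^-1 * (1 + 0) `^ (- N) * h (0 / (1 + 0)) * 0.
    by rewrite mulr0.
  apply: cvgM; last exact: powR_cvg0.
  apply: cvg_at_right_filter; apply: cvgM.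
    by apply: cvgMl_tmp; exact: is_derive_continuous d2.
  exact: (continuous_comp (is_derive_continuous d3) hc).
Unshelve. all: by end_near. Qed.

End IncompleteBeta.

(** * The kernels and their Stieltjes transforms *)

Section StieltjesKernel.
Context {R : realType}.
Local Notation mu := (@lebesgue_measure R).
Local Notation pos := [set` `](0 : R)%R, +oo[ ].
Implicit Types (N p q z u s : R).

(** With N = alpha1 + alpha2 - 1, the choices p = alpha2 and p = alpha2 + nu give the two
    hypergeometric functions of the estimator up to powers of z. The common [N] makes their
    transforms and their growth comparable. *)
Definition kernel_fun N p z : R := z `^ (p - 1) * hyp2F1 1 (p - N + 1) p (- z).

Lemma measurable_kernel_fun N p : 0 < p -> measurable_fun setT (kernel_fun N p).
Proof.
move=> p0; rewrite /kernel_fun; mfun.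
by apply: (measurableT_comp (measurable_hyp2F1 _ _ p0)); mfun.
Qed.

Lemma measurable_incbeta N p : 0 < p -> measurable_fun setT (incbeta N p).
Proof.
move=> p0; rewrite /incbeta; mfun.
by apply: (measurableT_comp (measurable_hyp2F1 _ _ p0)); mfun.
Qed.

Lemma incbeta_ge0 N p z : 1 < N -> 0 < p -> 0 < z -> 0 <= incbeta N p z.
Proof.
move=> N1 p0 z0; rewrite -lee_fin -incbetaE//; apply: Rint_ge0 => x _.
by rewrite mulr_ge0 ?powR_ge0.
Qed.

(** Both summands are nonnegative for N > 1, and the second contains an integral over ]0, z], which
    is the one exchanged in [stieltjes_kernel]. *)
Lemma kernel_funE N p z : 1 < N -> 0 < z -> kernel_fun N p z =
  (1 + z)^-1 * z `^ (p - 1) + (N - 1) * (1 + z) `^ (N - 2) * incbeta N p z.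
Proof.
move=> N1 z0; have z1 : 0 < 1 + z by lra.
have E : (1 + z) `^ (N - 2) * (1 + z) `^ (1 - N) = (1 + z)^-1.
  rewrite -powRD ?(gt_eqF z1) ?implybT// -powR_inv1 ?(ltW z1)//.
  by congr (_ `^ _); ring.
rewrite /kernel_fun /incbeta.
set H := hyp2F1 _ _ _ _; set W := z `^ _.
have -> : (N - 1) * (1 + z) `^ (N - 2) * ((1 + z) `^ (1 - N) * W * ((1 + z) * H - 1) / (N - 1)) =
   ((1 + z) `^ (N - 2) * (1 + z) `^ (1 - N)) * W * ((1 + z) * H - 1).
  by field; rewrite gt_eqF//; lra.
by rewrite E; field; rewrite gt_eqF.
Qed.

Lemma kernel_fun_ge0 N p z : 1 < N -> 0 < p -> 0 < z -> 0 <= kernel_fun N p z.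
Proof.
move=> N1 p0 z0; rewrite kernel_funE// addr_ge0// mulr_ge0 ?powR_ge0 ?invr_ge0 ?incbeta_ge0//; first lra.
by rewrite mulr_ge0 ?powR_ge0//; lra.
Qed.

Lemma is_derive_aff (c k y : R) : is_derive y (1 : R) (fun t => c + k * t) k.
Proof.
have -> : (fun t => c + k * t) = cst c + (k \*: id) :> (R -> R) by [].
by apply: is_derive_eq; rewrite add0r /GRing.scale/= mulr1.
Qed.

Lemma is_derive_affpowR (c k a y : R) : 0 < c + k * y ->
  is_derive y (1 : R) (fun t => (c + k * t) `^ a) (k * a * (c + k * y) `^ (a - 1)).
Proof.
move=> y1; have d1 := is_derive_aff c k y.
apply: (is_derive_eq (@is_derive1_comp _ (fun y => y `^ a) (fun t => c + k * t) y _ _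
  (is_derive_powR a y1) d1)).
ring.
Qed.

Lemma affine_gt0 (z t : R) : 0 < z -> 0 <= t <= 1 -> 0 < 1 + (z - 1) * t.
Proof. by move=> z0 /andP[t0 t1]; nra. Qed.

(* The factor q - 1 covers the logarithmic case q = 1. *)
Lemma integral_affpowR (z q : R) : 0 < z -> z != 1 -> exists2 m : R,
  (\int[mu]_(t in [set` `[0%R, 1%R] ]) ((1 + (z - 1) * t) `^ (- q))%:E = m%:E)%E &
  (q - 1) * m = (1 - z `^ (1 - q)) / (z - 1).
Proof.
move=> z0 z1; have z10 : z - 1 != 0 by rewrite subr_eq0.
have c0 t : 0 <= t <= 1 -> 0 < 1 + (z - 1) * t by exact: affine_gt0.
have cont t : 0 <= t <= 1 -> {for t, continuous (fun t => (1 + (z - 1) * t) `^ (- q))}.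
  by move=> t01; exact: is_derive_continuous (@is_derive_affpowR 1 (z - 1) (- q) t (c0 t t01)).
have [q1|q1] := eqVneq q 1.
  exists (((z - 1)^-1 * ln (1 + (z - 1) * 1)) - ((z - 1)^-1 * ln (1 + (z - 1) * 0))).
    rewrite (@FTC_cc _ _ (fun t => (z - 1)^-1 * ln (1 + (z - 1) * t)));
      [by []|exact: ltr01|move=> t t01; split; first exact: cont].
    have d1 := is_derive_aff 1 (z - 1) t.
    have d2 := @is_derive1_comp _ (@ln R) (fun t => 1 + (z - 1) * t) t _ _ (is_derive1_ln (c0 t t01)) d1.
    have d3 : is_derive t (1 : R) (fun t => (z - 1)^-1 * ln (1 + (z - 1) * t))
        ((z - 1)^-1 *: ((1 + (z - 1) * t)^-1 * (z - 1))) by exact: is_deriveZ.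
    apply: (is_derive_eq d3); rewrite /GRing.scale /= q1 powR_inv1 ?(ltW (c0 t t01))//.
    by field; rewrite z10 gt_eqF ?c0.
  by rewrite q1 subrr mul0r powRr0 subrr mul0r.
have q10 : 1 - q != 0 by rewrite subr_eq0 eq_sym.
pose F t := ((z - 1) * (1 - q))^-1 * (1 + (z - 1) * t) `^ (1 - q).
exists (F 1 - F 0).
  rewrite (@FTC_cc _ _ F)// => t t01; split; first exact: cont.
  have d3 : is_derive t (1 : R) F (((z - 1) * (1 - q))^-1 *:
     ((z - 1) * (1 - q) * (1 + (z - 1) * t) `^ (1 - q - 1))).
    by apply: is_deriveZ; exact: is_derive_affpowR (c0 t t01).
  apply: (is_derive_eq d3); rewrite /GRing.scale/= (_ : 1 - q - 1 = - q); last by ring.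
  by field; rewrite z10 q10.
rewrite /F !mulr1 mulr0 addr0 subrKC powR1; field.
by rewrite z10 q10.
Qed.

Lemma cvg_mobius_y (z : R) : (1 + x) / (z + x) @[x --> +oo] --> (1 : R).
Proof.
have h : (1 - z) * (z + x)^-1 @[x --> +oo] --> (1 - z) * 0.
  apply: cvgMl_tmp; apply/gtr0_cvgV0.
    by near=> x; rewrite -ltrBlDl sub0r; near: x; apply: nbhs_pinfty_gt; rewrite num_real.
  apply/cvgryPge => A; near=> x; rewrite -lerBlDl.
  by near: x; apply: nbhs_pinfty_ge; rewrite num_real.
suff : 1 + (1 - z) * (z + x)^-1 @[x --> +oo] --> 1 + (1 - z) * 0.
  rewrite mulr0 addr0; apply: cvg_trans; apply: near_eq_cvg; near=> x.
  have zx : 0 < z + x.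
    by rewrite -ltrBlDl sub0r; near: x; apply: nbhs_pinfty_gt; rewrite num_real.
  by field; rewrite gt_eqF.
by apply: cvgD; [exact: cvg_cst|exact: h].
Unshelve. all: by end_near. Qed.

Lemma integral_mobius_ray N (z s : R) : 1 < N -> 0 < z -> z != 1 -> 0 < s ->
  (\int[mu]_(x in [set` `]s, +oo[ ]) ((N - 1) * (1 + x) `^ (N - 2) * (z + x) `^ (- N))%:E =
   ((1 - (1 + s) `^ (N - 1) * (z + s) `^ (1 - N)) / (z - 1))%:E)%E.
Proof.
move=> N1 z0 z1 s0; have z10 : z - 1 != 0 by rewrite subr_eq0.
pose F x := (z - 1)^-1 * ((1 + x) `^ (N - 1) * (z + x) `^ (1 - N)).
rewrite (@ge0_FTC_ray _ (fun x => (N - 1) * (1 + x) `^ (N - 2) * (z + x) `^ (- N)) F 0 s (z - 1)^-1); [|exact: s0| |].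
- by rewrite /F; congr (_%:E); ring.
- move=> x x0; have x1 : 0 < 1 + x by lra.
  have zx : 0 < z + x by lra.
  split.
    apply: mulr_ge0 (powR_ge0 _ _); apply: mulr_ge0 (powR_ge0 _ _); lra.
  have d1 a := @is_derive_cDpowR _ 1 a x x1.
  have d2 a := @is_derive_cDpowR _ z a x zx.
  split.
    apply: (@continuousM _ _ (fun x : R => (N - 1) * (1 + x) `^ (N - 2)) (fun x : R => (z + x) `^ (- N))).
      apply: (@continuousM _ _ (cst (N - 1) : R -> R) (fun x : R => (1 + x) `^ (N - 2))).
        exact: cvg_cst.
      exact: is_derive_continuous (d1 _).
    exact: is_derive_continuous (d2 _).
  have d3 := is_deriveZ (z - 1)^-1 (is_deriveM (d1 (N - 1)) (d2 (1 - N))).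
  apply: (is_derive_eq d3); rewrite /GRing.scale/=.
  rewrite (_ : N - 1 - 1 = N - 2); last by ring.
  rewrite (_ : 1 - N - 1 = - N); last by ring.
  have -> : (1 + x) `^ (N - 1) = (1 + x) * (1 + x) `^ (N - 2).
    by rewrite -(powR_split _ x1); congr (_ * _ `^ _); ring.
  have -> : (z + x) `^ (1 - N) = (z + x) * (z + x) `^ (- N).
    by rewrite -(powR_split _ zx); congr (_ * _ `^ _); ring.
  by field.
- rewrite -[X in _ --> X]mulr1; apply: cvgMl_tmp.
  apply: (@cvg_trans _ (((1 + x) / (z + x)) `^ (N - 1) @[x --> +oo])).
    apply: near_eq_cvg; near=> x.
    have x0 : 0 < x by near: x; apply: nbhs_pinfty_gt; rewrite num_real.
    have x1 : 0 < 1 + x by lra.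
    have zx : 0 < z + x by lra.
    rewrite powRM ?invr_ge0 ?ltW// -powR_inv1 ?ltW// -powRrM.
    by congr (_ * _ `^ _); ring.
  have h : ((1 + x) / (z + x)) `^ (N - 1) @[x --> +oo] --> (1 : R) `^ (N - 1).
    apply: (@continuous_cvg _ _ _ _ _ (fun x => (1 + x) / (z + x)) (fun y : R => y `^ (N - 1)) 1).
      exact: powR_continuous.
    exact: cvg_mobius_y.
  by rewrite powR1 in h.
Unshelve. all: by end_near. Qed.

(* The incomplete beta integral in kernel_funE is swapped with the outer integral by
   Tonelli; the inner one is then elementary. *)
Lemma stieltjes_kernel N p q (z : R) : 1 < N -> 0 < p -> 0 < q -> p + q = N + 1 ->
  0 < z -> z != 1 -> exists2 m : R,
  (\int[mu]_(x in pos) (kernel_fun N p x * (z + x) `^ (- N))%:E = m%:E)%E &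
  (q - 1) * m = Gamma p * Gamma q / Gamma N * ((1 - z `^ (1 - q)) / (z - 1)).
Proof.
move=> N1 p0 q0 pqN z0 z1; have z10 : z - 1 != 0 by rewrite subr_eq0.
have [m mE mq] := integral_affpowR q z0 z1.
pose K := N * (Gamma p * Gamma q / Gamma (p + q)).
exists (K * m); last first.
  rewrite mulrCA mq /K pqN GammaS; last lra.
  have G0 : Gamma N != 0 by rewrite gt_eqF// Gamma_gt0//; lra.
  by field; rewrite z10 G0 gt_eqF//; lra.
pose A x := (1 + x)^-1 * x `^ (p - 1) * (z + x) `^ (- N).
pose B x := (N - 1) * (1 + x) `^ (N - 2) * (z + x) `^ (- N) * incbeta N p x.
rewrite (@eq_Rint _ _ _ (fun x => A x + B x)); last first.
  by move=> x; rewrite /= in_itv/= andbT => x0; rewrite kernel_funE// /A /B; ring.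
have mA : measurable_fun setT A by rewrite /A; mfun.
have mB : measurable_fun setT B.
  rewrite /B; apply: measurable_funM; [mfun|exact: measurable_incbeta].
rewrite Rint_D//; last 2 first.
- move=> x; rewrite /= in_itv/= andbT => x0.
  by rewrite /A !mulr_ge0 ?powR_ge0 ?invr_ge0//; lra.
- move=> x; rewrite /= in_itv/= andbT => x0.
  rewrite /B mulr_ge0 ?incbeta_ge0// mulr_ge0 ?powR_ge0// mulr_ge0 ?powR_ge0//; lra.
pose C s := s `^ (p - 1) * (1 + s) `^ (- N) *
  ((1 - (1 + s) `^ (N - 1) * (z + s) `^ (1 - N)) / (z - 1)).
have mC : measurable_fun setT C by rewrite /C; mfun.
have BC : (\int[mu]_(x in pos) (B x)%:E = \int[mu]_(s in pos) (C s)%:E)%E.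
  pose f (u : R * R) := ((N - 1) * (1 + u.1) `^ (N - 2) * (z + u.1) `^ (- N)) *
    (u.2 `^ (p - 1) * (1 + u.2) `^ (- N)).
  have mf : measurable_fun setT f by rewrite /f; mfun.
  transitivity (\int[mu]_(x in pos) \int[mu]_(y in [set` `]0%R, x[]) (f (x, y))%:E)%E.
    apply: eq_integral => x; rewrite inE/= in_itv/= andbT => x0.
    rewrite /f/= Rint_Zl; last 4 first.
    - exact: measurable_itv.
    - by rewrite mulr_ge0 ?powR_ge0// mulr_ge0 ?powR_ge0//; lra.
    - by mfun.
    - by move=> y _; rewrite mulr_ge0 ?powR_ge0.
    rewrite integral_itv_bndo_bndc ?incbetaE//.
    have mI : measurable_fun setT (fun y : R => y `^ (p - 1) * (1 + y) `^ (- N)) by mfun.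
    by apply/measurable_EFinP; exact: measurable_funTS.
  etransitivity; first apply: (@triangle_tonelli _ (fun u : R * R => (f u)%:E)).
  - exact/measurable_EFinP.
  - by move=> x y x0 y0; rewrite lee_fin /f /= !mulr_ge0 ?powR_ge0//; lra.
  apply: eq_integral => y; rewrite inE/= in_itv/= andbT => y0.
  rewrite (@eq_Rint _ _ _ (fun x => y `^ (p - 1) * (1 + y) `^ (- N) *
    ((N - 1) * (1 + x) `^ (N - 2) * (z + x) `^ (- N)))); last first.
    by move=> x _; rewrite /f/=; ring.
  rewrite Rint_Zl ?mulr_ge0 ?powR_ge0//; last 2 first.
  - by mfun.
  - move=> x; rewrite /= in_itv/= andbT => yx.
    by rewrite !mulr_ge0 ?powR_ge0//; lra.
  by rewrite integral_mobius_ray// -EFinM.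
have C0 s : 0 < s -> 0 <= C s.
  move=> s0; rewrite /C; apply: mulr_ge0; first by rewrite mulr_ge0 ?powR_ge0.
  rewrite -lee_fin -(integral_mobius_ray N1)//; apply: Rint_ge0 => x; rewrite /= in_itv/= andbT => sx.
  by rewrite !mulr_ge0 ?powR_ge0//; lra.
rewrite BC -Rint_D//; last 2 first.
- move=> x; rewrite /= in_itv/= andbT => x0.
  by rewrite /A !mulr_ge0 ?powR_ge0 ?invr_ge0//; lra.
- by move=> x; rewrite /= in_itv/= andbT => x0; exact: C0.
(* In [A + C] the factors (1 + s)^-1 cancel and s^(p-1) L s remains. The two powers in [L] cannot be
   integrated separately against s^(p-1) when q <= 1. Their difference is therefore written as an
   integral over [t], and the exponent becomes - N - 1 = - (p + q), for which the beta integral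
   converges for every q > 0. *)
pose L s := ((1 + s) `^ (- N) - (z + s) `^ (- N)) / (z - 1).
have FL s : 0 < s -> (\int[mu]_(t in [set` `[0%R, 1%R] ])
    (N * ((1 + s) + (z - 1) * t) `^ (- N - 1))%:E = (L s)%:E)%E.
  move=> s0; have c0 t : 0 <= t <= 1 -> 0 < (1 + s) + (z - 1) * t.
    by move=> t01; have := affine_gt0 z0 t01; lra.
  rewrite (@FTC_cc _ _ (fun t => - (z - 1)^-1 * ((1 + s) + (z - 1) * t) `^ (- N))); [|exact: ltr01|].
    by rewrite mulr0 addr0 mulr1 (_ : 1 + s + (z - 1) = z + s); [congr (_%:E); rewrite /L; ring|ring].
  move=> t t01; have d a := @is_derive_affpowR (1 + s) (z - 1) a t (c0 t t01).
  split.
    apply: (@continuousM _ _ (cst N : R -> R) (fun t : R => ((1 + s) + (z - 1) * t) `^ (- N - 1))).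
      exact: cvg_cst.
    exact: is_derive_continuous (d _).
  have d3 : is_derive t (1 : R) (fun t => - (z - 1)^-1 * ((1 + s) + (z - 1) * t) `^ (- N))
     (- (z - 1)^-1 *: ((z - 1) * - N * ((1 + s) + (z - 1) * t) `^ (- N - 1))).
    exact: is_deriveZ.
  by apply: (is_derive_eq d3); rewrite /GRing.scale/=; field.
pose f (u : R * R) := u.1 `^ (p - 1) * (N * ((1 + u.1) + (z - 1) * u.2) `^ (- N - 1)).
have mf : measurable_fun setT f by rewrite /f; mfun.
transitivity (\int[mu]_(s in pos) \int[mu]_(t in [set` `[0%R, 1%R] ]) (f (s, t))%:E)%E.
  apply: eq_integral => s; rewrite inE/= in_itv/= andbT => s0.
  rewrite /f/= Rint_Zl ?powR_ge0 ?measurable_itv//; last 2 first.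
  - by mfun.
  - by move=> t _; rewrite mulr_ge0 ?powR_ge0//; lra.
  rewrite FL// -EFinM; congr (_%:E); rewrite /A /C /L.
  have s1 : 0 < 1 + s by lra.
  have zs : 0 < z + s by lra.
  have -> : (z + s) `^ (1 - N) = (z + s) * (z + s) `^ (- N).
    by rewrite -(powR_split _ zs); congr (_ * _ `^ _); ring.
  have E : (1 + s) `^ (- N) * (1 + s) `^ (N - 1) = (1 + s)^-1.
    rewrite -powRD ?(gt_eqF s1) ?implybT// -powR_inv1 ?(ltW s1)//.
    by congr (_ `^ _); ring.
  have -> : s `^ (p - 1) * (1 + s) `^ (- N) *
    ((1 - (1 + s) `^ (N - 1) * ((z + s) * (z + s) `^ (- N))) / (z - 1)) =
    s `^ (p - 1) * (((1 + s) `^ (- N) - ((1 + s) `^ (- N) * (1 + s) `^ (N - 1)) *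
      ((z + s) * (z + s) `^ (- N))) / (z - 1)) by ring.
  by rewrite E; field; rewrite z10 gt_eqF.
etransitivity; first apply: (@set_tonelli _ pos [set` `[0%R, 1%R] ] (fun u : R * R => (f u)%:E)).
- exact: measurable_itv.
- exact: measurable_itv.
- exact/measurable_EFinP.
- by move=> x y _ _; rewrite lee_fin /f/= !mulr_ge0 ?powR_ge0//; lra.
transitivity (\int[mu]_(t in [set` `[0%R, 1%R] ]) (K * (1 + (z - 1) * t) `^ (- q))%:E)%E.
  apply: eq_integral => t; rewrite inE/= in_itv/= => t01.
  have c0 := affine_gt0 z0 t01.
  rewrite (@eq_Rint _ _ _ (fun s => N * (s `^ (p - 1) * ((1 + (z - 1) * t) + 1 * s) `^ (- (p + q))))); last first.
    move=> s _; rewrite /f/= mulrCA pqN; congr (_ * (_ * _ `^ _)); ring.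
  rewrite Rint_Zl//; last 3 first.
  - lra.
  - by mfun.
  - by move=> s _; rewrite mulr_ge0 ?powR_ge0.
  rewrite beta_integral// -EFinM; congr (_%:E).
  have -> : (1 : R) `^ (- p) = 1 by rewrite powR1.
  by rewrite /K; ring.
have K0 : 0 <= K.
  have Gpq : 0 < Gamma (p + q) by apply: Gamma_gt0; lra.
  apply: mulr_ge0; first lra.
  by apply/ltW; apply: divr_gt0 => //; apply: mulr_gt0; exact: Gamma_gt0.
rewrite EFinM -mE; apply: Rint_Zl; [exact: measurable_itv|exact: K0|by mfun|].
by move=> t _; exact: powR_ge0.
Qed.

Lemma Rint_split z (f : R -> R) : 0 < z -> measurable_fun setT f ->
  (forall x, 0 < x -> 0 <= f x) ->
  (\int[mu]_(x in [set` `]0%R, z] ]) (f x)%:E + \int[mu]_(x in [set` `]z, +oo[ ]) (f x)%:E =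
   \int[mu]_(x in pos) (f x)%:E)%E.
Proof.
move=> z0 mf f0.
have E : [set` `]0%R, z] ] `|` [set` `]z, +oo[ ] = pos.
  apply/seteqP; split => x /=; rewrite !in_itv/= !andbT.
    by case=> [/andP[]//|]; exact: lt_trans.
  by move=> ->/=; case: (leP x z); [left|right].
rewrite -E (@ge0_integral_setU _ _ _ mu).
- by [].
- exact: measurable_itv.
- exact: measurable_itv.
- by apply/measurable_EFinP; exact: measurable_funTS.
- by rewrite E => x; rewrite /= in_itv/= andbT lee_fin; exact: f0.
- rewrite disj_set2E; apply/eqP/seteqP; split => x //=; rewrite !in_itv/= andbT.
  by case=> /andP[_ x1] /(le_lt_trans x1); rewrite ltxx.
Qed.

Lemma incbeta_le N p z : 1 < N -> 0 < p -> 0 < z -> incbeta N p z <= z `^ p / p.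
Proof.
move=> N1 p0 z0; rewrite -lee_fin -incbetaE// -integral_powR_0//.
apply: Rint_le; [exact: measurable_itv|by mfun|by mfun|].
move=> x; rewrite /= in_itv/= => /andP[x0 _]; rewrite mulr_ge0 ?powR_ge0//=.
rewrite ler_piMr ?powR_ge0// powRN invf_le1 ?powR_gt0 ?addr_gt0//.
by rewrite -[leLHS](powRr0 (1 + x)); apply: ler_powR; lra.
Qed.

Lemma powR_addl_le N s : 0 <= N -> 0 < s -> (1 + s) `^ (- N) <= s `^ (- N).
Proof.
move=> N0 s0; rewrite !powRN lef_pV2 ?posrE ?powR_gt0//; last lra.
by apply: ge0_ler_powR; rewrite ?nnegrE//; lra.
Qed.

(** The factor q - 1 lets one estimate serve all q > 0. For q > 1 the error is the tail of a
    convergent beta integral; for q <= 1 one has z^(1-q) >= 1, and this bounds both the constant and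
    (1 - q) times the incomplete integral. *)
Lemma incbeta_asymp N p q z : 1 < N -> 0 < p -> 0 < q -> p + q = N + 1 -> 1 <= z ->
  `|(q - 1) * incbeta N p z - Gamma p * Gamma q / Gamma N| <=
  (1 + Gamma p * Gamma q / Gamma N) * z `^ (1 - q).
Proof.
move=> N1 p0 q0 pqN z1; have z0 : 0 < z by lra.
have NE : N = p + q - 1 by lra.
set K := Gamma p * Gamma q / Gamma N.
have GN : 0 < Gamma N by apply: Gamma_gt0; lra.
have K0 : 0 < K by apply: divr_gt0 => //; apply: mulr_gt0; exact: Gamma_gt0.
have mg : measurable_fun setT (fun s => s `^ (p - 1) * (1 + s) `^ (- N)) by mfun.
have g0 s : 0 <= s `^ (p - 1) * (1 + s) `^ (- N) by rewrite mulr_ge0 ?powR_ge0.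
have gle s : 0 < s -> s `^ (p - 1) * (1 + s) `^ (- N) <= s `^ (- q).
  move=> s0; have -> : s `^ (- q) = s `^ (p - 1) * s `^ (- N).
    by rewrite -powRD ?(gt_eqF s0) ?implybT//; congr (_ `^ _); lra.
  by rewrite ler_wpM2l ?powR_ge0//; apply: powR_addl_le; lra.
have [q1|q1] := ltP 1 q.
  pose t := (\int[mu]_(s in [set` `]z, +oo[ ]) (s `^ (p - 1) * (1 + s) `^ (- N))%:E)%E.
  have t_le : (t <= (z `^ (1 - q) / (q - 1))%:E)%E.
    rewrite (_ : z `^ (1 - q) = z `^ (- (q - 1))); last by rewrite opprB.
    rewrite -integral_powR_y//; last lra.
    apply: Rint_le; [exact: measurable_itv|exact: mg|by mfun|].
    move=> s; rewrite /= in_itv/= andbT => zs; rewrite g0/=.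
    rewrite (_ : - (q - 1) - 1 = - q); last by ring.
    by apply: gle; lra.
  have t_ge0 : (0 <= t)%E by apply: Rint_ge0.
  have tfin : t \is a fin_num by rewrite ge0_fin_numE// (le_lt_trans t_le)// ltry.
  have split_int : ((incbeta N p z)%:E + t = (K / (q - 1))%:E)%E.
    have -> : K / (q - 1) = Gamma p * Gamma (q - 1) / Gamma (p + (q - 1)) * 1 `^ (- p) * 1 `^ (- (q - 1)).
      rewrite !powR1 !mulr1 /K (_ : p + (q - 1) = N); last lra.
      rewrite -[in LHS](subrK 1 q) GammaS; last lra.
      by rewrite addrK; field; rewrite !gt_eqF ?Gamma_gt0//; lra.
    rewrite -beta_integral//; last lra.
    rewrite -(@incbetaE _ N p z)// (@Rint_split z _ z0 mg (fun x _ => g0 x)).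
    by apply: eq_Rint => x _; rewrite mul1r; congr (_ * _ `^ _); lra.
  have q10 : 0 < q - 1 by lra.
  have tE : fine t = K / (q - 1) - incbeta N p z.
    by apply: EFin_inj; rewrite fineK// EFinB -split_int addeAC subee// add0e.
  have -> : (q - 1) * incbeta N p z - K = - ((q - 1) * fine t).
    by rewrite tE; field; rewrite gt_eqF.
  rewrite normrN ger0_norm ?mulr_ge0 ?fine_ge0 ?(ltW q10)//.
  have : fine t <= z `^ (1 - q) / (q - 1) by rewrite -lee_fin fineK.
  rewrite ler_pdivlMr// mulrC => h; apply: le_trans h _.
  by rewrite mulrDl mul1r lerDl mulr_ge0 ?powR_ge0// ltW.
have zq : 1 <= z `^ (1 - q) by rewrite -[leLHS](powRr0 z); apply: ler_powR; lra.
have hI : (1 - q) * incbeta N p z <= z `^ (1 - q).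
  have [q11|q11] := eqVneq q 1; first by rewrite q11 subrr mul0r powRr0.
  have q2 : 0 < 1 - q by rewrite subr_gt0 lt_neqAle q11.
  rewrite mulrC -ler_pdivlMr// -lee_fin -incbetaE// -integral_powR_0//.
  apply: Rint_le; [exact: measurable_itv|exact: mg|by mfun|].
  move=> s; rewrite /= in_itv/= => /andP[s0 _]; rewrite g0/=.
  rewrite (_ : 1 - q - 1 = - q); last by ring.
  exact: gle.
have I0 := incbeta_ge0 N1 p0 z0.
rewrite ler_norml; apply/andP; split; last first.
  by apply: (@le_trans _ _ 0); [nra|rewrite mulr_ge0 ?powR_ge0//; lra].
have : K <= K * z `^ (1 - q) by rewrite ler_pMr.
lra.
Qed.

End StieltjesKernel.

(** * The estimator as a function of the ratio: growth and square integrability *)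

Section RadialPart.
Context {R : realType}.
Local Notation mu := (@lebesgue_measure R).
Local Notation pos := [set` `](0 : R)%R, +oo[ ].
Implicit Types (N p q z s a b nu : R).

(** The recurrence in the form that survives s <= 1. For 0 < s <= 1 it unfolds the shift by one in
    [Gamma]; at s = 1 both sides are 0 by the convention at the pole. *)
Lemma Gamma_pred s : 0 < s -> (Gamma (s - 1))^-1 = (s - 1) / Gamma s.
Proof.
move=> s0; have [s1|s1] := ltP 1 s.
  have G0 : Gamma (s - 1) != 0 by rewrite gt_eqF// Gamma_gt0// subr_gt0.
  rewrite -[in RHS](subrK 1 s) GammaS ?subr_gt0// addrK; field.
  by rewrite G0 subr_eq0 gt_eqF.
have t1 : Num.truncn (1 - (s - 1)) = 1%N.
  by apply/eqP; rewrite truncn_eq; lra.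
have t0 : Gamma s = Gamma_int s.
  rewrite /Gamma; have -> : Num.truncn (1 - s) = 0%N.
    by apply/truncn0Pn; rewrite -ltNge; lra.
  by rewrite addr0 rising0 divr1.
by rewrite {1}/Gamma t1 subrK t0 risingS rising0 mul1r addr0 invf_div.
Qed.

(** The normalization makes the leading coefficient at infinity independent of [p], and the
    Stieltjes transform of [stieltjes_kernel] equal to (1 - z^(p-N)) / (Gamma N (z - 1)). *)
Definition normalized_kernel N p z : R :=
  (N - p) / (Gamma p * Gamma (N + 1 - p)) * kernel_fun N p z.

Definition est_radial a b nu z : R :=
  (a - 1) * hyp2F1 1 (2 - a) b (- z)
  - Gamma a / Gamma (a - 1 - nu) * (z `^ nu / poch b nu)
    * hyp2F1 1 (2 - a + nu) (b + nu) (- z).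

Lemma measurable_est_radial a b nu : 0 < b -> 0 < b + nu ->
  measurable_fun setT (est_radial a b nu).
Proof.
move=> b0 bn0; rewrite /est_radial; apply: measurable_funB; apply: measurable_funM.
- by mfun.
- by apply: (measurableT_comp (measurable_hyp2F1 _ _ b0)); mfun.
- by mfun.
- by apply: (measurableT_comp (measurable_hyp2F1 _ _ bn0)); mfun.
Qed.

(** [Gamma_pred] at a - nu replaces 1 / Gamma (a - 1 - nu) by (a - 1 - nu) / Gamma (a - nu), whose
    argument is positive; this also covers a - 1 - nu <= 0. *)
Lemma est_radialE a b nu z : 0 < a -> 0 < b -> 0 < a - nu -> 0 < b + nu -> 0 < z ->
  z `^ (b - 1) * est_radial a b nu z = Gamma a * Gamma b *
    (normalized_kernel (a + b - 1) b z - normalized_kernel (a + b - 1) (b + nu) z).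
Proof.
move=> a0 b0 an bn z0.
have -> : est_radial a b nu z = (a - 1) * hyp2F1 1 (2 - a) b (- z)
  - Gamma a * ((a - 1 - nu) / Gamma (a - nu)) * (z `^ nu / poch b nu)
    * hyp2F1 1 (2 - a + nu) (b + nu) (- z).
  have := Gamma_pred an; rewrite (_ : a - nu - 1 = a - 1 - nu); last by ring.
  by move=> <-.
rewrite /normalized_kernel /kernel_fun /poch.
rewrite (_ : b - (a + b - 1) + 1 = 2 - a); last by ring.
rewrite (_ : b + nu - (a + b - 1) + 1 = 2 - a + nu); last by ring.
rewrite (_ : a + b - 1 + 1 - b = a); last by ring.
rewrite (_ : a + b - 1 + 1 - (b + nu) = a - nu); last by ring.
have -> : z `^ (b + nu - 1) = z `^ (b - 1) * z `^ nu.
  by rewrite -powRD ?(gt_eqF z0) ?implybT//; congr (_ `^ _); ring.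
set H1 := hyp2F1 _ _ _ _; set H2 := hyp2F1 _ _ _ _.
set Z1 := z `^ _; set Z2 := z `^ _.
have Ga := lt0r_neq0 (Gamma_gt0 a0); have Gb := lt0r_neq0 (Gamma_gt0 b0).
have Gan := lt0r_neq0 (Gamma_gt0 an); have Gbn := lt0r_neq0 (Gamma_gt0 bn).
by field; rewrite Ga Gb Gan Gbn.
Qed.

Lemma normalized_kernel_small N p : 1 < N -> 0 < p -> exists2 K, 0 <= K &
  forall z, 0 < z <= 1 -> `|normalized_kernel N p z| <= K * z `^ (p - 1).
Proof.
move=> N1 p0; pose c := `|(N - p) / (Gamma p * Gamma (N + 1 - p))|.
pose K := 1 + (N - 1) * 2 `^ N / p.
have K0 : 0 <= K.
  by rewrite /K addr_ge0// divr_ge0 ?(ltW p0)// mulr_ge0 ?powR_ge0//; lra.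
exists (c * K); first by rewrite mulr_ge0 ?normr_ge0.
move=> z /andP[z0 z1]; rewrite normrM -/c -mulrA; apply: ler_wpM2l; first exact: normr_ge0.
rewrite ger0_norm ?kernel_fun_ge0// kernel_funE// /K [leRHS]mulrDl mul1r lerD//.
  by rewrite ler_piMl ?powR_ge0// invf_le1; lra.
have h1 : (1 + z) `^ (N - 2) <= 2 `^ N.
  apply: (@le_trans _ _ ((1 + z) `^ N)); first by apply: ler_powR; lra.
  by apply: ge0_ler_powR; rewrite ?nnegrE; lra.
have h2 : incbeta N p z <= z `^ (p - 1) / p.
  apply: le_trans (incbeta_le N1 p0 z0) _.
  rewrite ler_wpM2r ?invr_ge0 ?(ltW p0)// -(powR_split _ z0).
  by rewrite ler_piMl ?powR_ge0.
rewrite -!mulrA ler_wpM2l//; first lra.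
rewrite [p^-1 * _]mulrC ler_pM ?powR_ge0 ?incbeta_ge0//.
Qed.

Lemma powR_1D_le (r z : R) : 1 <= z ->
  (1 + z) `^ r <= (1 + 2 `^ r) * z `^ r.
Proof.
move=> z1; have z0 : 0 < z by lra.
rewrite mulrDl mul1r; have [r0|r0] := leP 0 r.
  apply: (@le_trans _ _ ((2 * z) `^ r)).
    by apply: ge0_ler_powR; rewrite ?nnegrE; lra.
  by rewrite powRM ?(ltW z0)// lerDr powR_ge0.
apply: (@le_trans _ _ (z `^ r)); last by rewrite lerDl mulr_ge0 ?powR_ge0.
rewrite -[r]opprK !(powRN _ (- r)) lef_pV2 ?posrE ?powR_gt0//; last lra.
by apply: ge0_ler_powR; rewrite ?nnegrE; lra.
Qed.

(** [incbeta_asymp] is inserted in [kernel_funE]. The constant Gamma p Gamma q / Gamma N gives the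
    leading term; the error z^(1-q) times (1 + z)^(N-2) is of order z^(p-2). *)
Lemma normalized_kernel_large N p : 1 < N -> 0 < p -> 0 < N + 1 - p -> exists2 K, 0 <= K &
  forall z, 1 <= z -> `|normalized_kernel N p z - (N - 1) / Gamma N * (1 + z) `^ (N - 2)|
    <= K * z `^ (p - 2).
Proof.
move=> N1 p0 q0; set q := N + 1 - p in q0.
have GN : 0 < Gamma N by apply: Gamma_gt0; lra.
have Gp := Gamma_gt0 p0; have Gq := Gamma_gt0 q0.
pose c := (Gamma p * Gamma q)^-1; have c0 : 0 < c by rewrite invr_gt0 mulr_gt0.
pose B := 1 + Gamma p * Gamma q / Gamma N.
have B0 : 0 <= B.
  apply: addr_ge0 => //; apply: divr_ge0; last exact: ltW.
  by apply: mulr_ge0; exact: ltW.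
pose K1 := `|q - 1| * c; pose K2 := c * (N - 1) * (1 + 2 `^ (N - 2)) * B.
have K10 : 0 <= K1 by rewrite mulr_ge0 ?normr_ge0 ?ltW.
have K20 : 0 <= K2.
  apply: mulr_ge0 => //; apply: mulr_ge0; last by rewrite addr_ge0 ?powR_ge0.
  by apply: mulr_ge0; [exact: ltW|lra].
exists (K1 + K2); first by rewrite addr_ge0.
move=> z z1; have z0 : 0 < z by lra.
have -> : normalized_kernel N p z - (N - 1) / Gamma N * (1 + z) `^ (N - 2) =
   (q - 1) * c * ((1 + z)^-1 * z `^ (p - 1)) +
   c * (N - 1) * (1 + z) `^ (N - 2) *
     ((q - 1) * incbeta N p z - Gamma p * Gamma q / Gamma N).
  rewrite /normalized_kernel kernel_funE// -/q (_ : N - p = q - 1); last by rewrite /q; ring.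
  set I := incbeta _ _ _; set A := (1 + z) `^ _; set Z := z `^ _; rewrite /c.
  by field; rewrite !gt_eqF//; lra.
apply: le_trans (ler_normD _ _) _; rewrite [leRHS]mulrDl; apply: lerD.
  rewrite normrM normrM (gtr0_norm c0) ler_wpM2l// ger0_norm; last first.
    by rewrite mulr_ge0 ?powR_ge0 ?invr_ge0//; lra.
  have -> : z `^ (p - 1) = z * z `^ (p - 2).
    by rewrite -(powR_split (p - 1) z0); congr (_ * _ `^ _); ring.
  rewrite mulrA ler_piMl ?powR_ge0// mulrC ler_pdivrMr; lra.
rewrite normrM ger0_norm; last first.
  by rewrite mulr_ge0 ?powR_ge0// mulr_ge0 ?(ltW c0)//; lra.
have pqN : p + q = N + 1 by rewrite /q; ring.
apply: (@le_trans _ _ (c * (N - 1) * ((1 + 2 `^ (N - 2)) * z `^ (N - 2)) *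
   (B * z `^ (1 - q)))).
  apply: ler_pM; rewrite ?normr_ge0//.
  - by rewrite mulr_ge0 ?powR_ge0// mulr_ge0 ?(ltW c0)//; lra.
  - rewrite ler_wpM2l ?powR_1D_le//; rewrite mulr_ge0 ?(ltW c0)//; lra.
  - exact: incbeta_asymp.
have -> : z `^ (p - 2) = z `^ (N - 2) * z `^ (1 - q).
  by rewrite -powRD ?(gt_eqF z0) ?implybT//; congr (_ `^ _); rewrite /q; ring.
by rewrite /K2 le_eqVlt; apply/orP; left; apply/eqP; ring.
Qed.

Lemma sqr_norm_le (x u : R) : `|x| <= u -> x ^+ 2 <= u ^+ 2.
Proof.
by move=> xu; rewrite -real_normK ?num_real// ler_sqr// nnegrE ?(le_trans _ xu).
Qed.

(* The leading terms (N - 1) / Gamma N (1 + z)^(N - 2) at infinity do not depend on p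
   and cancel; this is why the estimator is square integrable. *)
Lemma normalized_kernel_diff_bound N p1 p2 : 1 < N -> 0 < p1 -> 0 < p2 ->
  0 < N + 1 - p1 -> 0 < N + 1 - p2 -> exists2 K, 0 <= K &
  forall z, 0 < z ->
    ((normalized_kernel N p1 z - normalized_kernel N p2 z) ^+ 2 <=
      K * ((if z <= 1 then z `^ (2 * (p1 - 1)) else z `^ (2 * (p1 - 2))) +
           (if z <= 1 then z `^ (2 * (p2 - 1)) else z `^ (2 * (p2 - 2))))).
Proof.
move=> N1 p10 p20 q10 q20.
have [K1 K10 h1] := normalized_kernel_small N1 p10.
have [K2 K20 h2] := normalized_kernel_small N1 p20.
have [K3 K30 h3] := normalized_kernel_large N1 p10 q10.
have [K4 K40 h4] := normalized_kernel_large N1 p20 q20.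
pose K := K1 + K2 + K3 + K4; have K0 : 0 <= K by rewrite !addr_ge0.
exists (2 * K ^+ 2); first by rewrite mulr_ge0 ?sqr_ge0.
have sq (x u v : R) : `|x| <= K * u + K * v ->
    x ^+ 2 <= 2 * K ^+ 2 * (u ^+ 2 + v ^+ 2).
  move=> /sqr_norm_le xu; apply: le_trans xu _; rewrite -mulrDr exprMn.
  rewrite (_ : 2 * K ^+ 2 * (u ^+ 2 + v ^+ 2) = K ^+ 2 * (2 * (u ^+ 2 + v ^+ 2))); last by ring.
  apply: ler_wpM2l; first exact: sqr_ge0.
  by have := sqr_ge0 (u - v); lra.
have pw (z r : R) : 0 < z -> z `^ (2 * r) = (z `^ r) ^+ 2.
  by move=> z0; rewrite expr2 -powRD ?(gt_eqF z0) ?implybT//; congr (_ `^ _); ring.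
have KE K' z r : K' <= K -> K' * z `^ r <= K * z `^ r by move=> ?; rewrite ler_wpM2r ?powR_ge0.
move=> z z0; case: ifPn => [z1|]; rewrite ?pw//.
  apply: sq; apply: le_trans (ler_normB _ _) _; apply: lerD.
    by apply: le_trans (h1 z _) (KE _ _ _ _); [rewrite z0|rewrite /K; lra].
  by apply: le_trans (h2 z _) (KE _ _ _ _); [rewrite z0|rewrite /K; lra].
rewrite -ltNge => z1; apply: sq.
set L := (N - 1) / Gamma N * (1 + z) `^ (N - 2).
rewrite (_ : _ - _ = (normalized_kernel N p1 z - L) - (normalized_kernel N p2 z - L)); last by ring.
apply: le_trans (ler_normB _ _) _; apply: lerD.
  by apply: le_trans (h3 z (ltW z1)) (KE _ _ _ _); rewrite /K; lra.
by apply: le_trans (h4 z (ltW z1)) (KE _ _ _ _); rewrite /K; lra.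
Qed.

Lemma powR_affine_le (t1 t2 M z : R) : 0 < t1 -> 0 < t2 -> 0 < M -> 0 < z ->
  (t1 + t2 * z) `^ (- M) <= t1 `^ (- M) /\ (t1 + t2 * z) `^ (- M) <= t2 `^ (- M) * z `^ (- M).
Proof.
move=> t10 t20 M0 z0; have tz : 0 < t2 * z by rewrite mulr_gt0.
rewrite -powRM ?(ltW z0) ?(ltW t20)// !powRN !lef_pV2 ?posrE ?powR_gt0//; last lra.
- by split; apply: ge0_ler_powR; rewrite ?nnegrE; lra.
- lra.
Qed.

Lemma est_radial_sq_lty a b nu (t1 t2 : R) : 0 < a -> 0 < b -> 2 < a + b ->
  - b < 2 * nu -> 2 * nu < a -> 0 < t1 -> 0 < t2 ->
  (\int[mu]_(z in pos) (est_radial a b nu z ^+ 2 * z `^ (b - 1) *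
     (t1 + t2 * z) `^ (- (a - 2 + b)))%:E < +oo)%E.
Proof.
move=> a0 b0 ab nu1 nu2 t10 t20; have bn : 0 < b + nu by lra.
have an : 0 < a - nu by lra.
have N1 : 1 < a + b - 1 by lra.
have q1 : 0 < a + b - 1 + 1 - b by lra.
have q2 : 0 < a + b - 1 + 1 - (b + nu) by lra.
have [K K0 hK] := normalized_kernel_diff_bound N1 b0 bn q1 q2.
pose G := (Gamma a * Gamma b) ^+ 2; have G0 : 0 <= G by exact: sqr_ge0.
pose M := a - 2 + b; have M0 : 0 < M by rewrite /M; lra.
pose C := G * K * (t1 `^ (- M) + t2 `^ (- M)) * 2.
have est2 z : 0 < z -> est_radial a b nu z ^+ 2 * z `^ (b - 1) =
    G * (normalized_kernel (a + b - 1) b z - normalized_kernel (a + b - 1) (b + nu) z) ^+ 2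
      * z `^ (1 - b).
  move=> z0; rewrite -exprMn -est_radialE//.
  have E : z `^ (b - 1) * z `^ (1 - b) = 1.
    rewrite -powRD ?(gt_eqF z0) ?implybT// (_ : b - 1 + (1 - b) = 0) ?powRr0//; ring.
  rewrite [RHS](_ : _ = (z `^ (b - 1) * z `^ (1 - b)) * (est_radial a b nu z ^+ 2 * z `^ (b - 1))).
    by rewrite E mul1r.
  by ring.
have pD z r r' r'' : 0 < z -> r + r' = r'' -> z `^ r * z `^ r' = z `^ r''.
  by move=> z0 <-; rewrite -powRD ?(gt_eqF z0) ?implybT.
(* The two kernels contribute the exponents b and b + 2 nu at 0, and a and a - 2 nu at infinity.
   Their positivity is where the bounds on [nu] enter. *)
apply: (@pos_integral_lty _ _ (Num.min b (b + 2 * nu)) (Num.min a (a - 2 * nu)) C).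
- by rewrite lt_min b0; lra.
- by rewrite lt_min a0; lra.
- apply: measurable_funM; last by mfun.
  apply: measurable_funM; last by mfun.
  by apply: measurable_funX; exact: measurable_est_radial.
- move=> z /andP[z0 z1]; apply/andP; split.
    by apply: mulr_ge0; [apply: mulr_ge0; [exact: sqr_ge0|exact: powR_ge0]|exact: powR_ge0].
  rewrite est2//.
  have := hK z z0; rewrite z1 => hD.
  have [hM _] := powR_affine_le t10 t20 M0 z0; rewrite -/M.
  apply: (@le_trans _ _ (G * (K * (z `^ (2 * (b - 1)) + z `^ (2 * (b + nu - 1)))) * z `^ (1 - b) * t1 `^ (- M))).
    apply: ler_pM hM; last 2 first.
    - exact: powR_ge0.
    - by apply: ler_wpM2r; [exact: powR_ge0|exact: ler_wpM2l].
    by apply: mulr_ge0; [apply: mulr_ge0; [exact: G0|exact: sqr_ge0]|exact: powR_ge0].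
  have -> : G * (K * (z `^ (2 * (b - 1)) + z `^ (2 * (b + nu - 1)))) * z `^ (1 - b) * t1 `^ (- M) =
    G * K * t1 `^ (- M) * (z `^ (2 * (b - 1)) * z `^ (1 - b) + z `^ (2 * (b + nu - 1)) * z `^ (1 - b)) by ring.
  rewrite (pD _ _ _ (b - 1))//; last by ring.
  rewrite (pD _ _ _ (b + 2 * nu - 1))//; last by ring.
  set m := Num.min _ _.
  have zm r : m <= r -> z `^ (r - 1) <= z `^ (m - 1).
    by move=> mr; apply: ger_powR; rewrite ?z0//; lra.
  have zm2 : z `^ (b - 1) + z `^ (b + 2 * nu - 1) <= z `^ (m - 1) * 2.
    have za : z `^ (b - 1) <= z `^ (m - 1) by apply: zm; rewrite ge_min lexx.
    have zb : z `^ (b + 2 * nu - 1) <= z `^ (m - 1) by apply: zm; rewrite ge_min lexx orbT.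
    lra.
  rewrite /C [G * K * (_ + _)]mulrDr; apply: (@le_trans _ _ (G * K * t1 `^ (- M) * (z `^ (m - 1) * 2))).
    apply: ler_wpM2l; last exact: zm2.
    by apply: mulr_ge0; [exact: mulr_ge0|exact: powR_ge0].
  rewrite mulrA -[leRHS]mulrA [2 * _]mulrC mulrA ler_wpM2r// ler_wpM2r ?powR_ge0//.
  by rewrite lerDl; apply: mulr_ge0; [exact: mulr_ge0|exact: powR_ge0].
- move=> z z1; have z0 : 0 < z by lra.
  apply/andP; split.
    by apply: mulr_ge0; [apply: mulr_ge0; [exact: sqr_ge0|exact: powR_ge0]|exact: powR_ge0].
  rewrite est2//.
  have z1' : (z <= 1) = false by apply/negbTE; rewrite -ltNge.
  have := hK z z0; rewrite z1' => hD.
  have [_ hM] := powR_affine_le t10 t20 M0 z0; rewrite -/M.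
  apply: (@le_trans _ _ (G * (K * (z `^ (2 * (b - 2)) + z `^ (2 * (b + nu - 2)))) * z `^ (1 - b) * (t2 `^ (- M) * z `^ (- M)))).
    apply: ler_pM hM; last 2 first.
    - exact: powR_ge0.
    - by apply: ler_wpM2r; [exact: powR_ge0|exact: ler_wpM2l].
    by apply: mulr_ge0; [apply: mulr_ge0; [exact: G0|exact: sqr_ge0]|exact: powR_ge0].
  have -> : G * (K * (z `^ (2 * (b - 2)) + z `^ (2 * (b + nu - 2)))) * z `^ (1 - b) * (t2 `^ (- M) * z `^ (- M)) =
    G * K * t2 `^ (- M) * (z `^ (2 * (b - 2)) * z `^ (1 - b) * z `^ (- M) + z `^ (2 * (b + nu - 2)) * z `^ (1 - b) * z `^ (- M)) by ring.
  rewrite !(pD _ _ _ _ z0 erefl).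
  rewrite (_ : 2 * (b - 2) + (1 - b) + - M = - a - 1); last by rewrite /M; ring.
  rewrite (_ : 2 * (b + nu - 2) + (1 - b) + - M = - (a - 2 * nu) - 1); last by rewrite /M; ring.
  set m := Num.min _ _.
  have zm r : m <= r -> z `^ (- r - 1) <= z `^ (- m - 1).
    by move=> mr; apply: ler_powR; lra.
  have zm2 : z `^ (- a - 1) + z `^ (- (a - 2 * nu) - 1) <= z `^ (- m - 1) * 2.
    have za : z `^ (- a - 1) <= z `^ (- m - 1) by apply: zm; rewrite ge_min lexx.
    have zb : z `^ (- (a - 2 * nu) - 1) <= z `^ (- m - 1) by apply: zm; rewrite ge_min lexx orbT.
    lra.
  rewrite /C [G * K * (_ + _)]mulrDr; apply: (@le_trans _ _ (G * K * t2 `^ (- M) * (z `^ (- m - 1) * 2))).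
    apply: ler_wpM2l; last exact: zm2.
    by apply: mulr_ge0; [exact: mulr_ge0|exact: powR_ge0].
  rewrite mulrA -[leRHS]mulrA [2 * _]mulrC mulrA ler_wpM2r// ler_wpM2r ?powR_ge0//.
  by rewrite lerDr; apply: mulr_ge0; [exact: mulr_ge0|exact: powR_ge0].
Qed.

End RadialPart.

(** * The law of the pair *)

Section JointLaw.
Local Open Scope ereal_scope.
Context d (T : measurableType d) (R : realType) (P : probability T R).
Local Notation mu := (@lebesgue_measure R).
Local Notation pos := [set` `](0 : R)%R, +oo[ ].

(** Density on the half-line of [s * Y] for [Y] of shape [s] and rate [s / k]: multiplication by the
    shape leaves the rate [k^-1], so [k] is the scale. *)
Definition gamma_density (s k x : R) : R :=
  (k `^ (- s) / Gamma s * (x `^ (s - 1) * expR (- (k^-1 * x))))%R.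

Lemma measurable_gamma_density s k : measurable_fun setT (gamma_density s k).
Proof. by rewrite /gamma_density; mfun. Qed.

Lemma gamma_density_ge0 s k x : (0 < s)%R -> (0 <= gamma_density s k x)%R.
Proof.
move=> s0; rewrite /gamma_density.
by rewrite !mulr_ge0 ?powR_ge0 ?expR_ge0 ?invr_ge0 ?ltW ?Gamma_gt0.
Qed.

Lemma measurable_gamma_pdf s (r : R) : measurable_fun setT (gamma_pdf s r).
Proof.
rewrite /gamma_pdf; apply: measurable_fun_ifT => //; last by mfun.
exact: measurable_fun_ltr.
Qed.

Lemma integral_gamma_distributed (s k : R) (Y : {RV P >-> R}) (f : R -> \bar R) :
  (0 < s)%R -> (0 < k)%R -> gamma_distributed s (s / k) Y ->
  measurable_fun setT f -> (forall x, 0 <= f x) ->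
  \int[P]_w f (s * Y w)%R =
  \int[mu]_(x in pos) (f x * (gamma_density s k x)%:E).
Proof.
move=> s0 k0 hY mf f0.
have sk0 : (0 < s / k)%R by rewrite divr_gt0.
have ms : measurable_fun setT (fun y => f (s * y)%R).
  by apply: (measurableT_comp mf); mfun.
have p0 y : (0 <= gamma_pdf s (s / k) y)%R.
  by rewrite /gamma_pdf; case: ifP => // _; rewrite !mulr_ge0 ?powR_ge0 ?expR_ge0 ?invr_ge0 ?(ltW (Gamma_gt0 _)).
have mY : @measurable_fun _ _ T (measurableTypeR R) setT Y by exact: (measurable_funPT Y).
transitivity (\int[pushforward P (Y : T -> measurableTypeR R)]_y f (s * y)%R).
  by rewrite ge0_integral_pushforward.
rewrite (@integral_density _ (measurableTypeR R) R mu (measure_function_pushforward__canonical__measure_function_Measure P mY) _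
  (measurable_gamma_pdf s (s / k)) p0 hY _ ms)//.
transitivity (\int[mu]_(y in pos) (f (s * y)%R * (gamma_pdf s (s / k) y)%:E)).
  rewrite [RHS]integral_mkcond; apply: eq_integral => y _.
  rewrite patchE; case: ifPn => //; rewrite notin_setE/= in_itv/= andbT => /negP/negbTE y0.
  by rewrite /gamma_pdf y0 mule0.
have s10 : (0 < s^-1)%R by rewrite invr_gt0.
rewrite (@ge0_integral_pos_scale _ s^-1)//; last 2 first.
- apply: measurable_funTS; apply: emeasurable_funM => //.
  by apply/measurable_EFinP; exact: measurable_gamma_pdf.
- by move=> x _; rewrite mule_ge0 ?lee_fin.
rewrite -ge0_integralZl//; last 3 first.
- apply: measurable_funTS; apply: emeasurable_funM => //.
    by apply: (measurableT_comp ms); mfun.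
  by apply/measurable_EFinP; apply: (measurableT_comp (measurable_gamma_pdf _ _)); mfun.
- by move=> x _; rewrite mule_ge0 ?lee_fin.
- by rewrite lee_fin ltW.
apply: eq_integral => x; rewrite inE/= in_itv/= andbT => x0.
rewrite mulrA mulfV ?gt_eqF// mul1r muleCA -EFinM; congr (_ * _%:E).
rewrite /gamma_pdf mulr_gt0// /gamma_density.
have -> : ((s / k) `^ s = s `^ s * k `^ (- s))%R.
  by rewrite powRM ?invr_ge0 ?ltW// -powR_inv1 ?ltW// -powRrM mulN1r.
have -> : ((s^-1 * x) `^ (s - 1) = s `^ (1 - s) * x `^ (s - 1))%R.
  rewrite powRM ?invr_ge0 ?ltW// -powR_inv1 ?ltW// -powRrM.
  by congr (_ `^ _ * _)%R; ring.
have -> : (s / k * (s^-1 * x) = k^-1 * x)%R by field; rewrite !gt_eqF.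
have E : (s `^ s * s `^ (1 - s) = s)%R.
  by rewrite -powRD ?(gt_eqF s0) ?implybT// subrKC powRr1 ?ltW.
rewrite [LHS](_ : _ = (s `^ s * s `^ (1 - s)) * s^-1 *
  (k `^ (- s) / Gamma s * (x `^ (s - 1) * expR (- (k^-1 * x)))))%R; last by ring.
by rewrite E mulfV ?gt_eqF// mul1r.
Qed.

Lemma integral_independent (Y1 Y2 : {RV P >-> R}) (h : R * R -> \bar R) :
  independent_RVs Y1 Y2 -> measurable_fun setT h -> (forall u, 0 <= h u) ->
  \int[P]_w h (Y1 w, Y2 w) =
  \int[distribution P Y1]_x \int[distribution P Y2]_y h (x, y).
Proof.
move=> ind mh h0.
have mY : measurable_fun setT (fun w => (Y1 w, Y2 w)) by apply: measurable_fun_pair.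
transitivity (\int[pushforward P (fun w => (Y1 w, Y2 w))]_u h u).
  by rewrite ge0_integral_pushforward.
rewrite -[RHS]fubini_tonelli1//.
apply: eq_measure_integral => A mA _; apply/esym.
by apply: product_measure_unique => // B C mB mC; rewrite /= -ind.
Qed.

Lemma integral_gamma_pair (a b k1 k2 : R) (Y1 Y2 : {RV P >-> R}) (h : R * R -> \bar R) :
  (0 < a)%R -> (0 < b)%R -> (0 < k1)%R -> (0 < k2)%R ->
  gamma_distributed a (a / k1) Y1 -> gamma_distributed b (b / k2) Y2 ->
  independent_RVs Y1 Y2 -> measurable_fun setT h -> (forall u, 0 <= h u) ->
  \int[P]_w h (a * Y1 w, b * Y2 w)%R =
  \int[mu]_(x in pos) \int[mu]_(y in pos)
    (h (x, y) * (gamma_density a k1 x * gamma_density b k2 y)%:E).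
Proof.
move=> a0 b0 k10 k20 h1 h2 ind mh h0.
pose H (u : R * R) := h (a * u.1, b * u.2)%R.
have mH : measurable_fun setT H by apply: (measurableT_comp mh); mfun.
rewrite (integral_independent (h := H) ind mH (fun u => h0 _)) /H/=.
pose F x := \int[mu]_(y in pos) (h (x, y) * (gamma_density b k2 y)%:E).
have F0 x : 0 <= F x.
  by apply: integral_ge0 => y _; rewrite mule_ge0 ?lee_fin ?gamma_density_ge0.
have mhy x : measurable_fun setT (fun y => h (x, y)).
  by apply: (measurableT_comp mh); mfun.
have mhb x : measurable_fun setT (fun y => h (x, b * y)%R).
  by apply: (measurableT_comp (mhy x)); mfun.
have FE x : F x = \int[distribution P Y2]_y h (x, b * y)%R.
  rewrite ge0_integral_distribution//.
  by rewrite (integral_gamma_distributed (f := fun y => h (x, y)) b0 k20 h2).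
have mF : measurable_fun setT F.
  rewrite (_ : F = fun x => \int[distribution P Y2]_y h (x, b * y)%R); last exact/funext.
  apply: (measurable_fun_fubini_tonelli_F (fun u : R * R => h (u.1, b * u.2)%R)) => //.
  by apply: (measurableT_comp mh); mfun.
transitivity (\int[distribution P Y1]_x F (a * x)%R).
  by apply: eq_integral => x _; rewrite FE.
rewrite ge0_integral_distribution//; last by apply: (measurableT_comp mF); mfun.
rewrite (integral_gamma_distributed a0 k10 h1 mF F0).
apply: eq_integral => x _; rewrite /F muleC -ge0_integralZl//.
- by apply: eq_integral => y _; rewrite muleCA EFinM.
- apply: measurable_funTS; apply: emeasurable_funM.
    by apply: (measurableT_comp mh); mfun.
  by apply/measurable_EFinP; exact: measurable_gamma_density.
- by move=> y _; rewrite mule_ge0 ?lee_fin ?gamma_density_ge0.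
- by rewrite lee_fin gamma_density_ge0.
Qed.

End JointLaw.

(** * Integrals under the product gamma law *)

Section GammaLaw.
Local Open Scope ereal_scope.
Context (R : realType) (M : probability (R * R)%type R) (a b k1 k2 : R).
Local Notation mu := (@lebesgue_measure R).
Local Notation pos := [set` `](0 : R)%R, +oo[ ].

(** The law enters only through this formula for nonnegative functions, so later arguments concern
    one measure on the plane and no longer the random variables. *)
Definition gamma_law := forall h : R * R -> \bar R,
  measurable_fun setT h -> (forall u, 0 <= h u) ->
  \int[M]_u h u = \int[mu]_(x in pos) \int[mu]_(y in pos)
    (h (x, y) * (gamma_density a k1 x * gamma_density b k2 y)%:E).

Hypothesis lawM : gamma_law.
Hypotheses (a0 : (0 < a)%R) (b0 : (0 < b)%R) (k10 : (0 < k1)%R) (k20 : (0 < k2)%R).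

(** The right side of [gamma_law] sees only the open positive quadrant; signed functions pass
    through their positive and negative parts. This licenses rewriting with identities valid for
    positive arguments only. *)
Lemma gamma_law_eq (h h' : R * R -> \bar R) :
  measurable_fun setT h -> measurable_fun setT h' ->
  (forall x y, (0 < x)%R -> (0 < y)%R -> h (x, y) = h' (x, y)) ->
  \int[M]_u h u = \int[M]_u h' u.
Proof.
move=> mh mh' hh'.
have eqp (f f' : R * R -> \bar R) : measurable_fun setT f -> measurable_fun setT f' ->
    (forall u, 0 <= f u) -> (forall u, 0 <= f' u) ->
    (forall x y, (0 < x)%R -> (0 < y)%R -> f (x, y) = f' (x, y)) ->
    \int[M]_u f u = \int[M]_u f' u.
  move=> mf mf' f0 f'0 ff'; rewrite (lawM mf f0) (lawM mf' f'0).
  apply: eq_integral => x; rewrite inE/= in_itv/= andbT => x0.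
  by apply: eq_integral => y; rewrite inE/= in_itv/= andbT => y0; rewrite ff'.
rewrite integralE [RHS]integralE; congr (_ - _); apply: eqp.
- exact: measurable_funepos.
- exact: measurable_funepos.
- exact: funepos_ge0.
- exact: funepos_ge0.
- by move=> x y x0 y0; rewrite !funeposE hh'.
- exact: measurable_funeneg.
- exact: measurable_funeneg.
- exact: funeneg_ge0.
- exact: funeneg_ge0.
- by move=> x y x0 y0; rewrite !funenegE hh'.
Qed.

Lemma gamma_law_pos (h : R * R -> \bar R) : measurable_fun setT h ->
  (forall x y, (0 < x)%R -> (0 < y)%R -> 0 <= h (x, y)) ->
  \int[M]_u h u = \int[mu]_(x in pos) \int[mu]_(y in pos)
    (h (x, y) * (gamma_density a k1 x * gamma_density b k2 y)%:E).
Proof.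
move=> mh h0; have mah : measurable_fun setT (fun u => `|h u|) by exact: measurableT_comp.
rewrite (gamma_law_eq mh mah); last by move=> x y x0 y0; rewrite gee0_abs ?h0.
rewrite (lawM mah (fun u => abse_ge0 (h u))).
apply: eq_integral => x; rewrite inE/= in_itv/= andbT => x0.
apply: eq_integral => y; rewrite inE/= in_itv/= andbT => y0.
by rewrite gee0_abs ?h0.
Qed.

Lemma gamma_law_polar (A B s t : R) (h : R -> R) :
  (0 < a + b + A + B)%R -> (0 <= s)%R -> (0 <= t)%R -> measurable_fun setT h ->
  (forall z, (0 < z)%R -> (0 <= h z)%R) ->
  \int[M]_u (u.1 `^ A * u.2 `^ B * h (u.2 / u.1) * expR (- (s * u.1 + t * u.2)))%:E =
  (k1 `^ (- a) * k2 `^ (- b) / (Gamma a * Gamma b) * Gamma (a + b + A + B))%:E *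
  \int[mu]_(z in pos) (h z * z `^ (b + B - 1) *
    ((k1^-1 + s) + (k2^-1 + t) * z) `^ (- (a + b + A + B)))%:E.
Proof.
move=> ABp s0 t0 mh h0; pose c := (k1 `^ (- a) * k2 `^ (- b) / (Gamma a * Gamma b))%R.
have c0 : (0 <= c)%R.
  have Ga := ltW (Gamma_gt0 a0); have Gb := ltW (Gamma_gt0 b0).
  by apply: divr_ge0; apply: mulr_ge0; rewrite ?powR_ge0.
have mhd : measurable_fun setT (fun u : R * R => h (u.2 / u.1)%R).
  by apply: (measurableT_comp mh); mfun.
rewrite gamma_law_pos; last 2 first.
- apply/measurable_EFinP; apply: measurable_funM; last by mfun.
  by apply: measurable_funM; [mfun|exact: mhd].
- by move=> x y x0 y0; rewrite lee_fin !mulr_ge0 ?powR_ge0 ?expR_ge0 ?h0 ?divr_gt0.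
pose F (u : R * R) := (u.1 `^ (a + A - 1) * u.2 `^ (b + B - 1) * (c * h (u.2 / u.1)) *
    expR (- ((k1^-1 + s) * u.1 + (k2^-1 + t) * u.2)))%R.
have FE (x y : R) : (0 < x)%R -> (0 < y)%R ->
    (x `^ A * y `^ B * h (y / x) * expR (- (s * x + t * y)) *
      (gamma_density a k1 x * gamma_density b k2 y) = F (x, y))%R.
  move=> x0 y0; rewrite /F /gamma_density /c /fst /snd.
  have -> : (x `^ (a + A - 1) = x `^ A * x `^ (a - 1))%R.
    by rewrite -powRD ?(gt_eqF x0) ?implybT//; congr (_ `^ _)%R; ring.
  have -> : (y `^ (b + B - 1) = y `^ B * y `^ (b - 1))%R.
    by rewrite -powRD ?(gt_eqF y0) ?implybT//; congr (_ `^ _)%R; ring.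
  have -> : (expR (- ((k1^-1 + s) * x + (k2^-1 + t) * y)) =
    expR (- (s * x + t * y)) * (expR (- (k1^-1 * x)) * expR (- (k2^-1 * y))))%R.
    by rewrite -!expRD; congr expR; ring.
  by field; rewrite !gt_eqF ?Gamma_gt0.
transitivity (\int[mu]_(x in pos) \int[mu]_(y in pos) (F (x, y))%:E).
  apply: eq_integral => x; rewrite inE/= in_itv/= andbT => x0.
  apply: eq_integral => y; rewrite inE/= in_itv/= andbT => y0.
  by rewrite -EFinM; congr (_%:E); exact: FE.
have E : (a + b + A + B = (a + A) + (b + B))%R by ring.
have AB0 : (0 < (a + A) + (b + B))%R by rewrite -E.
have t10 : (0 < k1^-1 + s)%R by rewrite ltr_wpDr ?invr_gt0.
have t20 : (0 < k2^-1 + t)%R by rewrite ltr_wpDr ?invr_gt0.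
have mch : measurable_fun setT (fun z => c * h z)%R by mfun.
have ch0 z : (0 < z -> 0 <= c * h z)%R by move=> z0; rewrite mulr_ge0 ?h0.
rewrite E; apply: etrans (polar AB0 t10 t20 mch ch0) _.
rewrite (@eq_Rint _ _ _ (fun z => c * (h z * z `^ (b + B - 1) *
   ((k1^-1 + s) + (k2^-1 + t) * z) `^ (- (a + A + (b + B))))))%R; last first.
  by move=> z _; ring.
rewrite Rint_Zl//; last 2 first.
- by mfun.
- by move=> z; rewrite /= in_itv/= andbT => z0; rewrite !mulr_ge0 ?powR_ge0 ?h0.
by rewrite EFinM muleCA muleA.
Qed.

End GammaLaw.

Section GammaLawEstimator.
Local Open Scope ereal_scope.
Context (R : realType) (M : probability (R * R)%type R) (a b k1 k2 : R).
Local Notation mu := (@lebesgue_measure R).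
Local Notation pos := [set` `](0 : R)%R, +oo[ ].
Hypothesis lawM : gamma_law M a b k1 k2.
Hypotheses (a0 : (0 < a)%R) (b0 : (0 < b)%R) (k10 : (0 < k1)%R) (k20 : (0 < k2)%R).
Hypothesis ab2 : (2 < a + b)%R.

Lemma gamma_law_expR (s t : R) : (0 <= s)%R -> (0 <= t)%R ->
  \int[M]_u (expR (- (s * u.1 + t * u.2)))%:E =
  ((1 + k1 * s) `^ (- a) * (1 + k2 * t) `^ (- b))%:E.
Proof.
move=> s0 t0.
have t10 : (0 < k1^-1 + s)%R by rewrite ltr_wpDr ?invr_gt0.
have t20 : (0 < k2^-1 + t)%R by rewrite ltr_wpDr ?invr_gt0.
have Gab : (0 < Gamma (b + a))%R by rewrite Gamma_gt0// addr_gt0.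
have := @gamma_law_polar _ _ _ _ _ _ lawM a0 b0 k10 k20 0 0 s t (cst 1%R).
rewrite !addr0 => H; rewrite (gamma_law_eq lawM
   (h' := fun u => (u.1 `^ 0 * u.2 `^ 0 * 1 * expR (- (s * u.1 + t * u.2)))%:E)); last 3 first.
- by apply/measurable_EFinP; mfun.
- by apply/measurable_EFinP; mfun.
- by move=> x y _ _; rewrite !powRr0 !mul1r.
rewrite H//; last exact: addr_gt0.
rewrite (@eq_Rint _ _ _ (fun z => z `^ (b - 1) * ((k1^-1 + s) + (k2^-1 + t) * z) `^ (- (b + a)))%R); last first.
  by move=> z _; rewrite mul1r [(b + a)%R]addrC.
rewrite beta_integral// -EFinM; congr (_%:E).
have pE (c w r : R) : (0 < c)%R -> (0 <= w)%R ->
    ((1 + c * w) `^ (- r) = c `^ (- r) * (c^-1 + w) `^ (- r))%R.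
  move=> c0 w0; rewrite -powRM ?(ltW c0)//; last by rewrite addr_ge0// invr_ge0 ltW.
  by congr (_ `^ _)%R; field; rewrite gt_eqF.
rewrite !pE// [(a + b)%R]addrC; have Ga := Gamma_gt0 a0; have Gb := Gamma_gt0 b0.
by field; rewrite !gt_eqF.
Qed.

Section Estimator.
Variable nu : R.
Hypotheses (nu1 : (- b < 2 * nu)%R) (nu2 : (2 * nu < a)%R).

(* The estimator as a function of u = (alpha1 Y1, alpha2 Y2). *)
Definition estimator_radial (u : R * R) : R := (u.1^-1 * est_radial a b nu (u.2 / u.1))%R.

Let bn : (0 < b + nu)%R. Proof. by move: b0 nu1; lra. Qed.
Let N1 : (1 < a + b - 1)%R. Proof. by move: ab2; lra. Qed.

Lemma measurable_estimator_radial : measurable_fun setT estimator_radial.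
Proof.
apply: measurable_funM; first by mfun.
by apply: (measurableT_comp (measurable_est_radial a b0 bn)); mfun.
Qed.

Lemma estimator_radial_sq_lty : \int[M]_u (estimator_radial u ^+ 2)%:E < +oo.
Proof.
have mT := measurable_estimator_radial.
have mr := measurable_est_radial a b0 bn.
pose h z := (est_radial a b nu z ^+ 2)%R.
have mh : measurable_fun setT h by apply: measurable_funX.
have mhd : measurable_fun setT (fun u : R * R => h (u.2 / u.1)%R).
  by apply: (measurableT_comp mh); mfun.
rewrite (gamma_law_eq lawM
   (h' := fun u => (u.1 `^ (- 2) * u.2 `^ 0 * h (u.2 / u.1) * expR (- (0 * u.1 + 0 * u.2)))%:E)); last 3 first.
- by apply/measurable_EFinP; apply: measurable_funX.
- apply/measurable_EFinP; apply: measurable_funM; last by mfun.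
  by apply: measurable_funM; [mfun|exact: mhd].
- move=> x y x0 y0; rewrite /estimator_radial /h /= !mul0r addr0 oppr0 expR0 powRr0 !mulr1.
  rewrite exprMn exprVn -powR_invn ?ltW//.
rewrite (gamma_law_polar lawM a0 b0 k10 k20 (A := (- 2)%R) (B := 0%R) (h := h))//; last 2 first.
- by move: ab2; lra.
- by move=> z z0; exact: sqr_ge0.
apply: lte_mul_pinfty.
- have Gab : (0 < Gamma (a + b + - 2 + 0))%R by apply: Gamma_gt0; move: ab2; lra.
  have Ga := Gamma_gt0 a0; have Gb := Gamma_gt0 b0.
  rewrite lee_fin; apply: mulr_ge0; last exact: ltW.
  by apply: divr_ge0; [rewrite mulr_ge0 ?powR_ge0|apply/ltW; exact: mulr_gt0].
- by [].
have t10 : (0 < k1^-1 + 0)%R by rewrite addr0 invr_gt0.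
have t20 : (0 < k2^-1 + 0)%R by rewrite addr0 invr_gt0.
have := est_radial_sq_lty a0 b0 ab2 nu1 nu2 t10 t20; rewrite !addr0.
by rewrite (_ : (a - 2 + b = a + b - 2)%R); last by ring.
Qed.

(** The factor 1 / u1 lowers the homogeneity of the gamma weight from a + b to N = a + b - 1,
    exactly the exponent in [stieltjes_kernel]; the power 1 - b of the ratio cancels the one in the
    density. *)
Lemma gamma_law_kernel (p q s t : R) (w := ((k1^-1 + s) / (k2^-1 + t))%R) :
  (0 < p)%R -> (0 < q)%R -> (p + q = a + b)%R -> (0 <= s)%R -> (0 <= t)%R ->
  w != 1%R -> exists2 m : R,
  \int[M]_u (u.1 `^ (- 1) * u.2 `^ 0 * ((u.2 / u.1) `^ (1 - b) * kernel_fun (a + b - 1) p (u.2 / u.1)) *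
      expR (- (s * u.1 + t * u.2)))%:E = m%:E &
  ((q - 1) * m = k1 `^ (- a) * k2 `^ (- b) / (Gamma a * Gamma b) * (Gamma p * Gamma q)
     * (k2^-1 + t) `^ (1 - a - b) * ((1 - w `^ (1 - q)) / (w - 1)))%R.
Proof.
move=> p0 q0 pq s0 t0 w1; set N := (a + b - 1)%R.
have t10 : (0 < k1^-1 + s)%R by rewrite ltr_wpDr ?invr_gt0.
have t20 : (0 < k2^-1 + t)%R by rewrite ltr_wpDr ?invr_gt0.
have w0 : (0 < w)%R by exact: divr_gt0.
have pqN : (p + q = N + 1)%R by rewrite /N; lra.
have [m mE mq] := stieltjes_kernel N1 p0 q0 pqN w0 w1.
have GN : (0 < Gamma N)%R by apply: Gamma_gt0; rewrite /N; move: ab2; lra.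
exists (k1 `^ (- a) * k2 `^ (- b) / (Gamma a * Gamma b) * Gamma N *
   ((k2^-1 + t) `^ (- N) * m))%R; last first.
  rewrite [LHS](_ : _ = k1 `^ (- a) * k2 `^ (- b) / (Gamma a * Gamma b) * Gamma N *
   ((k2^-1 + t) `^ (- N) * ((q - 1) * m)))%R; last by ring.
  rewrite mq (_ : (1 - a - b = - N)%R); last by rewrite /N; ring.
  have Ga := Gamma_gt0 a0; have Gb := Gamma_gt0 b0.
  by rewrite -/N; set D := (_ / (w - 1))%R; field; rewrite !gt_eqF.
have mk := measurable_kernel_fun N p0.
have mh : measurable_fun setT (fun z => z `^ (1 - b) * kernel_fun N p z)%R.
  by apply: measurable_funM => //; mfun.
rewrite (gamma_law_polar lawM a0 b0 k10 k20 (A := (- 1)%R) (B := 0%R)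
  (h := fun z => z `^ (1 - b) * kernel_fun N p z)%R)//; last 2 first.
- by move: ab2; lra.
- by move=> z z0; rewrite mulr_ge0 ?powR_ge0 ?kernel_fun_ge0.
rewrite (_ : (a + b + - 1 + 0 = N)%R); last by rewrite /N; ring.
rewrite [in RHS]EFinM; congr (_ * _).
have zE (z : R) : (0 < z -> z `^ (1 - b) * kernel_fun N p z * z `^ (b + 0 - 1) *
    ((k1^-1 + s) + (k2^-1 + t) * z) `^ (- N) =
    (k2^-1 + t) `^ (- N) * (kernel_fun N p z * (w + z) `^ (- N)))%R.
  move=> z0; have -> : ((k1^-1 + s) + (k2^-1 + t) * z = (k2^-1 + t) * (w + z))%R.
    by rewrite mulrDr /w [X in (_ = X + _)%R]mulrC divfK ?gt_eqF.
  rewrite powRM ?(ltW t20)//; last by rewrite addr_ge0 ?ltW.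
  have E : (z `^ (1 - b) * z `^ (b + 0 - 1) = 1)%R.
    by rewrite -powRD ?(gt_eqF z0) ?implybT// (_ : (_ + _ = 0)%R) ?powRr0//; ring.
  rewrite [LHS](_ : _ = (z `^ (1 - b) * z `^ (b + 0 - 1)) *
    ((k2^-1 + t) `^ (- N) * (kernel_fun N p z * (w + z) `^ (- N))))%R; last by ring.
  by rewrite E mul1r.
rewrite (@eq_Rint _ _ _ (fun z => (k2^-1 + t) `^ (- N) * (kernel_fun N p z * (w + z) `^ (- N)))%R); last first.
  by move=> z; rewrite /= in_itv/= andbT; exact: zE.
rewrite Rint_Zl ?powR_ge0//; last 2 first.
- by apply: measurable_funM => //; mfun.
- by move=> z; rewrite /= in_itv/= andbT => z0; rewrite mulr_ge0 ?powR_ge0 ?kernel_fun_ge0.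
by rewrite mE EFinM.
Qed.

End Estimator.
End GammaLawEstimator.

(** * Square integrable functions and density of exponentials *)

Section SquareIntegrable.
Context d (T : measurableType d) (R : realType) (P : probability T R).
Implicit Types (f g h : T -> R).

Definition sq_integrable f : Prop :=
  measurable_fun setT f /\ (\int[P]_x (f x ^+ 2)%:E < +oo)%E.

Definition sqnorm f : R := \int[P]_x (f x ^+ 2).

Definition inner f g : R := \int[P]_x (f x * g x).

Lemma sq_integrable_sq f : sq_integrable f ->
  P.-integrable setT (EFin \o (fun x => f x ^+ 2)).
Proof.
move=> [mf fy]; apply/integrableP; split.
  by apply/measurable_EFinP; exact: measurable_funX.
by under eq_integral do rewrite /= ger0_norm ?sqr_ge0//.
Qed.

Lemma sq_integrableM f g : sq_integrable f -> sq_integrable g ->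
  P.-integrable setT (EFin \o (fun x => f x * g x)).
Proof.
move=> hf hg; have [mf _] := hf; have [mg _] := hg.
have := integrableD measurableT (sq_integrable_sq hf) (sq_integrable_sq hg).
apply: le_integrable => //.
  by apply/measurable_EFinP; exact: measurable_funM.
move=> x _ /=; rewrite lee_fin [leRHS]ger0_norm ?addr_ge0 ?sqr_ge0// normrM.
rewrite -(real_normK (num_real (f x))) -(real_normK (num_real (g x))).
by have := sqr_ge0 (`|f x| - `|g x|); have := sqr_ge0 (`|f x| + `|g x|); lra.
Qed.

Lemma integrable_sq f : measurable_fun setT f ->
  P.-integrable setT (EFin \o (fun x => f x ^+ 2)) -> sq_integrable f.
Proof. by move=> mf h; split => //; exact: (integrable_lty measurableT h). Qed.

Lemma sq_integrableZ (c : R) f : sq_integrable f -> sq_integrable (fun x => c * f x).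
Proof.
move=> hf; have [mf _] := hf; apply: integrable_sq; first exact: measurable_funM.
have := integrableZl measurableT (c ^+ 2) (sq_integrable_sq hf).
by apply: eq_integrable => // x _; rewrite /= -EFinM exprMn.
Qed.

Lemma sq_integrableD f g : sq_integrable f -> sq_integrable g ->
  sq_integrable (fun x => f x + g x).
Proof.
move=> hf hg; have [mf _] := hf; have [mg _] := hg.
apply: integrable_sq; first exact: measurable_funD.
have := integrableD measurableT (integrableD measurableT (sq_integrable_sq hf)
  (integrableZl measurableT 2 (sq_integrableM hf hg))) (sq_integrable_sq hg).
by apply: eq_integrable => // x _; rewrite /= -!EFinM -!EFinD sqrrD mulr2n mulrDl mul1r.
Qed.

Lemma sq_integrableB f g : sq_integrable f -> sq_integrable g ->
  sq_integrable (fun x => f x - g x).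
Proof.
move=> hf hg; have := sq_integrableD hf (sq_integrableZ (-1) hg).
by congr sq_integrable; apply/funext => x; rewrite mulN1r.
Qed.

Lemma sq_integrable_bounded (c : R) f : measurable_fun setT f ->
  (forall x, `|f x| <= c) -> sq_integrable f.
Proof.
move=> mf fc; apply: integrable_sq => //.
apply: (@le_integrable _ _ _ _ _ measurableT _ (EFin \o cst (c ^+ 2))).
- by apply/measurable_EFinP; exact: measurable_funX.
- move=> x _; rewrite /= lee_fin !ger0_norm ?sqr_ge0//.
  by rewrite -real_normK ?num_real// ler_sqr ?nnegrE// (le_trans _ (fc x)).
- exact: finite_measure_integrable_cst.
Qed.

Lemma innerC f g : inner f g = inner g f.
Proof. by apply: eq_Rintegral => x _; rewrite mulrC. Qed.

Lemma innerZl (c : R) f g : sq_integrable f -> sq_integrable g ->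
  inner (fun x => c * f x) g = c * inner f g.
Proof.
move=> hf hg; rewrite /inner -RintegralZl//; last exact: sq_integrableM.
by apply: eq_Rintegral => x _; rewrite mulrA.
Qed.

Lemma innerDl f g h : sq_integrable f -> sq_integrable g -> sq_integrable h ->
  inner (fun x => f x + g x) h = inner f h + inner g h.
Proof.
move=> hf hg hh; rewrite /inner -RintegralD//; try exact: sq_integrableM.
by apply: eq_Rintegral => x _; rewrite mulrDl.
Qed.

Lemma innerBl f g h : sq_integrable f -> sq_integrable g -> sq_integrable h ->
  inner (fun x => f x - g x) h = inner f h - inner g h.
Proof.
move=> hf hg hh; rewrite /inner -RintegralB//; try exact: sq_integrableM.
by apply: eq_Rintegral => x _; rewrite mulrBl.
Qed.

Lemma sqnormE f : sqnorm f = inner f f.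
Proof. by apply: eq_Rintegral => x _; rewrite expr2. Qed.

Lemma sqnorm_ge0 f : 0 <= sqnorm f.
Proof. by apply: Rintegral_ge0 => x _; exact: sqr_ge0. Qed.

Lemma EFin_sqnorm f : sq_integrable f -> (sqnorm f)%:E = (\int[P]_x (f x ^+ 2)%:E)%E.
Proof. by move=> hf; rewrite fineK//; exact: (integrable_fin_num _ (sq_integrable_sq hf)). Qed.

Lemma sqnormD f g : sq_integrable f -> sq_integrable g ->
  sqnorm (fun x => f x + g x) = sqnorm f + 2 * inner f g + sqnorm g.
Proof.
move=> hf hg; have hfg := sq_integrableD hf hg.
rewrite !sqnormE innerDl// !(innerC _ (fun x => f x + g x)) !innerDl//.
by rewrite (innerC g f); ring.
Qed.

Lemma sqnormZ (c : R) f : sq_integrable f -> sqnorm (fun x => c * f x) = c ^+ 2 * sqnorm f.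
Proof.
move=> hf; have hcf := sq_integrableZ c hf.
by rewrite !sqnormE innerZl// innerC innerZl// mulrA expr2.
Qed.

Lemma sqnormB f g : sq_integrable f -> sq_integrable g ->
  sqnorm (fun x => f x - g x) = sqnorm f - 2 * inner f g + sqnorm g.
Proof.
move=> hf hg; have hg' := sq_integrableZ (-1) hg.
have -> : (fun x => f x - g x) = (fun x => f x + (-1) * g x).
  by apply/funext => x; rewrite mulN1r.
rewrite sqnormD// sqnormZ// innerC innerZl// innerC; ring.
Qed.

Lemma sqnormD_le f g : sq_integrable f -> sq_integrable g ->
  sqnorm (fun x => f x + g x) <= 2 * sqnorm f + 2 * sqnorm g.
Proof.
move=> hf hg; have := sqnorm_ge0 (fun x => f x - g x).
by rewrite sqnormB// sqnormD//; lra.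
Qed.

Lemma cauchy_schwarz_inner f g : sq_integrable f -> sq_integrable g ->
  inner f g ^+ 2 <= sqnorm f * sqnorm g.
Proof.
move=> hf hg; have h c : 0 <= sqnorm f - 2 * c * inner f g + c ^+ 2 * sqnorm g.
  have := sqnorm_ge0 (fun x => f x - c * g x).
  rewrite sqnormB ?sqnormZ//; last exact: sq_integrableZ.
  by rewrite innerC innerZl// (innerC g) mulrA.
have [g0|g0] := eqVneq (sqnorm g) 0.
  have [i0|i0] := eqVneq (inner f g) 0; first by rewrite i0 g0 expr0n mulr0.
  (* With [sqnorm g = 0] the quadratic is affine in [c]; this [c] gives it the value -1. *)
  have := h ((sqnorm f + 1) / (2 * inner f g)).
  rewrite g0 mulr0 addr0.
  have -> : sqnorm f - 2 * ((sqnorm f + 1) / (2 * inner f g)) * inner f g = -1 by field.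
  by rewrite ler0N1.
have gp : 0 < sqnorm g by rewrite lt_neqAle eq_sym g0 sqnorm_ge0.
have := h (inner f g / sqnorm g).
have -> : sqnorm f - 2 * (inner f g / sqnorm g) * inner f g +
    (inner f g / sqnorm g) ^+ 2 * sqnorm g =
    (sqnorm f * sqnorm g - inner f g ^+ 2) / sqnorm g by field.
by rewrite ler_pdivlMr// mul0r subr_ge0.
Qed.

Lemma sqnorm_dominated (f_ : (T -> R)^nat) f g :
  (forall n, measurable_fun setT (f_ n)) -> measurable_fun setT f ->
  P.-integrable setT (EFin \o g) ->
  {ae P, forall x, f_ ^~ x @ \oo --> f x} ->
  {ae P, forall x n, (f x - f_ n x) ^+ 2 <= g x} ->
  sqnorm (fun x => f x - f_ n x) @[n --> \oo] --> 0.
Proof.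
move=> mf_ mf ig cvf bf.
have := @dominated_convergence _ _ _ P _ measurableT
  (fun n x => ((f x - f_ n x) ^+ 2)%:E) (cst 0%E) (EFin \o g).
case.
- by move=> n; apply/measurable_EFinP; apply: measurable_funX; exact: measurable_funB.
- exact: measurable_cst.
- apply: filterS cvf => x fx _; apply: cvg_EFin; first exact: nearW.
  rewrite (_ : (0 : R) = (f x - f x) ^+ 2); last by rewrite subrr expr0n.
  rewrite [X in X @ _ --> _](_ : _ = (fun y => (f x - y) ^+ 2) \o (f_ ^~ x))//.
  apply: continuous_cvg => //.
  apply: (@continuous_comp _ _ _ (fun y => f x - y) (fun y => y ^+ 2)).
    by apply: continuousB; [exact: cvg_cst|exact: cvg_id].
  exact: exprn_continuous.
- by [].
- by apply: filterS bf => x bx n _; rewrite /= lee_fin ger0_norm ?sqr_ge0.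
move=> _ _; rewrite integral0 => /fine_cvgP[_].
exact.
Qed.

Section Closure.
Variable E : set (T -> R).
Hypothesis E_sq : forall p, E p -> sq_integrable p.
Hypothesis E0 : E (cst 0).
Hypothesis E_lin : forall c p q, E p -> E q -> E (fun x => c * p x + q x).

Definition sq_closure f : Prop :=
  sq_integrable f /\ forall e, 0 < e -> exists2 p, E p & sqnorm (fun x => f x - p x) < e.

Lemma subset_sq_closure p : E p -> sq_closure p.
Proof.
move=> Ep; split; first exact: E_sq.
move=> e e0; exists p => //; rewrite (_ : (fun x => p x - p x) = cst 0); last first.
  by apply/funext => x; rewrite subrr.
by rewrite /sqnorm /cst expr0n /= Rintegral_cst// mul0r.
Qed.

Lemma sq_closure_lin c f g : sq_closure f -> sq_closure g ->
  sq_closure (fun x => c * f x + g x).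
Proof.
move=> [hf cf] [hg cg]; split; first by apply: sq_integrableD => //; exact: sq_integrableZ.
move=> e e0; pose C := 4 * (c ^+ 2 + 1).
have C0 : 0 < C by rewrite mulr_gt0// ltr_wpDl ?sqr_ge0.
have eC : 0 < e / C by rewrite divr_gt0.
have [p Ep fp] := cf _ eC; have [q Eq gq] := cg _ eC.
exists (fun x => c * p x + q x); first exact: E_lin.
have hp := E_sq Ep; have hq := E_sq Eq.
have -> : (fun x => c * f x + g x - (c * p x + q x)) =
    (fun x => c * (f x - p x) + (g x - q x)) by apply/funext => x; ring.
have hfp := sq_integrableB hf hp; have hgq := sq_integrableB hg hq.
apply: le_lt_trans (sqnormD_le (sq_integrableZ c hfp) hgq) _.
rewrite sqnormZ//; rewrite ltr_pdivlMr// in fp; rewrite ltr_pdivlMr// in gq.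
rewrite /C in fp gq; have := sqr_ge0 c.
by have := sqnorm_ge0 (fun x => f x - p x); have := sqnorm_ge0 (fun x => g x - q x); nra.
Qed.

Lemma sq_closure_closed f (f_ : (T -> R)^nat) : sq_integrable f ->
  (forall n, sq_closure (f_ n)) -> sqnorm (fun x => f x - f_ n x) @[n --> \oo] --> 0 ->
  sq_closure f.
Proof.
move=> hf cf_ cvf; split => // e e0.
have e4 : 0 < e / 4 by rewrite divr_gt0.
have [n _ /(_ n (leqnn n))] := (cvgrPdist_lt _ _).1 cvf _ e4.
rewrite /= sub0r normrN ger0_norm ?sqnorm_ge0// => fn.
have [hfn /(_ _ e4)[p Ep pn]] := cf_ n.
exists p => //.
have -> : (fun x => f x - p x) = (fun x => (f x - f_ n x) + (f_ n x - p x)).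
  by apply/funext => x; ring.
apply: le_lt_trans (sqnormD_le (sq_integrableB hf hfn) (sq_integrableB hfn (E_sq Ep))) _.
lra.
Qed.

Lemma sq_closure_sum I (r : seq I) (F : I -> T -> R) :
  (forall i, sq_closure (F i)) -> sq_closure (fun x => \sum_(i <- r) F i x).
Proof.
move=> cF; elim: r => [|i r IH].
  under eq_fun do rewrite big_nil; exact: (subset_sq_closure E0).
under eq_fun do rewrite big_cons -[F i _]mul1r; exact: sq_closure_lin.
Qed.

Import HBNNSimple.

(** Positive and negative parts are treated separately, each as a dominated limit of simple
    functions. *)
Lemma sq_closure_dense f : (forall A, measurable A -> sq_closure \1_A) ->
  sq_integrable f -> sq_closure f.
Proof.
move=> cA.
suff pos g : sq_integrable g -> (forall x, 0 <= g x) -> sq_closure g.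
  move=> hf; have [mf fy] := hf.
  pose fp x := Num.max (f x) 0; pose fm x := Num.max (- f x) 0.
  have mp : measurable_fun setT fp by apply: measurable_maxr.
  have mm : measurable_fun setT fm by apply: measurable_maxr => //; exact: measurable_funTN.
  have sq h : measurable_fun setT h -> (forall x, `|h x| <= `|f x|) -> sq_integrable h.
    move=> mh hb; apply: integrable_sq => //.
    apply: (le_integrable _ _ _ (sq_integrable_sq hf)) => //.
      by apply/measurable_EFinP; exact: measurable_funX.
    move=> x _; rewrite /= lee_fin !normrX.
    by rewrite ler_sqr ?nnegrE.
  have -> : f = (fun x => (-1) * fm x + fp x).
    apply/funext => x; rewrite /fm /fp mulN1r.
    have [x0|x0] := leP 0 (f x).
      by rewrite (@max_r _ _ (- f x)) ?max_l ?oppr0 ?add0r// oppr_le0.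
    by rewrite (@max_l _ _ (- f x)) ?max_r ?opprK ?addr0 ?oppr_ge0 ?ltW.
  have sm : sq_integrable fm.
    apply: (sq _ mm) => x; have := ler_norm (- f x); rewrite normrN => fx.
    by rewrite /fm ger0_norm ?ge_max ?fx ?normr_ge0// le_max lexx orbT.
  have sp : sq_integrable fp.
    apply: (sq _ mp) => x.
    by rewrite /fp ger0_norm ?ge_max ?ler_norm ?normr_ge0// le_max lexx orbT.
  apply: sq_closure_lin; [apply: (pos _ sm)|apply: (pos _ sp)] => x.
    by rewrite /fm le_max lexx orbT.
  by rewrite /fp le_max lexx orbT.
move=> hg g0; have [mg _] := hg.
have mgE : measurable_fun setT (EFin \o g) by exact/measurable_EFinP.
pose g_ n : {nnsfun T >-> R} := nnsfun_approx measurableT mgE n.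
have gle n x : g_ n x <= g x.
  by rewrite -lee_fin /g_ nnsfun_approxE; apply: le_approx => // y _; rewrite /= lee_fin.
apply: (@sq_closure_closed _ (fun n => g_ n)) => //.
- move=> n; have -> : (g_ n : T -> R) = (fun x => \sum_(y <- finmap.enum_fset (fset_set (range (g_ n))))
      y * \1_(g_ n @^-1` [set y]) x).
    by apply/funext => x; rewrite {1}fimfunE fsbig_finite.
  apply: sq_closure_sum => y; under eq_fun do rewrite -[_ * _]addr0.
  by apply: sq_closure_lin; [exact: cA|exact: subset_sq_closure].
apply: (sqnorm_dominated (g := fun x => g x ^+ 2)) => //.
- exact: sq_integrable_sq.
- apply: aeW => x; have := @cvg_nnsfun_approx _ _ _ _ measurableT _ mgE.
  by move=> /(_ (fun y _ => g0 y) x I) /fine_cvgP[_].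
- apply: aeW => x n; have := gle n x; have : 0 <= g_ n x by []. have := g0 x; nra.
Qed.

End Closure.
End SquareIntegrable.

(** * Transforms against the normalized exponentials *)

Section ExpKernel.
Local Open Scope ereal_scope.
Context (R : realType) (M : probability (R * R)%type R) (a b k1 k2 : R).
Hypothesis lawM : gamma_law M a b k1 k2.
Hypotheses (a0 : (0 < a)%R) (b0 : (0 < b)%R) (k10 : (0 < k1)%R) (k20 : (0 < k2)%R).
Implicit Types (w : R * R).

Definition exp_kernel w (u : R * R) : R :=
  ((1 - w.1) `^ (- a) * (1 - w.2) `^ (- b) *
   expR (- (w.1 / (k1 * (1 - w.1)) * u.1 + w.2 / (k2 * (1 - w.2)) * u.2)))%R.

Definition unit_square : set (R * R) :=
  [set w | (0 <= w.1 < 1)%R /\ (0 <= w.2 < 1)%R].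

Lemma integral_exp_kernelM w w' : unit_square w -> unit_square w' ->
  \int[M]_u (exp_kernel w u * exp_kernel w' u)%:E =
  ((1 - w.1 * w'.1) `^ (- a) * (1 - w.2 * w'.2) `^ (- b))%:E.
Proof.
case: w w' => [r s] [r' s'] [/= /andP[r0 r1] /andP[s0 s1]] [/= /andP[r'0 r'1] /andP[s'0 s'1]].
have pE (k x x' p : R) : (0 < k)%R -> (0 <= x)%R -> (x < 1)%R -> (0 <= x')%R -> (x' < 1)%R ->
    ((1 - x) `^ p * (1 - x') `^ p *
      (1 + k * (x / (k * (1 - x)) + x' / (k * (1 - x')))) `^ p = (1 - x * x') `^ p)%R.
  move=> k0 x0 x1 x'0 x'1; have X : (0 < 1 - x)%R by lra.
  have X' : (0 < 1 - x')%R by lra.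
  have E : (1 + k * (x / (k * (1 - x)) + x' / (k * (1 - x'))) =
     (1 - x * x') / ((1 - x) * (1 - x')))%R.
    by field; rewrite !gt_eqF.
  have xx' : (0 < 1 - x * x')%R by nra.
  by rewrite E -!powRM ?(ltW X) ?(ltW X') ?mulr_ge0 ?invr_ge0 ?(ltW X) ?(ltW X') ?(ltW xx')//;
    [congr (_ `^ _)%R; field; rewrite !gt_eqF|rewrite !mulr_ge0 ?invr_ge0 ?mulr_ge0 ?ltW].
have t0 (k x : R) : (0 < k)%R -> (0 <= x)%R -> (x < 1)%R -> (0 <= x / (k * (1 - x)))%R.
  by move=> *; rewrite divr_ge0// mulr_ge0 ?(ltW _)//; lra.
set s1_ := (r / (k1 * (1 - r)) + r' / (k1 * (1 - r')))%R.
set s2_ := (s / (k2 * (1 - s)) + s' / (k2 * (1 - s')))%R.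
pose c := (((1 - r) `^ (- a) * (1 - r') `^ (- a)) * ((1 - s) `^ (- b) * (1 - s') `^ (- b)))%R.
have c0 : (0 <= c)%R by rewrite !mulr_ge0 ?powR_ge0.
transitivity (\int[M]_u (c%:E * (expR (- (s1_ * u.1 + s2_ * u.2)))%:E)).
  apply: eq_integral => u _; rewrite -EFinM; congr (_%:E).
  rewrite /exp_kernel /= (_ : - (s1_ * u.1 + s2_ * u.2) =
   - (r / (k1 * (1 - r)) * u.1 + s / (k2 * (1 - s)) * u.2) +
   - (r' / (k1 * (1 - r')) * u.1 + s' / (k2 * (1 - s')) * u.2))%R.
    by rewrite expRD /c; ring.
  by rewrite /s1_ /s2_; ring.
have mE : measurable_fun setT (fun u : R * R => (expR (- (s1_ * u.1 + s2_ * u.2)))%:E).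
  by apply/measurable_EFinP; mfun.
have E0 (u : R * R) : setT u -> 0 <= (expR (- (s1_ * u.1 + s2_ * u.2)))%:E.
  by move=> _; rewrite lee_fin expR_ge0.
rewrite (ge0_integralZl M measurableT mE E0) ?lee_fin//.
rewrite (gamma_law_expR lawM)//; last 2 first.
- by rewrite addr_ge0 ?t0.
- by rewrite addr_ge0 ?t0.
rewrite -EFinM; congr (_%:E).
rewrite -(pE k1 r r')// -(pE k2 s s')// /c /s1_ /s2_; ring.
Qed.

Lemma powR_ratio (x y p : R) : (0 < x)%R -> (0 < y)%R -> ((x / y) `^ p = x `^ p * y `^ (- p))%R.
Proof.
move=> x0 y0; rewrite powRM ?invr_ge0 ?ltW// -powR_inv1 ?ltW// -powRrM.
by rewrite mulN1r.
Qed.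

Section Estimator.
Hypothesis ab2 : (2 < a + b)%R.
Variable nu : R.
Hypotheses (nu1 : (- b < 2 * nu)%R) (nu2 : (2 * nu < a)%R).

(** The coefficients of the two kernels carry the factors q - 1 with which their transforms are
    known. In the difference of (1 - w^(1-a)) / (w - 1) and (1 - w^(1-a+nu)) / (w - 1) the constants
    cancel. *)
Lemma gamma_law_estimator_expR (s t : R) (w := ((k1^-1 + s) / (k2^-1 + t))%R) :
  (0 <= s)%R -> (0 <= t)%R -> w != 1%R ->
  \int[M]_u (estimator_radial a b nu u * expR (- (s * u.1 + t * u.2)))%:E =
  (k1 `^ (- a) * k2 `^ (- b) * (k2^-1 + t) `^ (1 - a - b) *
    (w `^ (1 - a) * (w `^ nu - 1) / (w - 1)))%:E.
Proof.
move=> s0 t0 w1; have bn : (0 < b + nu)%R by move: b0 nu1; lra.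
have an : (0 < a - nu)%R by move: a0 nu2; lra.
have N1 : (1 < a + b - 1)%R by move: ab2; lra.
have w0 : (0 < w)%R by rewrite divr_gt0// ltr_wpDr ?invr_gt0.
have Ga := Gamma_gt0 a0; have Gb := Gamma_gt0 b0.
have Gan := Gamma_gt0 an; have Gbn := Gamma_gt0 bn.
pose S p (u : R * R) := (u.1 `^ (- 1) * u.2 `^ 0 * ((u.2 / u.1) `^ (1 - b) *
  kernel_fun (a + b - 1) p (u.2 / u.1)) * expR (- (s * u.1 + t * u.2)))%R.
have mS p : (0 < p)%R -> measurable_fun setT (S p).
  move=> p0; apply: measurable_funM; last by mfun.
  apply: measurable_funM; first by mfun.
  apply: measurable_funM; first by mfun.
  by apply: (measurableT_comp (measurable_kernel_fun _ p0)); mfun.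
have S0 p x y : (0 < p)%R -> (0 < x)%R -> (0 < y)%R -> (0 <= S p (x, y))%R.
  move=> p0 x0 y0; rewrite /S; apply: mulr_ge0; last exact: expR_ge0.
  apply: mulr_ge0; first by rewrite mulr_ge0 ?powR_ge0.
  by apply: mulr_ge0; [exact: powR_ge0|apply: kernel_fun_ge0 => //; rewrite divr_gt0].
have pq1 : (b + a = a + b)%R by ring.
have pq2 : (b + nu + (a - nu) = a + b)%R by ring.
have [m1 m1E m1q] := gamma_law_kernel lawM a0 b0 k10 k20 ab2 b0 a0 pq1 s0 t0 w1.
have [m2 m2E m2q] := gamma_law_kernel lawM a0 b0 k10 k20 ab2 bn an pq2 s0 t0 w1.
(* Each kernel is nonnegative on the quadrant, so the finite transform already makes it integrable
   and the difference may be integrated termwise. *)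
have iS p m : (0 < p)%R -> \int[M]_u (S p u)%:E = m%:E -> M.-integrable setT (EFin \o S p).
  move=> p0 pm; apply/integrableP; split; first by apply/measurable_EFinP; exact: mS.
  rewrite (gamma_law_eq lawM (h' := EFin \o S p)) ?pm ?ltry//.
  - by apply: measurableT_comp => //; apply/measurable_EFinP; exact: mS.
  - by apply/measurable_EFinP; exact: mS.
  - by move=> x y x0 y0; rewrite /= ger0_norm ?S0.
pose C1 := (Gamma a * Gamma b * ((a - 1) / (Gamma b * Gamma a)))%R.
pose C2 := (Gamma a * Gamma b * ((a - nu - 1) / (Gamma (b + nu) * Gamma (a - nu))))%R.
have i1 := iS _ _ b0 m1E; have i2 := iS _ _ bn m2E.
have TE (x y : R) : (0 < x)%R -> (0 < y)%R ->
    (estimator_radial a b nu (x, y) * expR (- (s * x + t * y)) =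
     C1 * S b (x, y) - C2 * S (b + nu) (x, y))%R.
  move=> x0 y0; have z0 : (0 < y / x)%R by rewrite divr_gt0.
  have := est_radialE a0 b0 an bn z0; rewrite /normalized_kernel.
  rewrite (_ : (a + b - 1 - b = a - 1)%R); last by ring.
  rewrite (_ : (a + b - 1 - (b + nu) = a - nu - 1)%R); last by ring.
  rewrite (_ : (a + b - 1 + 1 - b = a)%R); last by ring.
  rewrite (_ : (a + b - 1 + 1 - (b + nu) = a - nu)%R); last by ring.
  rewrite /estimator_radial /S /C1 /C2 /fst /snd powRr0 powR_inv1 ?(ltW x0)//.
  have : ((y / x) `^ (1 - b) * (y / x) `^ (b - 1) = 1)%R.
    by rewrite -powRD ?(gt_eqF z0) ?implybT// (_ : (_ + _ = 0)%R) ?powRr0//; ring.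
  set Z := (_ `^ (1 - b))%R; set Z' := (_ `^ (b - 1))%R.
  set K1 := kernel_fun _ _ _; set K2 := kernel_fun _ _ _; set E := expR _.
  set F := est_radial _ _ _ _ => ZZ h.
  rewrite (_ : F = Z * (Z' * F))%R; last by rewrite mulrA ZZ mul1r.
  rewrite h; ring.
rewrite (gamma_law_eq lawM (h' := fun u => (C1 * S b u)%:E - (C2 * S (b + nu) u)%:E)); last 3 first.
- apply/measurable_EFinP; apply: measurable_funM; last by mfun.
  exact: measurable_estimator_radial.
- apply: emeasurable_funB; apply/measurable_EFinP; apply: measurable_funM => //; exact: mS.
- by move=> x y x0 y0; rewrite -EFinB TE.
rewrite integralB//; last 2 first.
- exact: (integrableZl measurableT C1 i1).
- exact: (integrableZl measurableT C2 i2).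
under eq_integral do rewrite EFinM.
rewrite integralZl// [X in _ - X](_ : _ = C2%:E * m2%:E); last first.
  by under eq_integral do rewrite EFinM; rewrite integralZl// m2E.
rewrite m1E -!EFinM -EFinB; congr (_%:E).
rewrite (_ : C1 * m1 = Gamma a * Gamma b / (Gamma b * Gamma a) * ((a - 1) * m1))%R; last first.
  by rewrite /C1; ring.
rewrite (_ : C2 * m2 = Gamma a * Gamma b / (Gamma (b + nu) * Gamma (a - nu)) * ((a - nu - 1) * m2))%R; last first.
  by rewrite /C2; ring.
rewrite m1q m2q.
have -> : (w `^ (1 - (a - nu)) = w `^ (1 - a) * w `^ nu)%R.
  by rewrite -powRD ?(gt_eqF w0) ?implybT//; congr (_ `^ _)%R; ring.
rewrite -/w; set W := (w `^ (1 - a))%R; set V := (w `^ nu)%R.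
have w10 : (w - 1 != 0)%R by rewrite subr_eq0.
set K1 := (_ `^ (- a))%R; set K2 := (_ `^ (- b))%R; set K3 := (_ `^ (1 - a - b))%R.
move: w10; set D := (w - 1)%R => w10.
by field; rewrite w10 !gt_eqF.
Qed.

(** [exp_kernel w] is the likelihood ratio between the product gamma laws of scales (k1', k2') and
    (k1, k2), so the left side is the mean of the estimator at the new scales. *)
Lemma integral_estimator_exp_kernel w : unit_square w ->
  let k1' := (k1 * (1 - w.1))%R in let k2' := (k2 * (1 - w.2))%R in k1' != k2' ->
  \int[M]_u (estimator_radial a b nu u * exp_kernel w u)%:E =
  (k1'^-1 * ((k2' / k1') `^ nu - 1) / (k2' / k1' - 1))%:E.
Proof.
case: w => r s [/= /andP[r0 r1] /andP[s0 s1]].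
set k1' := (k1 * _)%R; set k2' := (k2 * _)%R => kk.
have R1 : (0 < 1 - r)%R by lra.
have S1 : (0 < 1 - s)%R by lra.
have k1'0 : (0 < k1')%R by rewrite mulr_gt0.
have k2'0 : (0 < k2')%R by rewrite mulr_gt0.
have E1 : (k1^-1 + r / (k1 * (1 - r)) = k1'^-1)%R.
  by rewrite /k1'; field; rewrite !gt_eqF.
have E2 : (k2^-1 + s / (k2 * (1 - s)) = k2'^-1)%R.
  by rewrite /k2'; field; rewrite !gt_eqF.
have t10 : (0 <= r / (k1 * (1 - r)))%R by rewrite divr_ge0// ltW.
have t20 : (0 <= s / (k2 * (1 - s)))%R by rewrite divr_ge0// ltW.
have wE : ((k1^-1 + r / (k1 * (1 - r))) / (k2^-1 + s / (k2 * (1 - s))) = k2' / k1')%R.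
  by rewrite E1 E2 invrK mulrC.
have w1 : ((k1^-1 + r / (k1 * (1 - r))) / (k2^-1 + s / (k2 * (1 - s))) != 1)%R.
  rewrite wE; apply: contra kk => /eqP h; apply/eqP.
  by rewrite -[RHS](@divfK _ k1') ?gt_eqF// h mul1r.
have H := gamma_law_estimator_expR t10 t20 w1; rewrite wE in H.
pose c := ((1 - r) `^ (- a) * (1 - s) `^ (- b))%R.
pose e (u : R * R) := expR (- (r / (k1 * (1 - r)) * u.1 + s / (k2 * (1 - s)) * u.2)).
have sqT : sq_integrable M (estimator_radial a b nu).
  split; first exact: measurable_estimator_radial.
  exact: (estimator_radial_sq_lty lawM).
have sqe : sq_integrable M e.
  split; first by rewrite /e; mfun.
  have := gamma_law_expR lawM a0 b0 k10 k20 (addr_ge0 t10 t10) (addr_ge0 t20 t20).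
  rewrite (_ : \int[M]_u (expR _)%:E = \int[M]_u (e u ^+ 2)%:E) => [->|].
    by rewrite ltry.
  by apply: eq_integral => u _; rewrite /e expr2 -expRD; congr (expR _)%:E; ring.
transitivity (c%:E * \int[M]_u (estimator_radial a b nu u * e u)%:E).
  have := sq_integrableM sqT sqe => iTe; rewrite -integralZl//.
  by apply: eq_integral => u _; rewrite -EFinM; congr (_%:E); rewrite mulrCA.
rewrite H -EFinM; congr (_%:E); rewrite E2 /c.
have p1 : ((1 - r) `^ (- a) * k1 `^ (- a) = k1' `^ (- a))%R.
  by rewrite -powRM ?ltW// mulrC.
have p2 : ((1 - s) `^ (- b) * k2 `^ (- b) = k2' `^ (- b))%R.
  by rewrite -powRM ?ltW// mulrC.
rewrite (powR_ratio (1 - a) k2'0 k1'0).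
have -> : (k2'^-1 `^ (1 - a - b) = k2' `^ (a + b - 1))%R.
  rewrite -powR_inv1 ?ltW// -powRrM; congr (_ `^ _)%R; ring.
set W := (_ / (k2' / k1' - 1))%R in H *; set V := ((k2' / k1') `^ nu - 1)%R.
rewrite [LHS](_ : _ = ((1 - r) `^ (- a) * k1 `^ (- a)) * ((1 - s) `^ (- b) * k2 `^ (- b)) *
  k2' `^ (a + b - 1) * k2' `^ (1 - a) * k1' `^ (- (1 - a)) * V / (k2' / k1' - 1))%R; last by ring.
rewrite p1 p2.
have q1 : (k2' `^ (- b) * k2' `^ (a + b - 1) * k2' `^ (1 - a) = 1)%R.
  rewrite -!powRD ?(gt_eqF k2'0) ?implybT// (_ : (_ + _ = 0)%R) ?powRr0//; ring.
have q2 : (k1' `^ (- a) * k1' `^ (- (1 - a)) = k1'^-1)%R.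
  rewrite -!powRD ?(gt_eqF k1'0) ?implybT// -powR_inv1 ?ltW//; congr (_ `^ _)%R; ring.
rewrite [LHS](_ : _ = (k1' `^ (- a) * k1' `^ (- (1 - a))) *
  (k2' `^ (- b) * k2' `^ (a + b - 1) * k2' `^ (1 - a)) * V / (k2' / k1' - 1))%R; last by ring.
by rewrite q1 q2 mulr1.
Qed.

End Estimator.
End ExpKernel.

(** * Indicator functions in a closed subspace *)

Section ClosureGen.
Context d (T : measurableType d) (R : realType) (P : probability T R).
Variable E : set (T -> R).
Hypothesis E_sq : forall p, E p -> sq_integrable P p.
Hypothesis E0 : E (cst 0).
Hypothesis E_lin : forall c p q, E p -> E q -> E (fun x => c * p x + q x).

Lemma sq_closure_ae (f : T -> R) (f_ : (T -> R)^nat) (c : R) :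
  measurable_fun setT f -> (forall x, `|f x| <= c) ->
  (forall n, sq_closure P E (f_ n)) ->
  {ae P, forall x, f_ ^~ x @ \oo --> f x} ->
  {ae P, forall x n, `|f_ n x| <= c} -> sq_closure P E f.
Proof.
move=> mf fc cf_ cvf bf; apply: (sq_closure_closed E_sq _ cf_).
  exact: sq_integrable_bounded fc.
apply: (@sqnorm_dominated _ _ _ P _ _ (fun=> (2 * c) ^+ 2)) => //.
- by move=> n; have [[]] := cf_ n.
- exact: (finite_measure_integrable_cst P ((2 * c) ^+ 2) measurableT).
- apply: filterS bf => x bx n; rewrite -real_normK ?num_real//.
  rewrite ler_sqr ?nnegrE//; last by rewrite mulr_ge0// (le_trans _ (fc x)).
  by apply: le_trans (ler_normB _ _) _; have := bx n; have := fc x; lra.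
Qed.

Lemma sum_indic_trivIset (S : Type) (F : (set S)^nat) n (x : S) : trivIset setT F ->
  \sum_(k < n) \1_(F k) x = \1_(\bigcup_(k in `I_n) F k) x :> R.
Proof.
move=> tF; have [[k kn Fk]|nF] := pselect ((\bigcup_(k in `I_n) F k) x).
  rewrite [RHS]indicE mem_set; last by exists k.
  rewrite (bigD1 (Ordinal kn))//= big1 ?addr0 => [|i ik].
    by rewrite indicE mem_set.
  rewrite indicE memNset// => Fi; move/trivIsetP : tF.
  move=> /(_ i k I I) /=; rewrite -val_eqE/= in ik; move=> /(_ ik).
  by move=> /seteqP[+ _] => /(_ x); apply; split.
rewrite [RHS]indicE memNset// big1// => i _.
by rewrite indicE memNset// => Fi; apply: nF; exists i => //=.
Qed.

(* Dynkin's pi-lambda theorem. *)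
Lemma sq_closure_gen d' (S : measurableType d') (G : set (set S)) (h : T -> S) (w : T -> R) :
  @measurable _ S = <<s G >> -> setI_closed G -> measurable_fun setT h ->
  (forall u, `|w u| <= 1) -> sq_closure P E w ->
  (forall A, G A -> sq_closure P E (fun u => \1_A (h u) * w u)) ->
  forall A, measurable A -> sq_closure P E (fun u => \1_A (h u) * w u).
Proof.
move=> GE GI mh w1 cw cG A; rewrite GE; move: A.
have [mw _] := cw.1.
have lin c f g := @sq_closure_lin _ _ _ P E E_sq E_lin c f g.
apply: dynkin_induction => //.
- by under eq_fun do rewrite indicE in_setT mul1r.
- move=> B mB cB; have -> : (fun u => \1_(~` B) (h u) * w u) =
      (fun u => (-1) * (\1_B (h u) * w u) + w u).
    by apply/funext => u; rewrite !indicE in_setC; case: (_ \in _) => /=; ring.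
  exact: lin.
move=> F mF tF cF; apply: (@sq_closure_ae _ (fun n u => \sum_(k < n) \1_(F k) (h u) * w u) 1).
- apply: measurable_funM => //; apply: (measurableT_comp _ mh).
  by apply: measurable_indic; exact: bigcup_measurable.
- by move=> u; rewrite normrM indicE; case: (_ \in _); rewrite ?normr1 ?mul1r// normr0 mul0r.
- by move=> n; apply: sq_closure_sum => // k; exact: cF.
- apply: aeW => u; under eq_fun do rewrite -mulr_suml sum_indic_trivIset//.
  apply: cvg_near_cst; have [[k _ Fk]|nF] := pselect ((\bigcup_k F k) (h u)).
    exists k.+1 => // n /= kn; rewrite !indicE !mem_set//; first by exists k.
    by exists k.
  apply: nearW => n; rewrite !indicE !memNset// => -[k _ Fk]; apply: nF; by exists k.
- apply: aeW => u n; rewrite -mulr_suml sum_indic_trivIset// normrM.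
  apply: mulr_ile1 => //.
  by rewrite indicE; case: (_ \in _); rewrite ?normr1 ?normr0.
Qed.

End ClosureGen.

(** * Approximation of rays by exponential sums *)

Section ExponentialSpan.
Context {R : realType}.
Implicit Types (p q : R * R -> R) (s t x tau : R).

Definition exp_lin (c : R * R) (u : R * R) : R := expR (- (c.1 * u.1 + c.2 * u.2)).

Definition exp_span : set (R * R -> R) := [set p | exists r : seq (R * (R * R)),
  (forall c, c \in r -> 0 <= c.2.1 /\ 0 <= c.2.2) /\
  p = fun u => \sum_(c <- r) c.1 * exp_lin c.2 u].

Lemma exp_span0 : exp_span (cst 0).
Proof. by exists [::]; split=> //; apply/funext => u; rewrite big_nil. Qed.

Lemma exp_span_lin k p q : exp_span p -> exp_span q -> exp_span (fun u => k * p u + q u).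
Proof.
move=> [r [r0 ->]] [r' [r'0 ->]].
exists ([seq (k * c.1, c.2) | c <- r] ++ r'); split=> [c|].
  by rewrite mem_cat => /orP[/mapP[c' /r0 h ->]|/r'0].
apply/funext => u; rewrite big_cat big_map mulr_sumr; congr (_ + _).
by apply: eq_bigr => c _; rewrite mulrA.
Qed.

Lemma exp_span_exp_linM c p : 0 <= c.1 -> 0 <= c.2 -> exp_span p ->
  exp_span (fun u => exp_lin c u * p u).
Proof.
move=> c1 c2 [r [r0 ->]]; exists [seq (e.1, (c.1 + e.2.1, c.2 + e.2.2)) | e <- r]; split.
  by move=> e /mapP[e' /r0[e1 e2] ->]; rewrite !addr_ge0.
apply/funext => u; rewrite big_map mulr_sumr; apply: eq_bigr => e _.
rewrite mulrCA /exp_lin -expRD; congr (_ * expR _) => /=; ring.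
Qed.

(** The span is an algebra, hence contains the powers and products that form [ray_approx]. *)
Lemma exp_spanM p q : exp_span p -> exp_span q -> exp_span (fun u => p u * q u).
Proof.
move=> [r [+ ->]] Eq; elim: r => [_|c r IH rc].
  have -> : (fun u => (\sum_(c <- [::]) c.1 * exp_lin c.2 u) * q u) = cst 0.
    by apply/funext => u; rewrite big_nil mul0r.
  exact: exp_span0.
have -> : (fun u => (\sum_(c0 <- c :: r) c0.1 * exp_lin c0.2 u) * q u) =
   (fun u => c.1 * (exp_lin c.2 u * q u) + (\sum_(c0 <- r) c0.1 * exp_lin c0.2 u) * q u).
  by apply/funext => u; rewrite big_cons mulrDl mulrA.
have [c1 c2] := rc c (mem_head _ _).
apply: exp_span_lin; first exact: exp_span_exp_linM.
by apply: IH => e er; apply: rc; rewrite inE er orbT.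
Qed.

Lemma exp_span_exp_lin c : 0 <= c.1 -> 0 <= c.2 -> exp_span (exp_lin c).
Proof.
move=> c1 c2; exists [:: (1, c)]; split=> [e|]; first by rewrite inE => /eqP ->.
by apply/funext => u; rewrite big_seq1 mul1r.
Qed.

Lemma exp_span1 : exp_span (cst 1).
Proof.
have -> : cst 1 = exp_lin (0, 0).
  by apply/funext => u; rewrite /exp_lin /= !mul0r addr0 oppr0 expR0.
exact: exp_span_exp_lin.
Qed.

Lemma exp_spanX p n : exp_span p -> exp_span (fun u => p u ^+ n).
Proof.
move=> Ep; elim: n => [|n IH]; first exact: exp_span1.
by under eq_fun do rewrite exprS; exact: exp_spanM.
Qed.

(* With q = exp(- x ln 2 / tau) this is (1 - q^n)^(n 2^n), where q < 1/2 iff x > tau.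
   The extra factor n in the exponent makes the limit 0 also at x = tau. *)
Definition ray_approx tau n x : R :=
  if 0 < tau then (1 - expR (- (n%:R * (ln 2 / tau) * x))) ^+ (n * 2 ^ n) else 1.

Lemma exp_span_ray_approx (tau tau' : R) n :
  exp_span (fun u => ray_approx tau n u.1 * ray_approx tau' n u.2).
Proof.
have ln2 : 0 < ln 2 :> R by rewrite ln_gt0// ltr1n.
have c0 (t : R) : 0 < t -> 0 <= n%:R * (ln 2 / t).
  by move=> t0; rewrite mulr_ge0// divr_ge0 ?ltW.
apply: exp_spanM; rewrite /ray_approx.
  case: (ltP 0 tau) => [t0|_]; last exact: exp_span1.
  apply: exp_spanX.
  have -> : (fun u : R * R => 1 - expR (- (n%:R * (ln 2 / tau) * u.1))) =
      (fun u => (-1) * exp_lin (n%:R * (ln 2 / tau), 0) u + cst 1 u).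
    by apply/funext => u; rewrite /exp_lin /= mul0r addr0; ring.
  apply: exp_span_lin; last exact: exp_span1.
  by apply: exp_span_exp_lin => //=; exact: c0.
case: (ltP 0 tau') => [t0|_]; last exact: exp_span1.
apply: exp_spanX.
have -> : (fun u : R * R => 1 - expR (- (n%:R * (ln 2 / tau') * u.2))) =
    (fun u => (-1) * exp_lin (0, n%:R * (ln 2 / tau')) u + cst 1 u).
  by apply/funext => u; rewrite /exp_lin /= mul0r add0r; ring.
apply: exp_span_lin; last exact: exp_span1.
by apply: exp_span_exp_lin => //=; exact: c0.
Qed.

Lemma ray_approx_ge0_le1 tau n x : 0 < x -> 0 <= ray_approx tau n x <= 1.
Proof.
move=> x0; rewrite /ray_approx; case: ifPn => t0; last by rewrite ler01 lexx.
have ln2 : 0 < ln 2 :> R by rewrite ln_gt0// ltr1n.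
have e1 : expR (- (n%:R * (ln 2 / tau) * x)) <= 1.
  rewrite -[leRHS]expR0 ler_expR oppr_le0 mulr_ge0 ?(ltW x0)// mulr_ge0//.
  by rewrite divr_ge0 ?ltW.
have e0 := expR_gt0 (- (n%:R * (ln 2 / tau) * x)).
by rewrite exprn_ge0 ?exprn_ile1//; lra.
Qed.

Lemma bernoulli_le (y : R) m : 0 <= y <= 1 -> 1 - m%:R * y <= (1 - y) ^+ m.
Proof.
move=> /andP[y0 y1]; elim: m => [|m IH]; first by rewrite mul0r subr0 expr0.
rewrite exprS -natr1; have m0 : 0 <= m%:R :> R by [].
have [h|h] := leP 0 (1 - m%:R * y); last first.
  apply: (@le_trans _ _ 0); first by nra.
  by rewrite mulr_ge0 ?exprn_ge0//; lra.
have : (1 - y) * (1 - m%:R * y) <= (1 - y) * (1 - y) ^+ m.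
  by apply: ler_wpM2l => //; lra.
nra.
Qed.

Lemma cvg_natM_geometric (r : R) : 0 <= r < 1 -> n%:R * r ^+ n @[n --> \oo] --> 0.
Proof.
move=> /andP[r0 r1].
have : cvgn (series (fun n => `|n%:R * r ^+ n|)).
  have q01 : 0 <= (1 + r) / 2 < 1 by apply/andP; split; lra.
  (* From n >= 2 / (1 - r) on, (n + 1) r <= n (1 + r) / 2, so the ratio test applies with (1 + r) /
     2. *)
  pose N := (Num.truncn (2 / (1 - r))).+1.
  apply: (@is_cvg_series_ratio _ _ ((1 + r) / 2) N) => // n Nn.
  have nN : 2 / (1 - r) <= n%:R by apply: le_trans (ltW (truncnS_gt _)) _; rewrite ler_nat.
  have r1' : 0 < 1 - r by lra.
  have n0 : 0 <= n%:R :> R by [].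
  rewrite ler_pdivrMr// in nN.
  rewrite !ger0_norm ?mulr_ge0 ?exprn_ge0// exprS !mulrA ler_wpM2r ?exprn_ge0//.
  rewrite -natr1; nra.
by move=> /cvg_series_cvg_0/norm_cvg0.
Qed.

(** For x > tau Bernoulli's inequality gives the lower bound 1 - n (2 q)^n with 2 q < 1. For x <=
    tau one has q >= 1/2, and 1 - q^n <= exp(- 2^(-n)) gives the upper bound exp(- n). *)
Lemma cvg_ray_approx tau x : 0 < x ->
  ray_approx tau n x @[n --> \oo] --> (\1_[set` `]tau, +oo[ ] x : R).
Proof.
move=> x0; rewrite /ray_approx indicE mem_setE in_itv/= andbT.
case: (ltP 0 tau) => t0; last by rewrite (le_lt_trans t0 x0); exact: cvg_cst.
have ln2 : 0 < ln 2 :> R by rewrite ln_gt0// ltr1n.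
pose q := expR (- (ln 2 / tau * x)).
have qE n : expR (- (n%:R * (ln 2 / tau) * x)) = q ^+ n.
  by rewrite -expRM_natl; congr expR; ring.
have q0 : 0 < q by exact: expR_gt0.
have q1 : q < 1 by rewrite -[ltRHS]expR0 ltr_expR oppr_lt0 mulr_gt0// divr_gt0.
under eq_fun do rewrite qE.
have half : expR (- ln 2) = 2^-1 :> R by rewrite expRN lnK// posrE.
have [tx|xt] := ltP tau x.
  have q2 : 2 * q < 1.
    rewrite mulrC -ltr_pdivlMr// div1r -half ltr_expR ltrN2.
    by rewrite -mulrA mulrC -[ltLHS]mul1r ltr_pM2r// mulrC ltr_pdivlMr// mul1r.
  have h := @cvg_natM_geometric (2 * q) ltac:(by rewrite q2 mulr_ge0 ?ltW).
  have h' : 1 - n%:R * (2 * q) ^+ n @[n --> \oo] --> (1 - 0 : R).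
    by apply: cvgB => //; exact: cvg_cst.
  rewrite subr0 in h'; suff hs : (1 - q ^+ n) ^+ (n * 2 ^ n) @[n --> \oo] --> (1 : R) by [].
  apply: (squeeze_cvgr _ h' (cvg_cst (1 : R))).
  apply: nearW => n; have qn : 0 <= q ^+ n <= 1 by rewrite exprn_ge0 ?exprn_ile1// ltW.
  apply/andP; split; last by apply: exprn_ile1; case/andP: qn; lra.
  by apply: le_trans (bernoulli_le _ qn); rewrite exprMn natrM natrX !mulrA.
have q2 : 2^-1 <= q.
  rewrite -half ler_expR lerN2 -mulrA -[leRHS]mulr1 ler_pM2l//.
  by rewrite mulrC ler_pdivrMr// mul1r.
have h : expR (- n%:R) @[n --> \oo] --> (0 : R).
  have : (expR (-1) : R) ^+ n @[n --> \oo] --> 0.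
    have e1 : expR (-1) < 1 :> R by rewrite expR_lt1 ltrN10.
    by apply: cvg_expr; rewrite ger0_norm ?expR_ge0.
  by under eq_fun do rewrite -expRM_natl mulrN1.
suff hs : (1 - q ^+ n) ^+ (n * 2 ^ n) @[n --> \oo] --> (0 : R) by [].
apply: (squeeze_cvgr _ (cvg_cst (0 : R)) h).
apply: nearW => n; have qn : 0 <= q ^+ n <= 1 by rewrite exprn_ge0 ?exprn_ile1// ltW.
have y0 : 0 <= 1 - q ^+ n by case/andP: qn; lra.
rewrite exprn_ge0//=.
have y1 : 1 - q ^+ n <= expR (- (2^-1) ^+ n).
  apply: le_trans (expR_ge1Dx _); rewrite lerD2l lerN2.
  by rewrite lerXn2r ?nnegrE ?invr_ge0// ltW.
apply: (@le_trans _ _ (expR (- (2^-1) ^+ n) ^+ (n * 2 ^ n))).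
  by rewrite lerXn2r ?nnegrE ?expR_ge0.
rewrite -expRM_natl ler_expR mulrN lerN2 natrM natrX -mulrA -exprMn.
by rewrite mulfV ?expr1n ?mulr1.
Qed.

End ExponentialSpan.

(** * Density of exponentials in L^2 *)

Section ExponentialDensity.
Context {R : realType} (M : probability (R * R)%type R).
Hypothesis posM : {ae M, forall u : R * R, 0 < u.1 /\ 0 < u.2}.
Hypothesis sqM : forall c : R * R, 0 <= c.1 -> 0 <= c.2 -> sq_integrable M (exp_lin c).
Local Notation ray tau := ([set` `](tau : R), +oo[ ] : set R).

Lemma exp_span_sq_integrable p : exp_span p -> sq_integrable M p.
Proof.
move=> [r [+ ->]]; elim: r => [_|c r IH rc].
  under eq_fun do rewrite big_nil.
  by apply: (@sq_integrable_bounded _ _ _ _ 0) => // x; rewrite normr0.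
under eq_fun do rewrite big_cons.
have [c1 c2] := rc c (mem_head _ _).
apply: sq_integrableD; first by apply: sq_integrableZ; exact: sqM.
by apply: IH => e er; apply: rc; rewrite inE er orbT.
Qed.

Lemma sq_closure_rays (tau tau' : R) (f : R * R -> R) : measurable_fun setT f ->
  (forall u, `|f u| <= 1) ->
  (forall u, 0 < u.1 -> 0 < u.2 -> f u = \1_(ray tau) u.1 * \1_(ray tau') u.2) ->
  sq_closure M exp_span f.
Proof.
move=> mf f1 fE.
apply: (sq_closure_ae exp_span_sq_integrable mf f1
  (f_ := fun n u => ray_approx tau n u.1 * ray_approx tau' n u.2)).
- move=> n; apply: (subset_sq_closure exp_span_sq_integrable).
  exact: exp_span_ray_approx.
- apply: filterS posM => u [u1 u2]; rewrite fE//.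
  by apply: cvgM; exact: cvg_ray_approx.
- apply: filterS posM => u [u1 u2] n; rewrite normrM.
  have /andP[a0 a1] := ray_approx_ge0_le1 tau n u1.
  have /andP[b0 b1] := ray_approx_ge0_le1 tau' n u2.
  by apply: mulr_ile1 => //; rewrite ger0_norm.
Qed.

Let RGen : @measurable _ R = <<s @RGenOInfty.G R >>.
Proof. exact: RGenOInfty.measurableE. Qed.

Let RGenI : setI_closed (@RGenOInfty.G R).
Proof.
move=> A B [x ->] [y ->]; exists (Num.max x y); apply/seteqP; split => z /=;
  by rewrite !in_itv/= !andbT gt_max => /andP.
Qed.

Let indic_le1 (A : set R) x : `|\1_A x : R| <= 1.
Proof. by rewrite indicE; case: (_ \in _); rewrite ?normr1 ?normr0. Qed.

(** The threshold -1 stands for no condition: on the positive quadrant its ray is everything, and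
    [ray_approx] is then constant. *)
Let indic_ray (x : R) : 0 < x -> \1_(ray (-1)) x = 1 :> R.
Proof. by move=> x0; rewrite indicE mem_set//= in_itv/= andbT; lra. Qed.

(** Dynkin's argument, one coordinate at a time. The second set is made general first, with a ray or
    no condition on the first coordinate as the weight; then the first set, with the indicator of
    [B] as the weight. *)
Lemma sq_closure_rect (A B : set R) : measurable A -> measurable B ->
  sq_closure M exp_span (fun u => \1_A u.1 * \1_B u.2).
Proof.
have msnd := @measurable_snd _ _ R R; have mfst := @measurable_fst _ _ R R.
have mray (x : R) : measurable (ray x) by exact: measurable_itv.
have mi1 A' : measurable A' -> measurable_fun setT (fun u : R * R => \1_A' u.1 : R).
  by move=> mA'; apply: (measurableT_comp _ mfst); exact: measurable_indic.
have mi2 A' : measurable A' -> measurable_fun setT (fun u : R * R => \1_A' u.2 : R).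
  by move=> mA'; apply: (measurableT_comp _ msnd); exact: measurable_indic.
have gen := sq_closure_gen exp_span_sq_integrable exp_span0 exp_span_lin.
have snd1 x B' : measurable B' ->
    sq_closure M exp_span (fun u => \1_B' u.2 * \1_(ray x) u.1).
  apply: (gen _ _ _ snd (fun u => \1_(ray x) u.1) RGen RGenI msnd).
  - by [].
  - apply: (@sq_closure_rays x (-1)); [exact: mi1|by []|].
    by move=> u u1 u2; rewrite indic_ray// mulr1.
  - move=> _ [y ->]; apply: (@sq_closure_rays x y).
    + by apply: measurable_funM; [exact: mi2|exact: mi1].
    + by move=> u; rewrite normrM mulr_ile1.
    + by move=> u _ _; rewrite mulrC.
have snd2 B' : measurable B' ->
    sq_closure M exp_span (fun u => \1_B' u.2 * cst 1 u).
  apply: (gen _ _ _ snd (cst 1) RGen RGenI msnd).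
  - by move=> u; rewrite /cst normr1.
  - apply: (@sq_closure_rays (-1) (-1)) => //; first by move=> u; rewrite /cst normr1.
    by move=> u u1 u2; rewrite !indic_ray// mulr1.
  - move=> _ [y ->]; apply: (@sq_closure_rays (-1) y).
    + by apply: measurable_funM => //; exact: mi2.
    + by move=> u; rewrite /cst mulr1.
    + by move=> u u1 _; rewrite indic_ray// mulr1 mul1r.
move=> mA mB; move: A mA; apply: (gen _ _ _ fst (fun u => \1_B u.2) RGen RGenI mfst).
- by [].
- by have := snd2 _ mB; under eq_fun do rewrite /cst mulr1.
- move=> _ [y ->]; under eq_fun do rewrite mulrC; exact: snd1.
Qed.

(** Dynkin's argument once more, with rectangles as generators of the product sigma-algebra, reaches
    all measurable sets. *)
Lemma exp_span_dense f : sq_integrable M f -> sq_closure M exp_span f.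
Proof.
apply: (sq_closure_dense exp_span_sq_integrable exp_span0 exp_span_lin) => A mA.
have gen := sq_closure_gen exp_span_sq_integrable exp_span0 exp_span_lin.
suff : sq_closure M exp_span (fun u => \1_A (idfun u) * cst 1 u).
  by under eq_fun do rewrite /cst mulr1.
apply: (gen _ _ _ idfun (cst 1) (measurable_prod_measurableType R R)) mA.
- move=> _ _ [A1 mA1 [B1 mB1 <-]] [A2 mA2 [B2 mB2 <-]].
  exists (A1 `&` A2); first exact: measurableI.
  by exists (B1 `&` B2); [exact: measurableI|rewrite setXI].
- exact: measurable_id.
- by move=> u; rewrite /cst normr1.
- have := sq_closure_rect measurableT measurableT.
  by under eq_fun do rewrite !indicE !in_setT mul1r.
- move=> _ [A1 mA1 [B1 mB1 <-]]; have := sq_closure_rect mA1 mB1.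
  congr sq_closure; apply/funext => u; rewrite /cst mulr1 !indicE in_setX.
  by case: (_ \in _); case: (_ \in _); rewrite ?mulr1 ?mulr0.
Qed.

End ExponentialDensity.

(** * Parseval's formula *)

Section TriangularSeries.
Context {R : realType}.
Implicit Types (A B : nat -> nat -> R) (x : R).

(** Summation by antidiagonals is the order of the sum over k and l <= k in the first formula, and
    on a ray through the origin it gives the partial sums of an ordinary power series. *)
Definition tri_sum A n : R := \sum_(0 <= j < n) \sum_(0 <= k < j.+1) A k (j - k)%N.

Lemma eq_tri_sum A B n : (forall l m, A l m = B l m) -> tri_sum A n = tri_sum B n.
Proof. by move=> AB; apply: eq_bigr => j _; apply: eq_bigr => k _. Qed.

Lemma tri_sumD A B n : tri_sum (fun l m => A l m + B l m) n = tri_sum A n + tri_sum B n.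
Proof. by rewrite /tri_sum -big_split; apply: eq_bigr => j _; rewrite big_split. Qed.

Lemma tri_sumZ (c : R) A n : tri_sum (fun l m => c * A l m) n = c * tri_sum A n.
Proof. by rewrite /tri_sum mulr_sumr; apply: eq_bigr => j _; rewrite mulr_sumr. Qed.

Lemma tri_sumB A B n : tri_sum (fun l m => A l m - B l m) n = tri_sum A n - tri_sum B n.
Proof.
rewrite -[- tri_sum B n]mulN1r -tri_sumZ -tri_sumD.
by apply: eq_tri_sum => l m; rewrite mulN1r.
Qed.

Lemma tri_sum_le A B n : (forall l m, A l m <= B l m) -> tri_sum A n <= tri_sum B n.
Proof. by move=> AB; apply: ler_sum => j _; apply: ler_sum => k _. Qed.

Lemma tri_sum_ge0 A n : (forall l m, 0 <= A l m) -> 0 <= tri_sum A n.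
Proof. by move=> A0; apply: sumr_ge0 => j _; apply: sumr_ge0 => k _. Qed.

Lemma tri_sum_nondecreasing A : (forall l m, 0 <= A l m) ->
  {homo tri_sum A : n m / (n <= m)%N >-> n <= m}.
Proof.
move=> A0 n m nm; rewrite /tri_sum (big_cat_nat (leq0n n) nm) /= lerDl.
by apply: sumr_ge0 => j _; apply: sumr_ge0 => k _.
Qed.

Lemma tri_sum_diff_le A B n m : (n <= m)%N -> (forall l k, `|A l k| <= B l k) ->
  `|tri_sum A m - tri_sum A n| <= tri_sum B m - tri_sum B n.
Proof.
move=> nm AB; rewrite /tri_sum !(big_cat_nat (leq0n n) nm) /= [X in `|X|]addrAC subrr add0r.
rewrite [leRHS]addrAC subrr add0r.
apply: le_trans (ler_norm_sum _ _ _) _; apply: ler_sum => j _.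
by apply: le_trans (ler_norm_sum _ _ _) _; apply: ler_sum.
Qed.

Lemma tri_sum_ge_term A l m n : (forall l m, 0 <= A l m) -> (l + m < n)%N ->
  A l m <= tri_sum A n.
Proof.
move=> A0 lmn; rewrite /tri_sum big_mkord (bigD1 (Ordinal lmn))//=.
rewrite big_mkord (bigD1 (Ordinal (leq_addr m l : l < (l + m).+1)%N))//= addKn -addrA lerDl.
by rewrite addr_ge0// sumr_ge0// => i _; rewrite ?sumr_ge0.
Qed.

Lemma cvg_tri_sum (A_ : nat -> nat -> nat -> R) A n :
  (forall l m, A_ j l m @[j --> \oo] --> A l m) ->
  tri_sum (A_ j) n @[j --> \oo] --> tri_sum A n.
Proof.
move=> cA; rewrite /tri_sum; apply: cvg_big => [|j _]; first exact: add_continuous.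
by apply: cvg_big => [|k _]; [exact: add_continuous|exact: cA].
Qed.

Lemma tri_sum_ray A n (r rho : R) : tri_sum (fun l m => A l m * ((rho * r) ^+ l * rho ^+ m)) n =
  pseries (fun j => \sum_(0 <= k < j.+1) A k (j - k)%N * r ^+ k) rho n.
Proof.
rewrite /tri_sum /pseries /series/=; apply: eq_bigr => j _.
rewrite mulr_suml; apply: eq_big_nat => k /andP[_ kj].
have -> : rho ^+ j = rho ^+ k * rho ^+ (j - k) by rewrite -exprD subnKC.
rewrite exprMn; ring.
Qed.

(* Along the ray (rho r, rho) the sum is a power series in rho whose coefficients
   are polynomials in r. *)
Lemma tri_sum_eq0 A :
  (forall r, 0 < r < 1 -> exists2 del, 0 < del & forall rho, 0 < rho < del ->
    tri_sum (fun l m => A l m * ((rho * r) ^+ l * rho ^+ m)) n @[n --> \oo] --> 0) ->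
  forall l m, A l m = 0.
Proof.
move=> hA; suff h k r : 0 < r < 1 -> \sum_(0 <= l < k.+1) A l (k - l)%N * r ^+ l = 0.
  move=> l m; pose u i := if (i < (l + m).+1)%N then A i (l + m - i)%N else 0.
  have uE (x : R) : series (fun n => u n * x ^+ n) @ \oo -->
      \sum_(0 <= i < (l + m).+1) A i (l + m - i)%N * x ^+ i.
    apply: cvg_near_cst; exists (l + m).+1 => // n /= ln.
    rewrite /series /= (big_cat_nat (leq0n _) ln) /= -[RHS]addr0; congr (_ + _).
      by apply: eq_big_nat => i /andP[_ il]; rewrite /u il.
    rewrite big_nat_cond big1// => i /andP[/andP[li _] _].
    by rewrite /u ltnNge li mul0r.
  have := @pser_cv_eq0 _ u 1 (fun x => \sum_(0 <= i < (l + m).+1) A i (l + m - i)%N * x ^+ i)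
    ltr01 (fun x _ => uE x).
  move=> /(_ _ l); rewrite /u ltnS leq_addr addKn; apply => e e0.
  exists (Num.min (e / 2) 2^-1); have m0 : 0 < Num.min (e / 2) 2^-1 by rewrite lt_min divr_gt0 /=.
  split; [by rewrite gt_eqF| |].
    by rewrite gtr0_norm// gt_min; apply/orP; left; lra.
  by apply: h; rewrite m0 gt_min; apply/orP; right; lra.
move=> /hA[del del0 hrho]; move: k.
pose u j := \sum_(0 <= k < j.+1) A k (j - k)%N * r ^+ k.
have uc rho : 0 < rho < del -> pseries u rho @ \oo --> 0.
  move=> /hrho; rewrite (_ : tri_sum _ = pseries u rho)//.
  by apply/funext => n; exact: tri_sum_ray.
have d2 : 0 < del / 2 < del by apply/andP; split; lra.
have /cvgP c2 := uc _ d2.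
have uf : pser_cv u (del / 2) (fun x => limn (pseries u x)).
  move=> x xd; apply: (@is_cvg_pseries_inside _ _ (del / 2)) => //.
  by rewrite [ltRHS]gtr0_norm//; case/andP: d2.
apply: (pser_cv_eq0 _ uf); first by case/andP: d2.
move=> e e0; exists (Num.min (e / 2) (del / 4)).
have m0 : 0 < Num.min (e / 2) (del / 4) by rewrite lt_min !divr_gt0.
split; [by rewrite gt_eqF| |].
  by rewrite gtr0_norm// gt_min; apply/orP; left; lra.
apply/cvg_lim => //; apply: uc; rewrite m0 gt_min; apply/orP; right; lra.
Qed.

End TriangularSeries.

(** * Parseval from the expansion of a Gram kernel *)

Section Parseval.
Context d (S : measurableType d) (R : realType) (P : probability S R).
Variables (D : set (R * R)) (e : R * R -> S -> R) (W : nat -> nat -> R).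
Hypothesis W0 : forall l m, 0 < W l m.
Hypothesis sq_e : forall w, D w -> sq_integrable P (e w).
Implicit Types (w : R * R) (r : seq (R * (R * R))).

Definition monomial w l m : R := w.1 ^+ l * w.2 ^+ m.

Hypothesis kernel_series : forall w w', D w -> D w' ->
  tri_sum (fun l m => W l m * (monomial w l m * monomial w' l m)) n @[n --> \oo] -->
    inner P (e w) (e w').

Definition combination r (x : S) : R := \sum_(c <- r) c.1 * e c.2 x.
(** Sending [e w] to the sequence [monomial w] maps combinations into the l^2 space with weights
    [W]; [kernel_series] says that this map preserves inner products. *)
Definition coordinate r l m : R := \sum_(c <- r) c.1 * monomial c.2 l m.

Let adm r := forall c, c \in r -> D c.2.

Let adm_cons c r : adm (c :: r) -> D c.2 /\ adm r.
Proof.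
move=> h; split; first by apply: h; rewrite mem_head.
by move=> c' c'r; apply: h; rewrite inE c'r orbT.
Qed.

Lemma combination_sq_integrable r : adm r -> sq_integrable P (combination r).
Proof.
rewrite /combination; elim: r => [_|c r IH /adm_cons[cD rD]].
  under eq_fun do rewrite big_nil.
  by apply: (@sq_integrable_bounded _ _ _ _ 0) => // x; rewrite normr0.
under eq_fun do rewrite big_cons.
by apply: sq_integrableD; [apply: sq_integrableZ; exact: sq_e|exact: IH].
Qed.

Lemma combination_cons c r x : combination (c :: r) x = c.1 * e c.2 x + combination r x.
Proof. by rewrite /combination big_cons. Qed.

Lemma cvg_eq_tri_sum (A B : nat -> nat -> R) (l : R) : (forall l m, A l m = B l m) ->
  tri_sum A n @[n --> \oo] --> l -> tri_sum B n @[n --> \oo] --> l.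
Proof.
by move=> AB; rewrite (_ : tri_sum A = tri_sum B)//; apply/funext => n; exact: eq_tri_sum.
Qed.

Lemma inner_combination (f : S -> R) (K : nat -> nat -> R) r :
  sq_integrable P f ->
  (forall w, D w -> tri_sum (fun l m => K l m * monomial w l m) n @[n --> \oo] -->
     inner P (e w) f) ->
  adm r ->
  tri_sum (fun l m => K l m * coordinate r l m) n @[n --> \oo] -->
    inner P (combination r) f.
Proof.
move=> hf hK; elim: r => [_|c r IH /adm_cons[cD rD]].
  have -> : combination [::] = (fun x => 0 * f x).
    by apply/funext => x; rewrite /combination big_nil mul0r.
  rewrite innerZl// mul0r; apply: cvg_near_cst; apply: nearW => n.
  rewrite /tri_sum big1// => j _; rewrite big1// => k _.
  by rewrite /coordinate big_nil mulr0.
have -> : combination (c :: r) = (fun x => c.1 * e c.2 x + combination r x).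
  by apply/funext => x; exact: combination_cons.
rewrite innerDl//; last 2 first.
- by apply: sq_integrableZ; exact: sq_e.
- exact: combination_sq_integrable.
rewrite innerZl//; last exact: sq_e.
have -> : tri_sum (fun l m => K l m * coordinate (c :: r) l m) =
    (fun n => c.1 * tri_sum (fun l m => K l m * monomial c.2 l m) n +
      tri_sum (fun l m => K l m * coordinate r l m) n).
  apply/funext => n; rewrite -tri_sumZ -tri_sumD; apply: eq_tri_sum => l m.
  by rewrite /coordinate big_cons mulrDr mulrCA.
by apply: cvgD; [apply: cvgMl_tmp; exact: hK|exact: IH].
Qed.

Lemma inner_combination_kernel r w : adm r -> D w ->
  tri_sum (fun l m => W l m * (coordinate r l m * monomial w l m)) n @[n --> \oo] -->
    inner P (combination r) (e w).
Proof.
move=> rD wD; apply: (@cvg_eq_tri_sum (fun l m => (W l m * monomial w l m) * coordinate r l m)).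
  by move=> l m; ring.
apply: inner_combination => // [|w' w'D]; first exact: sq_e.
apply: (@cvg_eq_tri_sum (fun l m => W l m * (monomial w' l m * monomial w l m))).
  by move=> l m; ring.
exact: kernel_series.
Qed.

Lemma inner_combinations r r' : adm r -> adm r' ->
  tri_sum (fun l m => W l m * (coordinate r l m * coordinate r' l m)) n @[n --> \oo] -->
    inner P (combination r) (combination r').
Proof.
move=> rD r'D; have sr' := combination_sq_integrable r'D.
apply: (@cvg_eq_tri_sum (fun l m => (W l m * coordinate r' l m) * coordinate r l m)).
  by move=> l m; ring.
apply: inner_combination => // w wD; rewrite innerC.
apply: (@cvg_eq_tri_sum (fun l m => W l m * (coordinate r' l m * monomial w l m))).
  by move=> l m; ring.
exact: inner_combination_kernel.
Qed.

Lemma coordinate_le r l m : adm r ->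
  W l m * coordinate r l m ^+ 2 <= sqnorm P (combination r).
Proof.
move=> rD; rewrite sqnormE.
have A0 l' m' : 0 <= W l' m' * (coordinate r l' m' * coordinate r l' m').
  by rewrite -expr2 mulr_ge0 ?sqr_ge0 ?ltW.
have cv := inner_combinations rD rD.
apply: (@le_trans _ _ (tri_sum (fun l m => W l m * (coordinate r l m * coordinate r l m)) (l + m).+1)).
  by rewrite expr2; exact: (@tri_sum_ge_term _ (fun l m => W l m * (coordinate r l m * coordinate r l m))).
rewrite -(cvg_lim _ cv)//; apply: nondecreasing_cvgn_le; last by apply/cvgP; exact: cv.
exact: tri_sum_nondecreasing.
Qed.

Lemma tri_sum_coordinate_le r n : adm r ->
  tri_sum (fun l m => W l m * coordinate r l m ^+ 2) n <= sqnorm P (combination r).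
Proof.
move=> rD; rewrite sqnormE.
have cv := inner_combinations rD rD.
rewrite -(cvg_lim _ cv)//.
rewrite (_ : tri_sum _ n = tri_sum (fun l m => W l m * (coordinate r l m * coordinate r l m)) n); last first.
  by apply: eq_tri_sum => l m; rewrite expr2.
apply: nondecreasing_cvgn_le; last by apply/cvgP; exact: cv.
by apply: tri_sum_nondecreasing => l m; rewrite -expr2 mulr_ge0 ?sqr_ge0 ?ltW.
Qed.

Section Coefficients.
Variable f : S -> R.
Hypothesis hf : sq_integrable P f.
Variable p : nat -> seq (R * (R * R)).
Hypothesis padm : forall j, adm (p j).
Hypothesis pf : forall j, sqnorm P (fun x => f x - combination (p j) x) < j.+1%:R^-1.

Let sp j : sq_integrable P (combination (p j)).
Proof. exact: combination_sq_integrable. Qed.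

Let B := 2 * sqnorm P f + 2.

Lemma approx_sqnorm_le j : sqnorm P (combination (p j)) <= B.
Proof.
have -> : combination (p j) = (fun x => f x + (-1) * (f x - combination (p j) x)).
  by apply/funext => x; ring.
have h := sq_integrableB hf (sp j).
apply: le_trans (sqnormD_le hf (sq_integrableZ (-1) h)) _.
rewrite sqnormZ// sqrrN expr1n mul1r lerD2l.
apply: (@le_trans _ _ (2 * 1)); last by rewrite mulr1.
rewrite ler_wpM2l//; apply: le_trans (ltW (pf j)) _.
by rewrite invf_le1 ?ler1n.
Qed.

(** [coordinate_le] bounds a coordinate by the L^2 norm, so combinations that converge in L^2 have
    Cauchy coordinates. *)
Lemma cvg_coordinate l m : exists v : R, coordinate (p j) l m @[j --> \oo] --> v.
Proof.
suff : cvgn (fun j => coordinate (p j) l m) by move=> /cvg_ex.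
apply: cauchy_cvg; apply: cauchy_exP => eps eps0.
pose del := W l m * eps ^+ 2; have del0 : 0 < del by rewrite mulr_gt0 ?exprn_gt0.
(* Two squared errors below [del / 4], doubled by [sqnormD_le], stay below [del]. *)
pose N := Num.truncn (4 / del).
have hN j : (N <= j)%N -> j.+1%:R^-1 < del / 4.
  move=> Nj; rewrite -[ltRHS]invrK ltf_pV2 ?posrE ?invr_gt0 ?divr_gt0//.
  rewrite invf_div; apply: lt_le_trans (truncnS_gt _) _; by rewrite ler_nat.
exists (coordinate (p N) l m); exists N => // j Nj.
rewrite /ball_/= -ball_normE /=.
(* The difference of two combinations, written again as a combination. *)
pose r := p N ++ [seq (- c.1, c.2) | c <- p j].
have rD : adm r.
  move=> c; rewrite mem_cat => /orP[/padm//|/mapP[c' /padm c'D ->]]; exact: c'D.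
have cr : coordinate r l m = coordinate (p N) l m - coordinate (p j) l m.
  rewrite /coordinate big_cat big_map -sumrN; congr (_ + _).
  by apply: eq_bigr => c _; rewrite mulNr.
have fr : combination r = (fun x => (f x - combination (p j) x) + (-1) * (f x - combination (p N) x)).
  apply/funext => x; have -> : combination r x = combination (p N) x - combination (p j) x.
    rewrite /combination big_cat big_map -sumrN; congr (_ + _).
    by apply: eq_bigr => c _; rewrite mulNr.
  ring.
have := coordinate_le l m rD; rewrite cr fr => h.
have hj := sq_integrableB hf (sp j); have hNN := sq_integrableB hf (sp N).
have h2 := sqnormD_le hj (sq_integrableZ (-1) hNN).
rewrite sqnormZ// sqrrN expr1n mul1r in h2.
have hj2 : sqnorm P (fun x => f x - combination (p j) x) < del / 4 by apply: lt_trans (pf j) (hN _ _).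
have hN2 : sqnorm P (fun x => f x - combination (p N) x) < del / 4 by apply: lt_trans (pf N) (hN _ _).
have : W l m * (coordinate (p N) l m - coordinate (p j) l m) ^+ 2 < W l m * eps ^+ 2.
  apply: le_lt_trans h _; apply: le_lt_trans h2 _; rewrite -/del; lra.
rewrite ltr_pM2l// -(real_normK (num_real (_ - _))) ltr_sqr ?nnegrE// ltW//.
Qed.

Lemma sqnorm_approx_cvg : sqnorm P (fun x => f x - combination (p j) x) @[j --> \oo] --> 0.
Proof.
apply: (squeeze_cvgr _ (cvg_cst 0) (@cvg_harmonic R)).
by apply: nearW => j; rewrite sqnorm_ge0 ltW.
Qed.

Lemma inner_approx_cvg h : sq_integrable P h ->
  inner P (combination (p j)) h @[j --> \oo] --> inner P f h.
Proof.
move=> hh; apply/cvgrPdist_lt => eps eps0.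
have e2 : 0 < eps ^+ 2 / (sqnorm P h + 1).
  by rewrite divr_gt0 ?exprn_gt0// ltr_wpDl ?sqnorm_ge0.
move/cvgrPdist_lt : sqnorm_approx_cvg => /(_ _ e2); apply: filterS => j.
rewrite sub0r normrN ger0_norm ?sqnorm_ge0// ltr_pdivlMr ?ltr_wpDl ?sqnorm_ge0// => hj.
rewrite -innerBl//; have hfp := sq_integrableB hf (sp j).
rewrite -ltr_sqr ?nnegrE// ?(ltW eps0)// real_normK ?num_real//.
apply: le_lt_trans (cauchy_schwarz_inner hfp hh) _; apply: le_lt_trans hj.
by rewrite ler_wpM2l ?sqnorm_ge0// lerDl.
Qed.

Variable v : nat -> nat -> R.
Hypothesis hv : forall l m, coordinate (p j) l m @[j --> \oo] --> v l m.

Let tail w n := inner P (e w) (e w) - tri_sum (fun l m => W l m * monomial w l m ^+ 2) n.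

(* AM-GM: |x y| <= eps x^2 + y^2 / eps, termwise. *)
Lemma coefficient_error w n eps : D w -> 0 < eps ->
  `|inner P f (e w) - tri_sum (fun l m => W l m * (v l m * monomial w l m)) n| <=
  eps * B + tail w n / eps.
Proof.
move=> wD eps0; have se := sq_e wD.
have ww := kernel_series wD wD.
suff hj j : `|inner P (combination (p j)) (e w) -
    tri_sum (fun l m => W l m * (coordinate (p j) l m * monomial w l m)) n| <=
    eps * B + tail w n / eps.
  apply: (@cvg_le_bound _ (fun j => `|inner P (combination (p j)) (e w) -
    tri_sum (fun l m => W l m * (coordinate (p j) l m * monomial w l m)) n|)); last exact: nearW.
  apply: cvg_norm; apply: cvgB; first exact: inner_approx_cvg.
  apply: (@cvg_tri_sum _ (fun j l m => W l m * (coordinate (p j) l m * monomial w l m))) => l m.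
  by apply: cvgMl_tmp; apply: cvgMr_tmp; exact: hv.
have cj := inner_combination_kernel (@padm j) wD.
pose A l m := W l m * (coordinate (p j) l m * monomial w l m).
pose C l m := eps * (W l m * coordinate (p j) l m ^+ 2) + eps^-1 * (W l m * monomial w l m ^+ 2).
have AC l m : `|A l m| <= C l m.
  rewrite (_ : C l m = W l m * (eps * coordinate (p j) l m ^+ 2 + eps^-1 * monomial w l m ^+ 2)); last first.
    by rewrite /C; ring.
  rewrite /A normrM (gtr0_norm (W0 l m)).
  rewrite ler_pM2l// normrM -(real_normK (num_real (coordinate _ _ _))) -(real_normK (num_real (monomial _ _ _))).
  set x := `|coordinate _ _ _|; set y := `|monomial _ _ _|.
  have x0 : 0 <= x by exact: normr_ge0. have y0 : 0 <= y by exact: normr_ge0.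
  have h : 0 <= eps^-1 * (eps * x - y) ^+ 2 by rewrite mulr_ge0 ?sqr_ge0 ?invr_ge0 ?ltW.
  have E : eps^-1 * (eps * x - y) ^+ 2 = eps * x ^+ 2 - 2 * (x * y) + eps^-1 * y ^+ 2.
    by field; rewrite gt_eqF.
  have xy : 0 <= x * y by rewrite mulr_ge0.
  by move: h; rewrite E; lra.
apply: (@cvg_le_bound _ (fun N => `|tri_sum A N - tri_sum A n|)).
  by apply: cvg_norm; apply: cvgB; [exact: cj|exact: cvg_cst].
exists n => // N nN; apply: le_trans (tri_sum_diff_le nN AC) _.
rewrite /C !tri_sumD !tri_sumZ.
have h1 : tri_sum (fun l m => W l m * coordinate (p j) l m ^+ 2) N <= B.
  exact: le_trans (tri_sum_coordinate_le _ (@padm j)) (approx_sqnorm_le j).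
have h2 : 0 <= tri_sum (fun l m => W l m * coordinate (p j) l m ^+ 2) n.
  by apply: tri_sum_ge0 => l m; rewrite mulr_ge0 ?sqr_ge0 ?ltW.
have h3 : tri_sum (fun l m => W l m * monomial w l m ^+ 2) N <= inner P (e w) (e w).
  rewrite -(cvg_lim _ ww)//.
  rewrite (_ : tri_sum _ N = tri_sum (fun l m => W l m * (monomial w l m * monomial w l m)) N); last first.
    by apply: eq_tri_sum => l m; rewrite expr2.
  apply: nondecreasing_cvgn_le; last by apply/cvgP; exact: ww.
  by apply: tri_sum_nondecreasing => l m; rewrite -expr2 mulr_ge0 ?sqr_ge0 ?ltW.
rewrite /tail [_ / eps]mulrC.
have ei : 0 < eps^-1 by rewrite invr_gt0.
have h1' : eps * tri_sum (fun l m => W l m * coordinate (p j) l m ^+ 2) N <= eps * B.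
  by rewrite ler_pM2l.
have h2' := mulr_ge0 (ltW eps0) h2.
have h3' : eps^-1 * tri_sum (fun l m => W l m * monomial w l m ^+ 2) N <=
    eps^-1 * inner P (e w) (e w) by rewrite ler_pM2l.
rewrite mulrBr; lra.
Qed.

(** The AM-GM parameter in [coefficient_error] is fixed first, so that [e1 * B] is half of the
    accuracy; only then is [n] taken large enough for the tail. *)
Lemma coefficient_series w : D w ->
  tri_sum (fun l m => W l m * (v l m * monomial w l m)) n @[n --> \oo] -->
    inner P f (e w).
Proof.
move=> wD; have ww := kernel_series wD wD.
have B0 : 0 < B by rewrite ltr_wpDl// mulr_ge0 ?sqnorm_ge0.
have ct : tail w n @[n --> \oo] --> 0.
  rewrite -[X in _ --> X](subrr (inner P (e w) (e w))); apply: cvgB; first exact: cvg_cst.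
  by apply: cvg_eq_tri_sum ww => l m; rewrite expr2.
apply/cvgrPdist_le => eps eps0; pose e1 := eps / (2 * B).
have e10 : 0 < e1 by rewrite divr_gt0// mulr_gt0.
have e20 : 0 < eps / 2 * e1 by rewrite mulr_gt0// divr_gt0.
move/cvgrPdist_le : ct => /(_ _ e20); apply: filterS => n; rewrite sub0r normrN => tn.
apply: le_trans (coefficient_error n wD e10) _.
have -> : e1 * B = eps / 2 by rewrite /e1; field; rewrite gt_eqF.
have : tail w n / e1 <= eps / 2 by rewrite ler_pdivrMr// (le_trans (ler_norm _) tn).
lra.
Qed.

(** The upper bound is Bessel's inequality passed to the limit in [j]. For the lower bound, 2 <p_j,
    f> - |p_j|^2 = |f|^2 - |f - p_j|^2, while 2 v x - x^2 <= v^2 in each coordinate; so the sum is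
    at least |f|^2 minus an error that tends to 0. *)
Lemma parseval_limit :
  tri_sum (fun l m => W l m * v l m ^+ 2) n @[n --> \oo] --> sqnorm P f.
Proof.
have cp : sqnorm P (combination (p j)) @[j --> \oo] --> sqnorm P f.
  have -> : (fun j => sqnorm P (combination (p j))) = (fun j =>
      2 * inner P (combination (p j)) f - sqnorm P f +
      sqnorm P (fun x => f x - combination (p j) x)).
    by apply/funext => j; rewrite sqnormB// (innerC P f); ring.
  rewrite [X in _ --> X](_ : _ = 2 * inner P f f - sqnorm P f + 0); last by rewrite -sqnormE; ring.
  apply: cvgD; last exact: sqnorm_approx_cvg.
  by apply: cvgB; [apply: cvgMl_tmp; exact: inner_approx_cvg|exact: cvg_cst].
have ub n : tri_sum (fun l m => W l m * v l m ^+ 2) n <= sqnorm P f.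
  rewrite -subr_le0; apply: (@cvg_le_bound _ (fun j =>
    tri_sum (fun l m => W l m * coordinate (p j) l m ^+ 2) n - sqnorm P (combination (p j)))).
    apply: cvgB => //.
    apply: (@cvg_tri_sum _ (fun j l m => W l m * coordinate (p j) l m ^+ 2)) => l m.
    by apply: cvgMl_tmp; rewrite expr2; under eq_fun do rewrite expr2; apply: cvgM; exact: hv.
  by apply: nearW => j; rewrite subr_le0; exact: tri_sum_coordinate_le.
have nd := @tri_sum_nondecreasing _ (fun l m => W l m * v l m ^+ 2)
  (fun l m => mulr_ge0 (ltW (W0 l m)) (sqr_ge0 _)).
have cL : cvgn (tri_sum (fun l m => W l m * v l m ^+ 2)).
  by apply: nondecreasing_is_cvgn => //; exists (sqnorm P f) => _ [n _ <-].
suff -> : sqnorm P f = limn (tri_sum (fun l m => W l m * v l m ^+ 2)) by exact: cL.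
apply/eqP; rewrite eq_le; apply/andP; split; last by apply: limr_le => //; exact: nearW.
set L := limn _.
have hj j : sqnorm P f - sqnorm P (fun x => f x - combination (p j) x) <= L.
  have -> : sqnorm P f - sqnorm P (fun x => f x - combination (p j) x) =
      2 * inner P (combination (p j)) f - inner P (combination (p j)) (combination (p j)).
    by rewrite sqnormB// (innerC P f) -sqnormE; ring.
  have c1 := @inner_combination f (fun l m => W l m * v l m) (p j) hf.
  apply: (@cvg_le_bound _ (fun n => 2 * tri_sum (fun l m => W l m * v l m * coordinate (p j) l m) n -
     tri_sum (fun l m => W l m * (coordinate (p j) l m * coordinate (p j) l m)) n)).
    apply: cvgB; last exact: inner_combinations.
    apply: cvgMl_tmp; apply: c1 => // w wD; rewrite innerC.
    apply: cvg_eq_tri_sum (coefficient_series wD) => l m; ring.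
  apply: nearW => n; apply: (@le_trans _ _ (tri_sum (fun l m => W l m * v l m ^+ 2) n)).
    rewrite -tri_sumZ -tri_sumB; apply: tri_sum_le => l m.
    rewrite -subr_ge0 (_ : _ - _ = W l m * (v l m - coordinate (p j) l m) ^+ 2); last by ring.
    by rewrite mulr_ge0 ?sqr_ge0 ?ltW.
  exact: nondecreasing_cvgn_le.
apply: (@cvg_le_bound _ (fun j => sqnorm P f - sqnorm P (fun x => f x - combination (p j) x))).
  rewrite -[X in _ --> X]subr0; apply: cvgB; first exact: cvg_cst.
  exact: sqnorm_approx_cvg.
exact: nearW.
Qed.

End Coefficients.

(** [coefficient_series] expands the inner products with the coefficients [W l m * v l m], and
    agreement on short rays is enough for [tri_sum_eq0] to identify these with [c]. *)
Lemma parseval_series f (c : nat -> nat -> R) : sq_integrable P f ->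
  (forall eps : R, 0 < eps -> exists2 r, adm r &
    sqnorm P (fun x => f x - combination r x) < eps) ->
  (forall x : R, 0 < x < 1 -> exists2 del : R, 0 < del & forall rho, 0 < rho < del ->
    D (rho * x, rho) /\
    tri_sum (fun l m => c l m * ((rho * x) ^+ l * rho ^+ m)) n @[n --> \oo] -->
      inner P f (e (rho * x, rho))) ->
  tri_sum (fun l m => c l m ^+ 2 / W l m) n @[n --> \oo] --> sqnorm P f.
Proof.
move=> hf dens hc.
have dens' j : exists r, adm r /\ sqnorm P (fun x => f x - combination r x) < j.+1%:R^-1.
  by have [|r rD rf] := dens j.+1%:R^-1; [rewrite invr_gt0|exists r].
have [p hp] := choice dens'.
have padm j := (hp j).1; have pf j := (hp j).2.
have [v hv] : exists v : nat -> nat -> R, forall l m,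
    coordinate (p j) l m @[j --> \oo] --> v l m.
  have [v hv] := choice (fun lm : nat * nat => cvg_coordinate hf padm pf lm.1 lm.2).
  by exists (fun l m => v (l, m)) => l m; exact: (hv (l, m)).
have cv l m : c l m = W l m * v l m.
  apply/eqP; rewrite -subr_eq0; apply/eqP.
  apply: (@tri_sum_eq0 _ (fun l m => c l m - W l m * v l m)) => r /hc[del del0 hdel].
  exists del => // rho /hdel[wD cw].
  rewrite (_ : tri_sum _ = (fun n => tri_sum (fun l m => c l m * ((rho * r) ^+ l * rho ^+ m)) n -
     tri_sum (fun l m => W l m * (v l m * monomial (rho * r, rho) l m)) n)); last first.
    apply/funext => n; rewrite -tri_sumB; apply: eq_tri_sum => l' m'.
    by rewrite /monomial /=; ring.
  rewrite -(subrr (inner P f (e (rho * r, rho)))); apply: cvgB; first exact: cw.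
  exact: (coefficient_series hf padm pf hv wD).
apply: cvg_eq_tri_sum (parseval_limit hf padm pf hv) => l m.
by rewrite cv; field; rewrite gt_eqF.
Qed.

End Parseval.

(** * The coefficients of the estimator *)

Section TriangularProduct.
Context {R : realType}.
Implicit Types (u v : R^nat) (U V : R -> R) (x y : R).

Lemma tri_sumE A n : tri_sum A n = \sum_(0 <= k < n) \sum_(0 <= m < n - k) A k m :> R.
Proof. exact: triangle_sum. Qed.

Lemma tri_sum_product_le u v x y n : (forall k, 0 <= u k) -> (forall k, 0 <= v k) ->
  0 <= x -> 0 <= y ->
  tri_sum (fun l m => u l * x ^+ l * (v m * y ^+ m)) n <= pseries u x n * pseries v y n.
Proof.
move=> u0 v0 x0 y0; rewrite tri_sumE /pseries /series /= mulr_suml.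
apply: ler_sum => k _; rewrite mulr_sumr.
rewrite [leRHS](big_cat_nat (leq0n (n - k)) (leq_subr k n)) /= lerDl.
by apply: sumr_ge0 => i _; rewrite !mulr_ge0 ?exprn_ge0.
Qed.

Lemma tri_sum_product_bounded u v U V (r x y : R) : pser_cv u r U -> pser_cv v r V ->
  `|x| < r -> `|y| < r -> exists B, forall n,
  tri_sum (fun l m => `|u l| * `|x| ^+ l * (`|v m| * `|y| ^+ m)) n <= B.
Proof.
move=> uU vV x1 y1; have cu := pser_cv_normed uU x1; have cv := pser_cv_normed vV y1.
pose su := pseries (fun k => `|u k|) `|x|; pose sv := pseries (fun k => `|v k|) `|y|.
have nd (w : R^nat) (z : R) : {homo pseries (fun k => `|w k|) `|z| : n m / (n <= m)%N >-> n <= m}.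
  apply/nondecreasing_seqP => n; rewrite /pseries /series/= big_nat_recr//= lerDl.
  by rewrite mulr_ge0 ?exprn_ge0.
exists (limn su * limn sv) => n.
apply: le_trans (@tri_sum_product_le (fun k => `|u k|) (fun k => `|v k|) `|x| `|y| n _ _ _ _) _ => //.
by apply: ler_pM; rewrite ?sumr_ge0//; do ?[move=> i _; rewrite mulr_ge0 ?exprn_ge0//];
  apply: nondecreasing_cvgn_le.
Qed.

(** Absolute convergence of both series bounds the square sums of the products, so
    [double_series_diag] applies. *)
Lemma tri_sum_product u v U V (r x y : R) : pser_cv u r U -> pser_cv v r V ->
  `|x| < r -> `|y| < r ->
  tri_sum (fun l m => u l * x ^+ l * (v m * y ^+ m)) n @[n --> \oo] --> U x * V y.
Proof.
move=> uU vV x1 y1.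
pose A l m := u l * x ^+ l * (v m * y ^+ m).
have [B hB] := tri_sum_product_bounded uU vV x1 y1.
have AB n : \sum_(0 <= k < n) \sum_(0 <= m < n) `|A k m| <= B.
  apply: le_trans (hB (n + n)%N); rewrite tri_sumE.
  rewrite (eq_bigr (fun k => \sum_(0 <= m < n) (`|u k| * `|x| ^+ k * (`|v m| * `|y| ^+ m)))); last first.
    by move=> k _; apply: eq_bigr => m _; rewrite /A !normrM !normrX.
  apply: (@square_sum_mono _ (fun k m => `|u k| * `|x| ^+ k * (`|v m| * `|y| ^+ m)) n (n + n) (fun k => (n + n - k)%N)).
  - by move=> k m; rewrite !mulr_ge0 ?exprn_ge0.
  - exact: leq_addr.
  - by move=> k kn; lia.
have AL k : series (A k) @ \oo --> u k * x ^+ k * V y.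
  rewrite (_ : series (A k) = fun n => u k * x ^+ k * pseries v y n); last first.
    by apply/funext => n; rewrite /series /pseries /= mulr_sumr.
  by apply: cvgMl_tmp; exact: vV.
have [S LS] := double_series_diag AB AL.
suff -> : S = U x * V y by [].
have : series (fun k => u k * x ^+ k * V y) @ \oo --> U x * V y.
  rewrite (_ : series _ = fun n => pseries u x n * V y); last first.
    by apply/funext => n; rewrite /series /pseries /= mulr_suml.
  by apply: cvgMr_tmp; exact: uU.
by move=> h; rewrite -(cvg_lim _ LS)// -(cvg_lim _ h).
Qed.

End TriangularProduct.

Section UnitInterval.
Context {R : realType}.
Local Notation mu := (@lebesgue_measure R).
Local Notation I01 := [set` `[(0 : R), 1] ].
Implicit Types (f g : R -> R).

Definition bounded_measurable f : Prop :=
  measurable_fun setT f /\ exists C, forall t, 0 <= t <= 1 -> `|f t| <= C.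

Definition unit_integral f : R := \int[mu]_(t in I01) f t.

Lemma bounded_measurable_integrable f : bounded_measurable f ->
  mu.-integrable I01 (EFin \o f).
Proof.
move=> [mf [C fC]]; apply: measurable_bounded_integrable => //.
- have := @lebesgue_measure_itv R `[0, 1]; rewrite /= => ->.
  by rewrite lte_fin ltr01 -EFinB ltry.
- exact: (measurable_funTS mf).
exists C; split; first exact: num_real.
by move=> y Cy t; rewrite /= in_itv/= => /fC fy; exact: le_trans fy (ltW Cy).
Qed.

Lemma EFin_unit_integral f : bounded_measurable f ->
  (unit_integral f)%:E = (\int[mu]_(t in I01) (f t)%:E)%E.
Proof.
move=> hf; rewrite fineK//.
exact: (integrable_fin_num _ (bounded_measurable_integrable hf)).
Qed.

Lemma bounded_measurable_lin (c : R) f g : bounded_measurable f -> bounded_measurable g ->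
  bounded_measurable (fun t => c * f t + g t).
Proof.
move=> [mf [C fC]] [mg [C' gC]]; split.
  by apply: measurable_funD => //; exact: measurable_funM.
exists (`|c| * C + C') => t t01; apply: le_trans (ler_normD _ _) _.
by rewrite lerD ?gC// normrM ler_wpM2l ?fC.
Qed.

Lemma unit_integral_lin (c : R) f g : bounded_measurable f -> bounded_measurable g ->
  unit_integral (fun t => c * f t + g t) = c * unit_integral f + unit_integral g.
Proof.
move=> hf hg; have iF := bounded_measurable_integrable hf.
have iG := bounded_measurable_integrable hg.
rewrite /unit_integral RintegralD//; last exact: (integrableZl _ c iF).
by rewrite RintegralZl.
Qed.

Lemma unit_integral0 : unit_integral (cst 0) = 0.
Proof. by rewrite /unit_integral Rintegral_cst// mul0r. Qed.

Lemma bounded_measurable0 : bounded_measurable (cst 0).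
Proof. by split => //; exists 0 => t _; rewrite normr0. Qed.

Lemma eq_unit_integral f g : (forall t, 0 <= t <= 1 -> f t = g t) ->
  unit_integral f = unit_integral g.
Proof. by move=> fg; apply: eq_Rintegral => t; rewrite inE/= in_itv/=; exact: fg. Qed.

Lemma unit_integral_sum (J : Type) (s : seq J) (F : J -> R -> R) :
  (forall j, bounded_measurable (F j)) ->
  bounded_measurable (fun t => \sum_(j <- s) F j t) /\
  unit_integral (fun t => \sum_(j <- s) F j t) = \sum_(j <- s) unit_integral (F j).
Proof.
move=> hF; elim: s => [|j s [IH1 IH2]].
  under eq_fun do rewrite big_nil.
  by rewrite big_nil; split; [exact: bounded_measurable0|exact: unit_integral0].
have -> : (fun t => \sum_(i <- j :: s) F i t) = (fun t => 1 * F j t + \sum_(i <- s) F i t).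
  by apply/funext => t; rewrite big_cons mul1r.
split; first exact: bounded_measurable_lin.
by rewrite unit_integral_lin// mul1r big_cons IH2.
Qed.

Lemma unit_integral_tri_sum (F : nat -> nat -> R -> R) n :
  (forall l m, bounded_measurable (F l m)) ->
  bounded_measurable (fun t => tri_sum (fun l m => F l m t) n) /\
  unit_integral (fun t => tri_sum (fun l m => F l m t) n) =
  tri_sum (fun l m => unit_integral (F l m)) n.
Proof.
move=> hF.
have inner j := unit_integral_sum (index_iota 0 j.+1) (fun k => hF k (j - k)%N).
have [h1 h2] := unit_integral_sum (index_iota 0 n) (fun j => (inner j).1).
by split=> //; rewrite /tri_sum h2; apply: eq_bigr => j _; rewrite (inner j).2.
Qed.

Lemma unit_integral_dominated (F : nat -> R -> R) f (C : R) :
  (forall n, measurable_fun setT (F n)) -> measurable_fun setT f ->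
  (forall n t, 0 <= t <= 1 -> `|F n t| <= C) ->
  (forall t, 0 <= t <= 1 -> F n t @[n --> \oo] --> f t) ->
  unit_integral (F n) @[n --> \oo] --> unit_integral f.
Proof.
move=> mF mf FC Ff.
have := @dominated_convergence _ _ _ mu _ (measurable_itv `[0, 1])
  (fun n t => (F n t)%:E) (EFin \o f) (EFin \o cst C).
case.
- by move=> n; apply/measurable_EFinP; exact: (measurable_funTS (mF n)).
- by apply/measurable_EFinP; exact: (measurable_funTS mf).
- apply: aeW => t; rewrite /= in_itv/= => t01; apply: cvg_EFin; first exact: nearW.
  exact: Ff.
- apply: bounded_measurable_integrable; split=> //.
  by exists `|C| => t _.
- by apply: aeW => t n; rewrite /= in_itv/= lee_fin; exact: FC.
move=> iF _.
rewrite (_ : (\int[mu]_(x in I01) (EFin \o f) x)%E = (unit_integral f)%:E).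
  by move=> /fine_cvgP[_]; exact.
by rewrite /unit_integral /Rintegral fineK//; exact: (integrable_fin_num _ iF).
Qed.

End UnitInterval.

(** * Taylor coefficients of the transform *)

Section EstimatorExpansion.
Context {R : realType}.
Variables (z nu : R).
Hypothesis z0 : 0 < z.
Local Notation mu := (@lebesgue_measure R).
Implicit Types (t r s B : R).

Definition segment z' t : R := 1 - (1 - z') * t.

Lemma segment_ge t : 0 <= t <= 1 -> Num.min 1 z <= segment z t <= Num.max 1 z.
Proof.
move=> /andP[t0 t1]; rewrite /segment ge_min le_max.
by have [z1|z1] := leP z 1; apply/andP; split; apply/orP; [right|left|left|right]; nra.
Qed.

Let m0 : R := Num.min 1 z.
Let m00 : 0 < m0. Proof. by rewrite /m0 lt_min ltr01. Qed.

Lemma segment_gt0 t : 0 <= t <= 1 -> 0 < segment z t.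
Proof. by move=> /segment_ge/andP[h _]; exact: lt_le_trans m00 h. Qed.

(** Up to the factor [k.+1] this is Euler's integral for F(1, B; k + 2; 1 - z), see
    [hyp2F1_euler]. *)
Definition moment (k : nat) B : R :=
  unit_integral (fun t => (1 - t) ^+ k * segment z t `^ (- B)).

Lemma powR_segment_le (p t : R) : 0 <= t <= 1 ->
  segment z t `^ p <= m0 `^ p + Num.max 1 z `^ p.
Proof.
move=> t01; have /andP[h1 h2] := segment_ge t01; have s0 := segment_gt0 t01.
have [p0|p0] := leP 0 p.
  apply: ler_wpDl; first exact: powR_ge0.
  apply: ge0_ler_powR => //; rewrite nnegrE ltW//; exact: lt_le_trans s0 h2.
apply: ler_wpDr; first exact: powR_ge0.
rewrite -[p]opprK !(powRN _ (- p)) lef_pV2 ?posrE ?powR_gt0//.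
by apply: ge0_ler_powR; rewrite ?nnegrE ?oppr_ge0//; exact: ltW.
Qed.

Lemma bounded_measurable_moment k B :
  bounded_measurable (fun t => (1 - t) ^+ k * segment z t `^ (- B)).
Proof.
split; first by rewrite /segment; mfun.
exists (m0 `^ (- B) + Num.max 1 z `^ (- B)) => t t01.
rewrite normrM ger0_norm; last by rewrite exprn_ge0//; lra.
rewrite ger0_norm ?powR_ge0// -[leRHS]mul1r ler_pM ?powR_ge0 ?powR_segment_le//.
  by rewrite exprn_ge0//; lra.
by rewrite exprn_ile1//; lra.
Qed.

Definition ascending_coef (c : R) n : R := rising c n / n`!%:R.

(** Both powers are expanded by the binomial series, in (1 - t) r / segment and in (1 - t) s, and
    integrated termwise by dominated convergence. *)
Lemma cvg_tri_sum_moment r s : 0 <= r < m0 -> 0 <= s < 1 ->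
  tri_sum (fun l m => ascending_coef (1 + nu) l * ascending_coef (1 - nu) m *
     moment (l + m) (l%:R + nu + 1) * (r ^+ l * s ^+ m)) n @[n --> \oo] -->
  unit_integral (fun t => (segment z t - (1 - t) * r) `^ (- nu - 1) *
     (1 - (1 - t) * s) `^ (nu - 1)).
Proof.
move=> /andP[r0 rm] /andP[s0 s1].
set u := ascending_coef (1 + nu); set v := ascending_coef (1 - nu).
have uU := @pser_cv_binomial R (1 + nu); have vV := @pser_cv_binomial R (1 - nu).
pose G l m t := u l * v m * (r ^+ l * s ^+ m) * ((1 - t) ^+ (l + m) * segment z t `^ (- (l%:R + nu + 1))).
have hG l m : bounded_measurable (G l m).
  have h := bounded_measurable_lin (u l * v m * (r ^+ l * s ^+ m))
    (bounded_measurable_moment (l + m) (l%:R + nu + 1)) bounded_measurable0.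
  by move: h; congr bounded_measurable; apply/funext => t; rewrite addr0.
(* Since [segment] is at least [m0], this bounds the first expansion variable uniformly in [t]; it
   is below 1 exactly because [r < m0]. *)
pose q := r / m0.
have q0 : 0 <= q by rewrite divr_ge0// ltW.
have q1 : q < 1 by rewrite ltr_pdivrMr// mul1r.
have nq : `|q| < 1 by rewrite ger0_norm.
have ns : `|s| < 1 by rewrite ger0_norm.
have [C hC] := tri_sum_product_bounded uU vV nq ns.
have GE l m t : 0 <= t <= 1 -> G l m t = segment z t `^ (- nu - 1) *
    (u l * ((1 - t) * r / segment z t) ^+ l * (v m * ((1 - t) * s) ^+ m)).
  move=> t01; have s0' := segment_gt0 t01; rewrite /G.
  have -> : segment z t `^ (- (l%:R + nu + 1)) = segment z t `^ (- nu - 1) * segment z t ^- l.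
    rewrite -powR_invn ?ltW// -powRD ?(gt_eqF s0') ?implybT//; congr (_ `^ _); ring.
  rewrite exprD !exprMn exprVn; ring.
have tE n t : 0 <= t <= 1 -> tri_sum (fun l m => G l m t) n = segment z t `^ (- nu - 1) *
    tri_sum (fun l m => u l * ((1 - t) * r / segment z t) ^+ l * (v m * ((1 - t) * s) ^+ m)) n.
  by move=> t01; rewrite -tri_sumZ; apply: eq_tri_sum => l m; exact: GE.
have xq t : 0 <= t <= 1 -> 0 <= (1 - t) * r / segment z t <= q.
  move=> t01; have /andP[h1 _] := segment_ge t01; have s0' := segment_gt0 t01.
  have t1 : 0 <= 1 - t by lra.
  rewrite divr_ge0 ?mulr_ge0 ?(ltW s0')//= ler_pdivrMr// /q mulrAC ler_pdivlMr//.
  apply: (@le_trans _ _ (1 * r * m0)); first by rewrite ler_wpM2r ?(ltW m00)// ler_wpM2r//; lra.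
  by rewrite mul1r ler_wpM2l.
have yq t : 0 <= t <= 1 -> 0 <= (1 - t) * s <= s.
  move=> t01; have t1 : 0 <= 1 - t by lra.
  by rewrite mulr_ge0//= ler_piMl//; lra.
have mo l m : unit_integral (G l m) = u l * v m * moment (l + m) (l%:R + nu + 1) * (r ^+ l * s ^+ m).
  rewrite (@eq_unit_integral _ _ (fun t => (u l * v m * (r ^+ l * s ^+ m)) *
     ((1 - t) ^+ (l + m) * segment z t `^ (- (l%:R + nu + 1))) + cst 0 t)); last first.
    by move=> t _; rewrite /cst addr0.
  rewrite unit_integral_lin ?unit_integral0 ?addr0; [|exact: bounded_measurable_moment|exact: bounded_measurable0].
  by rewrite /moment; ring.
have -> : tri_sum (fun l m => u l * v m * moment (l + m) (l%:R + nu + 1) * (r ^+ l * s ^+ m)) =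
    (fun n => unit_integral (fun t => tri_sum (fun l m => G l m t) n)).
  apply/funext => n; rewrite (unit_integral_tri_sum n hG).2.
  by apply: eq_tri_sum => l m; rewrite mo.
apply: (@unit_integral_dominated _ (fun n t => tri_sum (fun l m => G l m t) n) _
  ((m0 `^ (- nu - 1) + Num.max 1 z `^ (- nu - 1)) * C)).
- by move=> n; exact: (unit_integral_tri_sum n hG).1.1.
- by rewrite /segment; mfun.
- move=> n t t01; rewrite tE// normrM ger0_norm ?powR_ge0//.
  apply: ler_pM; rewrite ?powR_ge0 ?normr_ge0 ?powR_segment_le//.
  apply: le_trans (hC n); rewrite -[X in `|X|]subr0.
  (* Compared with the empty sum, [tri_sum_diff_le] serves as the triangle inequality. *)
  rewrite (_ : 0 = tri_sum (fun l m => u l * ((1 - t) * r / segment z t) ^+ l * (v m * ((1 - t) * s) ^+ m)) 0%N); last first.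
    by rewrite /tri_sum big_geq.
  have /andP[x0 x1] := xq t t01; have /andP[y0 y1] := yq t t01.
  apply: le_trans (@tri_sum_diff_le _ _ (fun l m => `|u l| * `|q| ^+ l * (`|v m| * `|s| ^+ m)) 0%N n (leq0n n) _) _.
    move=> l m; rewrite !(normrM (_ * _ ^+ _)) !(normrM _ (_ ^+ _)) !normrX.
    rewrite (ger0_norm x0) (ger0_norm y0) (ger0_norm q0) (ger0_norm s0).
    have xl : ((1 - t) * r / segment z t) ^+ l <= q ^+ l by rewrite lerXn2r ?nnegrE.
    have ym : ((1 - t) * s) ^+ m <= s ^+ m by rewrite lerXn2r ?nnegrE.
    by rewrite ler_pM ?mulr_ge0 ?exprn_ge0// ler_wpM2l.
  by rewrite [X in _ - X](_ : _ = 0) ?subr0// /tri_sum big_geq.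
- move=> t t01; have /andP[x0 x1] := xq t t01; have /andP[y0 y1] := yq t t01.
  have s0' := segment_gt0 t01.
  under eq_fun do rewrite tE//.
  have -> : (segment z t - (1 - t) * r) `^ (- nu - 1) * (1 - (1 - t) * s) `^ (nu - 1) =
    segment z t `^ (- nu - 1) * ((1 - (1 - t) * r / segment z t) `^ (- (1 + nu)) *
      (1 - (1 - t) * s) `^ (- (1 - nu))).
    rewrite mulrA (_ : - (1 + nu) = - nu - 1); last by ring.
    rewrite (_ : - (1 - nu) = nu - 1); last by ring.
    rewrite -powRM ?(ltW s0')//; last by lra.
    by congr (_ `^ _ * _); field; rewrite gt_eqF.
  apply: cvgMl_tmp; apply: (tri_sum_product uU vV).
    by rewrite ger0_norm//; lra.
  by rewrite ger0_norm//; lra.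
Qed.

(** Up to a constant the integrand is the derivative of the nu-th power of the quotient of the
    affine functions (1 - s) + s t and (1 - r) + k t, whose determinant is the factor (1 - r) - z (1
    - s). Kept on the left, that factor may vanish. *)
Lemma unit_integral_ratio r s : 0 <= r < m0 -> 0 <= s < 1 ->
  ((1 - r) - z * (1 - s)) * (nu * z `^ nu *
  unit_integral (fun t => (segment z t - (1 - t) * r) `^ (- nu - 1) *
     (1 - (1 - t) * s) `^ (nu - 1))) = 1 - (z * (1 - s) / (1 - r)) `^ nu.
Proof.
move=> /andP[r0 rm] /andP[s0 s1].
pose k := r - (1 - z).
have PE t : segment z t - (1 - t) * r = (1 - r) + k * t by rewrite /segment /k; ring.
have qE t : 1 - (1 - t) * s = (1 - s) + s * t by ring.
have P0 t : 0 <= t <= 1 -> 0 < (1 - r) + k * t.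
  move=> t01; rewrite -PE subr_gt0; have /andP[h1 _] := segment_ge t01.
  by apply: lt_le_trans h1; apply: le_lt_trans rm; rewrite ler_piMl//; lra.
have Q0 t : 0 <= t <= 1 -> 0 < (1 - s) + s * t by move=> t01; nra.
pose g t := ((1 - r) + k * t) `^ (- nu - 1) * ((1 - s) + s * t) `^ (nu - 1).
rewrite (@eq_unit_integral _ _ g); last by move=> t _; rewrite PE qE.
pose c := ((1 - r) - z * (1 - s)) * nu * z `^ nu.
pose F t := z `^ nu * (((1 - s) + s * t) `^ nu * ((1 - r) + k * t) `^ (- nu)).
have mg : measurable_fun setT g by rewrite /g; mfun.
have dg t : 0 <= t <= 1 -> {for t, continuous g} /\ is_derive t (1 : R) F (c * g t).
  move=> t01; have d1 a := is_derive_affpowR a (P0 t t01); have d2 a := is_derive_affpowR a (Q0 t t01).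
  split.
    apply: (@continuousM _ _ (fun t : R => ((1 - r) + k * t) `^ (- nu - 1)) (fun t : R => ((1 - s) + s * t) `^ (nu - 1))).
      exact: is_derive_continuous (d1 _).
    exact: is_derive_continuous (d2 _).
  have d3 := is_deriveZ (z `^ nu) (is_deriveM (d2 nu) (d1 (- nu))).
  apply: (is_derive_eq d3); rewrite /GRing.scale/=.
  have -> : ((1 - s) + s * t) `^ nu = ((1 - s) + s * t) * ((1 - s) + s * t) `^ (nu - 1).
    by rewrite powR_split// Q0.
  have -> : ((1 - r) + k * t) `^ (- nu) = ((1 - r) + k * t) * ((1 - r) + k * t) `^ (- nu - 1).
    by rewrite powR_split// P0.
  rewrite /c /g /k; ring.
have cont : {within [set` `[0, 1] ], continuous g}.
  apply: continuous_in_subspaceT => t; rewrite inE/= in_itv/= => t01.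
  by have [] := dg t t01.
have hg : bounded_measurable g.
  split => //; have [M [_ hM]] := @compact_bounded _ _ _ (continuous_compact cont (@segment_compact R 0 1)).
  exists (M + 1) => t t01; apply: (hM (M + 1)); first by rewrite ltrDl.
  by exists t => //; rewrite /= in_itv.
have E : c * unit_integral g = F 1 - F 0.
  apply: EFin_inj; rewrite -(@FTC_cc _ (fun t => c * g t) F 0 1)//; last first.
    move=> t t01; have [h1 h2] := dg t t01; split => //.
    by apply: (@continuousM _ _ (cst c : R -> R) g) => //; exact: cvg_cst.
  have hcg : bounded_measurable (fun t => c * g t).
    have := bounded_measurable_lin c hg bounded_measurable0.
    by congr bounded_measurable; apply/funext => t; rewrite addr0.
  rewrite -EFin_unit_integral//; congr (_%:E).
  have := unit_integral_lin c hg bounded_measurable0; rewrite unit_integral0 addr0 => <-.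
  by apply: eq_unit_integral => t _; rewrite addr0.
have -> : ((1 - r) - z * (1 - s)) * (nu * z `^ nu * unit_integral g) = c * unit_integral g.
  by rewrite /c; ring.
rewrite E; congr (_ - _).
  rewrite /F !mulr1 (_ : 1 - s + s = 1) ?powR1; last by ring.
  rewrite (_ : 1 - r + k = z); last by rewrite /k; ring.
  by rewrite mul1r powRN mulfV// gt_eqF// powR_gt0.
have r1 : 0 < 1 - r by have := P0 0; rewrite mulr0 addr0; apply; rewrite lexx ler01.
have s1' : 0 < 1 - s by lra.
rewrite /F !mulr0 !addr0 powRM ?mulr_ge0 ?invr_ge0 ?ltW// powRM ?ltW// mulrA; congr (_ * _).
by rewrite -powR_inv1 ?ltW// -powRrM mulN1r.
Qed.

Definition estimator_coef (k1 : R) l m : R := nu * z `^ nu / k1 *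
  (ascending_coef (1 + nu) l * ascending_coef (1 - nu) m * moment (l + m) (l%:R + nu + 1)).

Lemma cvg_estimator_coef (k1 r s : R) : 0 < k1 -> 0 <= r < m0 -> 0 <= s < 1 ->
  let k1' := k1 * (1 - r) in let k2' := k1 * z * (1 - s) in k1' != k2' ->
  tri_sum (fun l m => estimator_coef k1 l m * (r ^+ l * s ^+ m)) n @[n --> \oo] -->
    k1'^-1 * ((k2' / k1') `^ nu - 1) / (k2' / k1' - 1).
Proof.
move=> k10 hr hs k1' k2' kk.
have hr1 : 0 < 1 - r.
  by have /andP[_ h] := hr; rewrite subr_gt0 (lt_le_trans h)// ge_min lexx.
have hs1 : 0 < 1 - s by lra.
have U := unit_integral_ratio hr hs; set I := unit_integral _ in U.
have d0 : (1 - r) - z * (1 - s) != 0.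
  apply: contra kk; rewrite subr_eq0 /k1' /k2' -mulrA => /eqP ->; exact: eqxx.
have -> : k1'^-1 * ((k2' / k1') `^ nu - 1) / (k2' / k1' - 1) = nu * z `^ nu / k1 * I.
  have -> : k2' / k1' = z * (1 - s) / (1 - r).
    by rewrite /k2' /k1'; field; rewrite !gt_eqF.
  set V := (z * (1 - s) / (1 - r)) `^ nu in U *.
  have -> : V - 1 = - (((1 - r) - z * (1 - s)) * (nu * z `^ nu * I)) by rewrite U; ring.
  have -> : z * (1 - s) / (1 - r) - 1 = - (((1 - r) - z * (1 - s)) / (1 - r)).
    by field; rewrite gt_eqF.
  move: d0; set del := (1 - r) - z * (1 - s) => d0.
  by rewrite /k1'; field; rewrite d0 !gt_eqF.
rewrite (_ : tri_sum _ = fun n => nu * z `^ nu / k1 *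
  tri_sum (fun l m => ascending_coef (1 + nu) l * ascending_coef (1 - nu) m *
     moment (l + m) (l%:R + nu + 1) * (r ^+ l * s ^+ m)) n); last first.
  apply/funext => n; rewrite -tri_sumZ; apply: eq_tri_sum => l m.
  by rewrite /estimator_coef !mulrA.
by apply: cvgMl_tmp; exact: cvg_tri_sum_moment.
Qed.

End EstimatorExpansion.

(** * Euler's integral and the functions g *)

Section EulerIntegral.
Context {R : realType}.
Implicit Types (a b s z nu B x t : R).

Lemma unit_integral_series (u : R^nat) (f phi h : R -> R) (q C : R) : q < 1 ->
  pser_cv u 1 f -> measurable_fun setT phi -> measurable_fun setT h ->
  measurable_fun setT (fun t => f (phi t) * h t) ->
  (forall t, 0 <= t <= 1 -> `|phi t| <= q) -> (forall t, 0 <= t <= 1 -> `|h t| <= C) ->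
  series (fun n => u n * unit_integral (fun t => phi t ^+ n * h t)) @ \oo -->
    unit_integral (fun t => f (phi t) * h t).
Proof.
move=> q1 uf mp mh mfh phq hC.
have t0 : 0 <= (0 : R) <= 1 by rewrite lexx ler01.
have q0 : 0 <= q by apply: le_trans (phq 0 t0).
have C0 : 0 <= C by apply: le_trans (hC 0 t0).
pose F n t := u n * (phi t ^+ n * h t).
have hF0 n : bounded_measurable (fun t => phi t ^+ n * h t).
  split; first by mfun.
  exists C => t t01; rewrite normrM normrX -[leRHS]mul1r ler_pM ?hC//.
  by rewrite exprn_ile1// ltW// (le_lt_trans (phq t t01)).
have hF n : bounded_measurable (F n).
  have := bounded_measurable_lin (u n) (hF0 n) bounded_measurable0.
  by congr bounded_measurable; apply/funext => t; rewrite addr0.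
have -> : series (fun n => u n * unit_integral (fun t => phi t ^+ n * h t)) =
    (fun n => unit_integral (fun t => \sum_(0 <= i < n) F i t)).
  apply/funext => n; rewrite (unit_integral_sum (index_iota 0 n) hF).2.
  apply: eq_bigr => i _.
  have := unit_integral_lin (u i) (hF0 i) bounded_measurable0.
  rewrite unit_integral0 addr0 => <-; apply: eq_unit_integral => t _.
  by rewrite /F /cst addr0.
have nq : `|q| < 1 by rewrite ger0_norm.
have cq := pser_cv_normed uf nq.
pose S := limn (pseries (fun n => `|u n|) `|q|).
apply: (@unit_integral_dominated _ (fun n t => \sum_(0 <= i < n) F i t) _ (S * C)).
- by move=> n; exact: (unit_integral_sum (index_iota 0 n) hF).1.1.
- exact: mfh.
- move=> n t t01; apply: le_trans (ler_norm_sum _ _ _) _.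
  apply: (@le_trans _ _ (pseries (fun n => `|u n|) `|q| n * C)).
    rewrite /pseries /series /= mulr_suml; apply: ler_sum => i _.
    rewrite /F !normrM normrX mulrA ler_pM ?hC ?mulr_ge0 ?exprn_ge0//.
    by rewrite ler_wpM2l// lerXn2r ?nnegrE// [leRHS]ger0_norm ?phq.
  rewrite ler_wpM2r//; apply: nondecreasing_cvgn_le => //.
  apply/nondecreasing_seqP => i; rewrite /pseries /series/= big_nat_recr//= lerDl.
  by rewrite mulr_ge0 ?exprn_ge0.
- move=> t t01; have pt : `|phi t| < 1 by apply: le_lt_trans (phq t t01) q1.
  rewrite (_ : (fun n => \sum_(0 <= i < n) F i t) = (fun n => pseries u (phi t) n * h t)).
    by apply: cvgMr_tmp; exact: uf.
  by apply/funext => n; rewrite /pseries /series /= mulr_suml; apply: eq_bigr => i _; rewrite /F mulrA.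
Qed.

Lemma unit_integral_beta k n :
  unit_integral (fun t : R => (1 - t) ^+ k * t ^+ n) = n`!%:R * k`!%:R / (n + k).+1`!%:R.
Proof.
rewrite -natrM -beta_fun_fact /beta_fun -Rintegral_mkcond.
by apply: eq_Rintegral => t _; rewrite /XMonemX mulrC.
Qed.

Lemma rising_nat k n : rising (k.+1%:R : R) n = (n + k)`!%:R / k`!%:R.
Proof.
have k0 : k`!%:R != 0 :> R by rewrite pnatr_eq0 -lt0n fact_gt0.
elim: n => [|n IH]; first by rewrite rising0 add0n divff.
rewrite risingS IH addSn factS natrM -natrD mulrAC; congr (_ / _).
by rewrite mulrC; congr (_%:R * _); lia.
Qed.

(** Termwise integration with beta values. For z < 2 the Gauss series in 1 - z is used; for z >= 2
    it no longer converges, and Pfaff's transformation passes to the variable (z - 1) / z in [0,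
    1[. *)
Lemma hyp2F1_euler k B z : 0 < z ->
  hyp2F1 1 B (k%:R + 2) (1 - z) = k.+1%:R * moment z k B.
Proof.
move=> z0; have k0 m : m.+1%:R != 0 :> R by rewrite pnatr_eq0.
have f0 m : m`!%:R != 0 :> R by rewrite pnatr_eq0 -lt0n fact_gt0.
have kE : (k%:R + 2 : R) = k.+2%:R by rewrite -[in RHS]addn2 natrD.
have c0 : 0 < k%:R + 2 :> R by rewrite kE.
have bB := @pser_cv_binomial R B.
have hk t : 0 <= t <= 1 -> `|(1 - t) ^+ k| <= 1.
  by move=> t01; rewrite ger0_norm ?exprn_ge0 ?exprn_ile1//; lra.
have mk : measurable_fun setT (fun t : R => (1 - t) ^+ k) by mfun.
have [z2|z2] := ltP z 2.
  have q1 : `|1 - z| < 1 by rewrite ltr_norml; lra.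
  have H := @hyp2F1_gauss _ 1 B _ _ c0 q1.
  have mphi : measurable_fun setT (fun t : R => (1 - z) * t) by mfun.
  have mfh : measurable_fun setT (fun t : R => (1 - (1 - z) * t) `^ (- B) * (1 - t) ^+ k) by mfun.
  have bphi t : 0 <= t <= 1 -> `|(1 - z) * t| <= `|1 - z|.
    by move=> /andP[t0 t1]; rewrite normrM (ger0_norm t0) ler_piMr.
  have H2 := unit_integral_series q1 bB mphi mk mfh bphi hk.
  have H3 : pseries (hyp2F1_coef 1 B (k%:R + 2)) (1 - z) @ \oo --> k.+1%:R * moment z k B.
    rewrite (_ : moment z k B = unit_integral (fun t : R => (1 - (1 - z) * t) `^ (- B) * (1 - t) ^+ k)); last first.
      by apply: eq_unit_integral => t _; rewrite mulrC.
    rewrite (_ : pseries _ _ = fun n => k.+1%:R * series (fun n => rising B n / n`!%:R *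
        unit_integral (fun t : R => ((1 - z) * t) ^+ n * (1 - t) ^+ k)) n).
      by apply: cvgMl_tmp; exact: H2.
    apply/funext => n; rewrite /pseries /series /= mulr_sumr; apply: eq_bigr => i _.
    have -> : unit_integral (fun t : R => ((1 - z) * t) ^+ i * (1 - t) ^+ k) =
        (1 - z) ^+ i * (i`!%:R * k`!%:R / (i + k).+1`!%:R).
      rewrite -unit_integral_beta.
      have hb : bounded_measurable (fun t : R => (1 - t) ^+ k * t ^+ i).
        split; first by mfun.
        exists 1 => t t01; rewrite normrM -[leRHS]mulr1 ler_pM ?hk//.
        by rewrite ger0_norm ?exprn_ge0 ?exprn_ile1//; lra.
      have := unit_integral_lin ((1 - z) ^+ i) hb bounded_measurable0.
      rewrite unit_integral0 addr0 => <-; apply: eq_unit_integral => t _.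
      by rewrite /cst addr0 exprMn; ring.
    rewrite /hyp2F1_coef rising1 kE rising_nat addnS !factS !natrM.
    move: (k.+1%:R : R) (k0 k) ((i + k).+1%:R : R) (k0 (i + k)%N) => K K0 L L0.
    by field; rewrite K0 L0 !f0.
  by rewrite -(cvg_lim _ H)// -(cvg_lim _ H3).
have zn : z != 0 by rewrite gt_eqF.
pose y := (1 - z) / (1 - z - 1).
have yE : y = (z - 1) / z by rewrite /y (_ : 1 - z - 1 = - z) ?invrN ?mulrN -?mulNr ?opprB//; ring.
have y0 : 0 <= y by rewrite yE divr_ge0 ?ltW//; lra.
have y1 : y < 1 by rewrite yE ltr_pdivrMr//; lra.
have ny : `|y| < 1 by rewrite ger0_norm.
(* The upper parameters are exchanged first, so that the prefactor is z^(-B), the power that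
   combines with the integrand into [segment]. *)
rewrite hyp2F1C hyp2F1_pfaff//; last by lra.
rewrite -/y (_ : 1 - (1 - z) = z); last by ring.
have H := @hyp2F1_gauss _ B (k%:R + 2 - 1) _ _ c0 ny.
have mphi : measurable_fun setT (fun t : R => y * (1 - t)) by mfun.
have mfh : measurable_fun setT (fun t : R => (1 - y * (1 - t)) `^ (- B) * (1 - t) ^+ k) by mfun.
have bphi t : 0 <= t <= 1 -> `|y * (1 - t)| <= y.
  by move=> /andP[t0 t1]; rewrite normrM ger0_norm// ger0_norm ?ler_piMr//; lra.
have H2 := unit_integral_series y1 bB mphi mk mfh bphi hk.
have H3 : pseries (hyp2F1_coef B (k%:R + 2 - 1) (k%:R + 2)) y @ \oo --> k.+1%:R *
   unit_integral (fun t : R => (1 - y * (1 - t)) `^ (- B) * (1 - t) ^+ k).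
  rewrite (_ : pseries _ _ = fun n => k.+1%:R * series (fun n => rising B n / n`!%:R *
      unit_integral (fun t : R => (y * (1 - t)) ^+ n * (1 - t) ^+ k)) n).
    by apply: cvgMl_tmp; exact: H2.
  apply/funext => n; rewrite /pseries /series /= mulr_sumr; apply: eq_bigr => i _.
  have -> : unit_integral (fun t : R => (y * (1 - t)) ^+ i * (1 - t) ^+ k) =
      y ^+ i * (0`!%:R * (i + k)`!%:R / (0 + (i + k)).+1`!%:R).
    rewrite -unit_integral_beta.
    have hb : bounded_measurable (fun t : R => (1 - t) ^+ (i + k) * t ^+ 0).
      split; first by mfun.
      exists 1 => t t01; rewrite expr0 mulr1.
      by rewrite ger0_norm ?exprn_ge0 ?exprn_ile1//; lra.
    have := unit_integral_lin (y ^+ i) hb bounded_measurable0.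
    rewrite unit_integral0 addr0 => <-; apply: eq_unit_integral => t _.
    by rewrite /cst addr0 exprMn expr0 exprD; ring.
  have -> : (k%:R + 2 - 1 : R) = k.+1%:R by rewrite -natr1; ring.
  rewrite /hyp2F1_coef kE !rising_nat add0n fact0 addnS !factS !natrM.
  move: (k.+1%:R : R) (k0 k) ((i + k).+1%:R : R) (k0 (i + k)%N) => K K0 L L0.
  by field; rewrite K0 L0 !f0.
rewrite -(cvg_lim _ H)// (cvg_lim _ H3)// mulrCA; congr (_ * _).
have sE t : 0 <= t <= 1 -> z `^ (- B) * (1 - y * (1 - t)) `^ (- B) = segment z t `^ (- B).
  move=> t01; rewrite -powRM ?(ltW z0)//; last by have := bphi t t01; rewrite ler_norml; lra.
  by congr (_ `^ _); rewrite /segment yE; field.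
have zB : 0 < z `^ (- B) by exact: powR_gt0.
have hb : bounded_measurable (fun t : R => (1 - y * (1 - t)) `^ (- B) * (1 - t) ^+ k).
  split => //; have [_ [C hC]] := bounded_measurable_moment z0 k B.
  exists ((z `^ (- B))^-1 * C) => t t01; rewrite ler_pdivlMl//.
  by rewrite -{1}(gtr0_norm zB) -normrM mulrA sE// mulrC hC.
have := unit_integral_lin (z `^ (- B)) hb bounded_measurable0.
rewrite unit_integral0 addr0 => <-; apply: eq_unit_integral => t t01.
by rewrite /cst addr0 mulrA sE// mulrC.
Qed.

Lemma falling_Sl s n : falling (s + 1) n.+1 = (s + 1) * falling s n.
Proof.
rewrite /falling big_ord_recl subr0; congr (_ * _); apply: eq_bigr => i _.
by rewrite lift0 -natr1; ring.
Qed.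

(** The product runs from nu + l down to nu - m through the factor nu. The l factors above it form
    [rising (1 + nu) l]; the m factors below it form [rising (1 - nu) m] with m sign changes, which
    squaring removes later. *)
Lemma falling_rising nu l m : falling (l%:R + nu) (l + m).+1 =
  rising (1 + nu) l * nu * ((-1) ^+ m * rising (1 - nu) m).
Proof.
elim: l => [|l IH].
  rewrite add0n add0r rising0 mul1r; elim: m => [|m IH].
    by rewrite /falling big_ord_recr big_ord0 /= rising0 expr0 !mulr1 mul1r subr0.
  rewrite /falling big_ord_recr /= -/(falling _ _) IH risingS exprS -natr1; ring.
rewrite addSn (_ : l.+1%:R + nu = l%:R + nu + 1); last by rewrite -natr1; ring.
rewrite falling_Sl IH risingS; ring.
Qed.

Lemma poch_nat s n : 0 < s -> poch s n%:R = rising s n.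
Proof.
move=> s0; have Gs := lt0r_neq0 (Gamma_gt0 s0); rewrite /poch.
elim: n => [|n IH]; first by rewrite addr0 divff// rising0.
rewrite risingS -IH -natr1 addrA GammaS; last by rewrite ltr_wpDr.
by field.
Qed.

Lemma Gamma_nat n : Gamma (n.+1%:R : R) = n`!%:R.
Proof.
elim: n => [|n IH]; first exact: Gamma1.
by rewrite -natr1 GammaS// IH factS natrM.
Qed.

Lemma g_moment (k l : nat) z nu : 0 < z ->
  g k l%:R z nu = falling (l%:R + nu) k.+1 * z `^ nu * moment z k (l%:R + nu + 1).
Proof.
move=> z0; rewrite /g /hyp2F1_reg hyp2F1_euler//.
have -> : (k%:R + 2 : R) = k.+2%:R by rewrite -[in RHS]addn2 natrD.
rewrite Gamma_nat factS natrM.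
have k0 : k.+1%:R != 0 :> R by rewrite pnatr_eq0.
have f0 : k`!%:R != 0 :> R by rewrite pnatr_eq0 -lt0n fact_gt0.
move: (k.+1%:R : R) k0 => K k0.
by field; rewrite f0 k0.
Qed.

Lemma g_estimator_coef a b z nu k1 (l m : nat) : 0 < a -> 0 < b -> 0 < z -> 0 < k1 ->
  k1 ^- 2 * (g (l + m) l%:R z nu ^+ 2 / (poch a l%:R * poch b m%:R * l`!%:R * m`!%:R)) =
  estimator_coef z nu k1 l m ^+ 2 / (ascending_coef a l * ascending_coef b m).
Proof.
move=> a0 b0 z0 k10; rewrite g_moment// falling_rising !poch_nat// /estimator_coef /ascending_coef.
have ra := rising_neq0 l a0; have rb := rising_neq0 m b0.
have f0 n : n`!%:R != 0 :> R by rewrite pnatr_eq0 -lt0n fact_gt0.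
have s2 : ((-1) ^+ m) ^+ 2 = 1 :> R by rewrite -exprM mulnC exprM sqrrN !expr1n.
rewrite !exprMn s2 mul1r.
by field; rewrite ra rb !f0 gt_eqF.
Qed.

End EulerIntegral.

(** * The double integral as a series *)

Section DoubleIntegral.
Context {R : realType}.
Local Notation mu := (@lebesgue_measure R).
Local Notation oo01 := [set` `](0 : R)%R, 1%R[ ].
Implicit Types (a b z nu x y t : R).

Lemma integral_oo01 (f : R -> R) : bounded_measurable f ->
  (\int[mu]_(t in oo01) (f t)%:E)%E = (unit_integral f)%:E.
Proof.
move=> hf; rewrite EFin_unit_integral//; have [mf _] := hf.
have mfD D : measurable_fun D (EFin \o f) by apply/measurable_EFinP; exact: measurable_funTS.
by rewrite integral_itv_bndo_bndc// integral_itv_obnd_cbnd.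
Qed.

Lemma hyp2F1_coef_sq_ge0 (c : R) a n : 0 < a -> 0 <= hyp2F1_coef c c a n.
Proof.
move=> a0; rewrite /hyp2F1_coef divr_ge0//; first by rewrite -expr2 sqr_ge0.
by rewrite mulr_ge0// ltW// rising_gt0.
Qed.

(** With equal upper parameters the coefficients are squares over positive numbers, so sums and
    integrals commute by positivity alone. Each term is a product of the same function of x and of
    y, which produces the square of [moment]. *)
Lemma double_integral_series a b z nu : 0 < a -> 0 < b -> 0 < z ->
  (\int[mu]_(y in oo01) \int[mu]_(x in oo01)
     (let D := (1 - (1 - z) * x) * (1 - (1 - z) * y) in
      hyp2F1 (1 + nu) (1 + nu) a ((1 - x) * (1 - y) / D) *
      hyp2F1 (1 - nu) (1 - nu) b ((1 - x) * (1 - y)) * D `^ (- nu - 1))%:E)%E =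
  (\sum_(0 <= k <oo) (\sum_(0 <= l < k.+1)
     (hyp2F1_coef (1 + nu) (1 + nu) a l * hyp2F1_coef (1 - nu) (1 - nu) b (k - l) *
      moment z (l + (k - l)) (l%:R + nu + 1) ^+ 2))%:E)%E.
Proof.
move=> a0 b0 z0; set A := hyp2F1_coef _ _ a; set B := hyp2F1_coef _ _ b.
have A0 l : 0 <= A l by exact: hyp2F1_coef_sq_ge0.
have B0 l : 0 <= B l by exact: hyp2F1_coef_sq_ge0.
pose h l m t : R := (1 - t) ^+ (l + m) * segment z t `^ (- (l%:R + nu + 1)).
have hb l m : bounded_measurable (h l m) by exact: bounded_measurable_moment.
have mh l m : measurable_fun setT (h l m) by have [] := hb l m.
have h0 l m t : oo01 t -> 0 <= h l m t.
  by rewrite /= in_itv/= => /andP[t0 t1]; rewrite mulr_ge0 ?powR_ge0// exprn_ge0//; lra.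
pose G k y x := \sum_(0 <= l < k.+1) (A l * B (k - l)%N * h l (k - l)%N y) * h l (k - l)%N x.
have sumE y x : oo01 y -> oo01 x ->
    ((let D := (1 - (1 - z) * x) * (1 - (1 - z) * y) in
      hyp2F1 (1 + nu) (1 + nu) a ((1 - x) * (1 - y) / D) *
      hyp2F1 (1 - nu) (1 - nu) b ((1 - x) * (1 - y)) * D `^ (- nu - 1))%:E =
     \sum_(0 <= k <oo) (G k y x)%:E)%E.
  rewrite /= !in_itv/= => /andP[y0 y1] /andP[x0 x1].
  have x01 : 0 <= x <= 1 by rewrite !ltW.
  have y01 : 0 <= y <= 1 by rewrite !ltW.
  have sx := segment_gt0 z0 x01; have sy := segment_gt0 z0 y01.
  rewrite -/(segment z x) -/(segment z y).
  set D := segment z x * segment z y; have D0 : 0 < D by rewrite mulr_gt0.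
  set X := (1 - x) * (1 - y).
  have X0 : 0 < X by rewrite mulr_gt0// subr_gt0.
  have X1 : X < 1 by rewrite /X; nra.
  (* [segment z x] exceeds 1 - x by z x > 0, so on the open square the first hypergeometric series
     converges for every z > 0. *)
  have XD : X < D.
    have hx : 1 - x < segment z x by rewrite /segment; nra.
    have hy : 1 - y < segment z y by rewrite /segment; nra.
    by rewrite /X /D; apply: ltr_pM => //; rewrite subr_ge0 ltW.
  have q1 : `|X / D| < 1.
    by rewrite ger0_norm ?ltr_pdivrMr ?mul1r// divr_ge0// ltW.
  have q2 : `|X| < 1 by rewrite gtr0_norm.
  have cA : pser_cv A 1 (hyp2F1 (1 + nu) (1 + nu) a) by move=> w w1; exact: hyp2F1_gauss.
  have cB : pser_cv B 1 (hyp2F1 (1 - nu) (1 - nu) b) by move=> w w1; exact: hyp2F1_gauss.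
  have cv := tri_sum_product cA cB q1 q2.
  apply/esym/cvg_lim => //.
  rewrite (_ : (fun n => _) = EFin \o (fun n => tri_sum (fun l m => A l * (X / D) ^+ l * (B m * X ^+ m)) n * D `^ (- nu - 1))).
    by apply: cvg_EFin; [exact: nearW|apply: cvgMr_tmp; exact: cv].
  apply/funext => n; rewrite /= sumEFin; congr (_%:E).
  rewrite mulrC -tri_sumZ /tri_sum; apply: eq_bigr => k _.
  apply: eq_big_nat => l /andP[_ lk]; rewrite /h /X /D.
  have E (t : R) : 0 < segment z t -> segment z t `^ (- (l%:R + nu + 1)) =
      segment z t `^ (- nu - 1) * segment z t ^- l.
    move=> s0; rewrite -powR_invn ?ltW// -powRD ?(gt_eqF s0) ?implybT//; congr (_ `^ _); ring.
  rewrite !E// powRM ?(ltW sx) ?(ltW sy)// !exprD !exprMn exprVn exprMn invfM; ring.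
have mG k y : measurable_fun setT (G k y).
  by rewrite /G; apply: measurable_sum => l; apply: measurable_funM => //; mfun.
have G0 k y x : oo01 y -> oo01 x -> 0 <= G k y x.
  move=> yD xD; apply: sumr_ge0 => l _; apply: mulr_ge0; last exact: h0.
  by apply: mulr_ge0; [exact: mulr_ge0|exact: h0].
have I1 k y : (\int[mu]_(x in oo01) (G k y x)%:E = (\sum_(0 <= l < k.+1)
    (A l * B (k - l)%N * moment z (l + (k - l)) (l%:R + nu + 1)) * h l (k - l)%N y)%:E)%E.
  have bl l : bounded_measurable (fun x => (A l * B (k - l)%N * h l (k - l)%N y) * h l (k - l)%N x).
    have := bounded_measurable_lin (A l * B (k - l)%N * h l (k - l)%N y) (hb l (k - l)%N) bounded_measurable0.
    by congr bounded_measurable; apply/funext => t; rewrite addr0.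
  have [bs us] := unit_integral_sum (index_iota 0 k.+1) bl.
  rewrite integral_oo01 // us; congr (_%:E); apply: eq_bigr => l _.
  have := unit_integral_lin (A l * B (k - l)%N * h l (k - l)%N y) (hb l (k - l)%N) bounded_measurable0.
  rewrite unit_integral0 addr0 => e; rewrite -[RHS]mulrAC -/(h _ _ _) -e.
  by apply: eq_unit_integral => t _; rewrite /cst addr0.
pose G' k y := \sum_(0 <= l < k.+1)
    (A l * B (k - l)%N * moment z (l + (k - l)) (l%:R + nu + 1)) * h l (k - l)%N y.
have bl' k l : bounded_measurable (fun y => (A l * B (k - l)%N * moment z (l + (k - l)) (l%:R + nu + 1)) * h l (k - l)%N y).
  have := bounded_measurable_lin (A l * B (k - l)%N * moment z (l + (k - l)) (l%:R + nu + 1)) (hb l (k - l)%N) bounded_measurable0.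
  by congr bounded_measurable; apply/funext => t; rewrite addr0.
transitivity (\int[mu]_(y in oo01) (\sum_(0 <= k <oo) (G' k y)%:E))%E.
  apply: eq_integral => y; rewrite inE => yD.
  transitivity (\int[mu]_(x in oo01) (\sum_(0 <= k <oo) (G k y x)%:E))%E.
    by apply: eq_integral => x; rewrite inE => xD; exact: sumE.
  rewrite (@integral_nneseries _ _ _ mu _ _ (fun k x => (G k y x)%:E))//.
  - by apply: eq_eseriesr => k _; exact: I1.
  - by move=> k; apply/measurable_EFinP; exact: (measurable_funTS (mG k y)).
  - by move=> k x xD; rewrite lee_fin; exact: G0.
rewrite (@integral_nneseries _ _ _ mu _ _ (fun k y => (G' k y)%:E))//.
- apply: eq_eseriesr => k _; have [bs us] := unit_integral_sum (index_iota 0 k.+1) (bl' k).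
  rewrite integral_oo01// us; congr (_%:E); apply: eq_bigr => l _.
  have := unit_integral_lin (A l * B (k - l)%N * moment z (l + (k - l)) (l%:R + nu + 1)) (hb l (k - l)%N) bounded_measurable0.
  rewrite unit_integral0 addr0 expr2 mulrA => <-.
  by apply: eq_unit_integral => t _; rewrite /cst addr0.
- move=> k; have [[ms _] _] := unit_integral_sum (index_iota 0 k.+1) (bl' k).
  by apply/measurable_EFinP; exact: (measurable_funTS ms).
- move=> k y yD; rewrite lee_fin; apply: sumr_ge0 => l _.
  apply: mulr_ge0; last exact: h0.
  apply: mulr_ge0; first exact: mulr_ge0.
  rewrite -lee_fin -(integral_oo01 (hb l (k - l)%N)); apply: integral_ge0 => t tD.
  by rewrite /= lee_fin; exact: h0.
Qed.

End DoubleIntegral.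

(** * Parseval's formula for the estimator *)

Section EstimatorParseval.
Context (R : realType) (M : probability (R * R)%type R) (a b k1 z : R).
Local Notation k2 := (k1 * z).
Hypothesis lawM : gamma_law M a b k1 k2.
Hypotheses (a0 : 0 < a) (b0 : 0 < b) (k10 : 0 < k1) (z0 : 0 < z).
Let k20 : 0 < k2. Proof. by rewrite mulr_gt0. Qed.
Implicit Types (w : R * R).

Lemma gamma_law_ae_gt0 : {ae M, forall u : R * R, 0 < u.1 /\ 0 < u.2}.
Proof.
pose A : set (R * R) := [set u | 0 < u.1 /\ 0 < u.2].
have mA : measurable A.
  rewrite (_ : A = `]0%R, +oo[%classic `*` `]0%R, +oo[%classic); first exact: measurableX.
  by apply/seteqP; split => -[x y] /=; rewrite !in_itv/= !andbT.
exists (~` A); split; [exact: measurableC| |by move=> u].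
rewrite -[~` A]setIT -integral_indic//; last exact: measurableC.
rewrite (gamma_law_eq lawM (h' := cst 0%E)).
- by rewrite integral0.
- by apply/measurable_EFinP; apply: measurable_indic; exact: measurableC.
- exact: measurable_cst.
- move=> x y x0 y0; rewrite indicE memNset//; exact.
Qed.

Lemma sq_integrable_exp_lin (c : R * R) : 0 <= c.1 -> 0 <= c.2 -> sq_integrable M (exp_lin c).
Proof.
move=> c1 c2; split; first by rewrite /exp_lin; mfun.
have := gamma_law_expR lawM a0 b0 k10 k20 (addr_ge0 c1 c1) (addr_ge0 c2 c2).
rewrite (_ : (\int[M]_u (expR _)%:E)%E = (\int[M]_u (exp_lin c u ^+ 2)%:E)%E) => [->|].
  by rewrite ltry.
by apply: eq_integral => u _; rewrite /exp_lin expr2 -expRD; congr (expR _)%:E; ring.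
Qed.

Lemma exp_kernelE w u : exp_kernel a b k1 k2 w u =
  (1 - w.1) `^ (- a) * (1 - w.2) `^ (- b) *
  exp_lin (w.1 / (k1 * (1 - w.1)), w.2 / (k2 * (1 - w.2))) u.
Proof. by []. Qed.

Lemma sq_integrable_exp_kernel w : unit_square w -> sq_integrable M (exp_kernel a b k1 k2 w).
Proof.
move=> [/andP[r0 r1] /andP[s0 s1]]; apply: sq_integrableZ.
have pos (k x : R) : 0 < k -> 0 <= x -> x < 1 -> 0 <= x / (k * (1 - x)).
  by move=> k0 x0 x1; rewrite divr_ge0// mulr_ge0 ?ltW// subr_gt0.
by apply: (sq_integrable_exp_lin (c := (_, _))); exact: pos.
Qed.

Lemma exp_lin_exp_kernel (c : R * R) : 0 <= c.1 -> 0 <= c.2 ->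
  exists2 e : R * (R * R), unit_square e.2 &
    forall u, exp_lin c u = e.1 * exp_kernel a b k1 k2 e.2 u.
Proof.
case: c => s t /= s0 t0.
(* Inverse of r -> r / (k (1 - r)), which maps [0, 1[ onto the nonnegative rates; hence every
   exponential of the span is a multiple of an [exp_kernel]. *)
pose p (k x : R) := k * x / (1 + k * x).
have pP (k x : R) : 0 < k -> 0 <= x -> 0 <= p k x < 1 /\ p k x / (k * (1 - p k x)) = x.
  move=> k0 x0; have kx : 0 <= k * x by rewrite mulr_ge0// ltW.
  have kx1 : 0 < 1 + k * x by lra.
  have E : 1 - p k x = (1 + k * x)^-1 by rewrite /p; field; rewrite gt_eqF.
  split; last by rewrite E /p; field; rewrite !gt_eqF.
  by rewrite divr_ge0 ?(ltW kx1)//= ltr_pdivrMr// mul1r; lra.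
have [hs es] := pP _ _ k10 s0; have [ht et] := pP _ _ k20 t0.
exists (((1 - p k1 s) `^ (- a) * (1 - p k2 t) `^ (- b))^-1, (p k1 s, p k2 t)) => // u.
rewrite exp_kernelE es et /= mulrA mulVf ?mul1r// mulf_neq0// gt_eqF// powR_gt0//; lra.
Qed.

Lemma exp_kernel_dense f (eps : R) : sq_integrable M f -> 0 < eps ->
  exists2 r : seq (R * (R * R)), (forall c, c \in r -> unit_square c.2) &
    sqnorm M (fun u => f u - combination (exp_kernel a b k1 k2) r u) < eps.
Proof.
move=> hf eps0.
have [_ /(_ _ eps0)[p [r [+ ->]] fp]] :=
  exp_span_dense gamma_law_ae_gt0 sq_integrable_exp_lin hf.
move=> rP; suff [r' r'D r'E] : exists2 r' : seq (R * (R * R)),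
    (forall c, c \in r' -> unit_square c.2) & forall u,
    combination (exp_kernel a b k1 k2) r' u = \sum_(c <- r) c.1 * exp_lin c.2 u.
  by exists r' => //; under eq_fun do rewrite r'E.
elim: r rP {fp} => [_|c r IH rP].
  by exists [::] => // u; rewrite /combination !big_nil.
have [c1 c2] := rP c (mem_head _ _).
have [e eD eE] := exp_lin_exp_kernel c1 c2.
have [|r' r'D r'E] := IH; first by move=> c' c'r; apply: rP; rewrite inE c'r orbT.
exists ((c.1 * e.1, e.2) :: r') => [c'|u].
  by rewrite inE => /orP[/eqP -> //|]; exact: r'D.
by rewrite combination_cons r'E big_cons eE mulrA.
Qed.

Lemma ascending_coef_gt0 c n : 0 < c -> 0 < ascending_coef c n :> R.
Proof. by move=> c0; rewrite divr_gt0 ?rising_gt0// ltr0n fact_gt0. Qed.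

Lemma cvg_exp_kernel_series w w' : unit_square w -> unit_square w' ->
  tri_sum (fun l m => ascending_coef a l * ascending_coef b m *
    (monomial w l m * monomial w' l m)) n @[n --> \oo] -->
  inner M (exp_kernel a b k1 k2 w) (exp_kernel a b k1 k2 w').
Proof.
move=> wD w'D; have := integral_exp_kernelM lawM a0 b0 k10 k20 wD w'D.
rewrite /inner /Rintegral => -> /=.
case: wD w'D => [/andP[r0 r1] /andP[s0 s1]] [/andP[r'0 r'1] /andP[s'0 s'1]].
have lt1 (x y : R) : 0 <= x -> x < 1 -> 0 <= y -> y < 1 -> `|x * y| < 1.
  by move=> x0 x1 y0 y1; rewrite ger0_norm ?mulr_ge0// mulr_ilt1.
have := tri_sum_product (@pser_cv_binomial R a) (@pser_cv_binomial R b)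
  (lt1 _ _ r0 r1 r'0 r'1) (lt1 _ _ s0 s1 s'0 s'1).
apply: cvg_eq_tri_sum => l m.
by rewrite /monomial /ascending_coef !exprMn; ring.
Qed.

Variable nu : R.
Hypotheses (ab2 : 2 < a + b) (nu1 : - b < 2 * nu) (nu2 : 2 * nu < a).

Lemma sq_integrable_estimator : sq_integrable M (estimator_radial a b nu).
Proof.
split; first exact: measurable_estimator_radial.
exact: (estimator_radial_sq_lty lawM).
Qed.

(* For z = 1 the two scales k1 (1 - rho x) and k1 (1 - rho) differ because
   x < 1; for z <> 1 they differ for small rho. *)
Lemma scales_neq (x : R) : 0 < x < 1 -> exists2 del, 0 < del &
  forall rho, 0 < rho < del -> k1 * (1 - rho * x) != k2 * (1 - rho).
Proof.
move=> /andP[x0 x1]; have [z1|z1] := eqVneq z 1.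
  exists 1 => // rho /andP[r0 _]; rewrite z1 mulr1 (inj_eq (mulfI (lt0r_neq0 k10))).
  by rewrite gt_eqF//; nra.
have z1' : 0 < 1 + z by move: z0; lra.
exists (`|1 - z| / (1 + z)); first by rewrite divr_gt0// normr_gt0 subr_eq0 eq_sym.
move=> rho /andP[r0]; rewrite ltr_pdivlMr// => rz.
rewrite -mulrA; apply/eqP => /(mulfI (lt0r_neq0 k10)) E.
have e : 1 - z = rho * (x - z) by rewrite mulrBr; lra.
have h : `|x - z| < 1 + z by rewrite ltr_norml; move: z0; lra.
by move: rz; rewrite e normrM gtr0_norm// ltr_pM2l// ltNge (ltW h).
Qed.

Lemma estimator_parseval :
  tri_sum (fun l m => estimator_coef z nu k1 l m ^+ 2 /
    (ascending_coef a l * ascending_coef b m)) n @[n --> \oo] -->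
  sqnorm M (estimator_radial a b nu).
Proof.
have W0 l m : 0 < ascending_coef a l * ascending_coef b m.
  by rewrite mulr_gt0// ascending_coef_gt0.
apply: (@parseval_series _ _ _ _ _ _ _ W0 sq_integrable_exp_kernel
  cvg_exp_kernel_series _ (estimator_coef z nu k1) sq_integrable_estimator).
  by move=> eps; apply: exp_kernel_dense; exact: sq_integrable_estimator.
move=> x x01; have [del del0 hdel] := scales_neq x01; have /andP[x0 x1] := x01.
(* [del] keeps the two scales apart; the bound by 1 and [z] places the ray in the domain of
   [cvg_estimator_coef]. *)
exists (Num.min del (Num.min 1 z)); first by rewrite !lt_min del0 ltr01.
move=> rho /andP[r0]; rewrite !lt_min => /and3P[rdel r1 rz].
have rx : rho * x < rho by rewrite gtr_pMr.
have rx0 : 0 < rho * x by rewrite mulr_gt0.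
have wD : unit_square (rho * x, rho) by split; rewrite /= ltW//=; lra.
split=> //.
have kk : k1 * (1 - rho * x) != k2 * (1 - rho) by apply: hdel; rewrite r0.
rewrite /inner /Rintegral.
rewrite (integral_estimator_exp_kernel lawM a0 b0 k10 k20 ab2 nu1 nu2 wD kk) /=.
apply: cvg_estimator_coef => //; last by rewrite ltW.
by rewrite ltW//= lt_min; apply/andP; split; lra.
Qed.

End EstimatorParseval.

Lemma gamma_pair_law (R : realType) d (T : measurableType d) (P : probability T R)
    (a b k1 k2 : R) (Y1 Y2 : {RV P >-> R}) :
  0 < a -> 0 < b -> 0 < k1 -> 0 < k2 ->
  gamma_distributed a (a / k1) Y1 -> gamma_distributed b (b / k2) Y2 ->
  independent_RVs Y1 Y2 ->
  exists M : probability (R * R)%type R, gamma_law M a b k1 k2 /\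
    forall h : R * R -> \bar R, measurable_fun setT h -> (forall u, 0 <= h u)%E ->
      (\int[P]_w h (a * Y1 w, b * Y2 w)%R = \int[M]_u h u)%E.
Proof.
move=> a0 b0 k10 k20 h1 h2 ind.
have mX : measurable_fun setT (fun w => (a * Y1 w, b * Y2 w)).
  by apply: measurable_fun_pair; apply: measurable_funM.
pose X : {mfun T >-> (R * R)%type} := mfun_Sub (mem_set mX).
have E (h : R * R -> \bar R) : measurable_fun setT h -> (forall u, 0 <= h u)%E ->
    (\int[P]_w h (a * Y1 w, b * Y2 w)%R = \int[distribution P X]_u h u)%E.
  by move=> mh h0; rewrite ge0_integral_distribution.
exists (distribution P X); split=> // h mh h0.
by rewrite -E// (integral_gamma_pair a0 b0 k10 k20 h1 h2 ind).
Qed.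

Lemma eseries_tri_sum (R : realType) (A : nat -> nat -> R) (s : R) :
  tri_sum A n @[n --> \oo] --> s ->
  (\sum_(0 <= k <oo) (\sum_(0 <= l < k.+1) A l (k - l)%N)%:E = s%:E)%E.
Proof.
move=> As; apply: cvg_lim => //.
rewrite (_ : (fun n => _) = EFin \o tri_sum A); last first.
  by apply/funext => n; rewrite /= sumEFin.
by apply: cvg_EFin; [exact: nearW|].
Qed.

(** The squared ascending factor of 1 + nu divided by that of a is a Gauss coefficient with equal
    upper parameters, and likewise for 1 - nu and b; the terms thus match
    [double_integral_series]. *)
Lemma hyp2F1_estimator_coef (R : realType) (a b z nu k1 : R) l m :
  0 < a -> 0 < b -> 0 < z -> 0 < k1 ->
  estimator_coef z nu k1 l m ^+ 2 / (ascending_coef a l * ascending_coef b m) =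
  nu ^+ 2 * z `^ (2 * nu) / k1 ^+ 2 *
  (hyp2F1_coef (1 + nu) (1 + nu) a l * hyp2F1_coef (1 - nu) (1 - nu) b m *
   moment z (l + m) (l%:R + nu + 1) ^+ 2).
Proof.
move=> a0 b0 z0 k10; rewrite /estimator_coef /ascending_coef /hyp2F1_coef.
have ra := rising_neq0 l a0; have rb := rising_neq0 m b0.
have f0 n : n`!%:R != 0 :> R by rewrite pnatr_eq0 -lt0n fact_gt0.
have -> : z `^ (2 * nu) = z `^ nu ^+ 2 by rewrite mulrC powRrM powR_mulrn ?powR_ge0.
by field; rewrite ra rb !f0 gt_eqF.
Qed.

Theorem theorem9 (R : realType) (d : measure_display) (T : measurableType d)
    (P : probability T R) (alpha1 alpha2 nu kappa1 kappa2 : R)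
    (Y1 Y2 : {RV P >-> R})
    (halpha1 : 0 < alpha1) (halpha2 : 0 < alpha2)
    (halpha : 2 < alpha1 + alpha2)
    (hnu1 : - alpha2 < 2 * nu) (hnu2 : 2 * nu < alpha1)
    (hkappa1 : 0 < kappa1) (hkappa2 : 0 < kappa2)
    (hY1 : gamma_distributed alpha1 (alpha1 / kappa1) Y1)
    (hY2 : gamma_distributed alpha2 (alpha2 / kappa2) Y2)
    (hindep : independent_RVs Y1 Y2) :
  let zeta := kappa2 / kappa1 in
  let est : T -> R := fun w => estimator alpha1 alpha2 nu (Y1 w) (Y2 w) in
  let ET2 : \bar R := ('E_P[fun w => (est w ^+ 2)%R])%E in
  [/\ measurable_fun setT est,
      (ET2 < +oo)%E,
      ET2 = ((kappa1 ^- 2)%:E *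
        \sum_(0 <= k <oo)
          (\sum_(0 <= l < k.+1)
             g k l%:R zeta nu ^+ 2 /
             (poch alpha1 l%:R * poch alpha2 (k - l)%:R
              * l`!%:R * (k - l)`!%:R))%R%:E)%E
    & ET2 = ((nu ^+ 2 * zeta `^ (2 * nu) / kappa1 ^+ 2)%:E *
        \int[lebesgue_measure]_(y in `]0%R, 1%R[)
          \int[lebesgue_measure]_(x in `]0%R, 1%R[)
            (let D := (1 - (1 - zeta) * x) * (1 - (1 - zeta) * y) in
             hyp2F1 (1 + nu) (1 + nu) alpha1 ((1 - x) * (1 - y) / D) *
             hyp2F1 (1 - nu) (1 - nu) alpha2 ((1 - x) * (1 - y)) *
             D `^ (- nu - 1))%R%:E)%E].
Proof.
move=> zeta est ET2.
have z0 : 0 < zeta by rewrite divr_gt0.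
have k2E : kappa2 = kappa1 * zeta by rewrite mulrC divfK// gt_eqF.
have [M [lawM ME]] := gamma_pair_law halpha1 halpha2 hkappa1 hkappa2 hY1 hY2 hindep.
rewrite k2E in lawM.
have mF := measurable_estimator_radial alpha1 halpha2 hnu1.
pose F := estimator_radial alpha1 alpha2 nu.
(* By conversion: Z depends on the data only through [alpha2 * Y2] and [alpha1 * Y1]. *)
have estE w : est w = F (alpha1 * Y1 w, alpha2 * Y2 w) by [].
have sqF := sq_integrable_estimator lawM halpha1 halpha2 hkappa1 z0 halpha hnu1 hnu2.
have ET : ET2 = (sqnorm M F)%:E.
  rewrite EFin_sqnorm// /ET2 unlock -ME//; last by move=> u; rewrite lee_fin sqr_ge0.
  by apply/measurable_EFinP; exact: measurable_funX.
have S := estimator_parseval lawM halpha1 halpha2 hkappa1 z0 halpha hnu1 hnu2.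
clearbody ET2 zeta; split.
- rewrite (_ : est = F \o (fun w => (alpha1 * Y1 w, alpha2 * Y2 w)))//.
  by apply: (measurableT_comp mF); apply: measurable_fun_pair; apply: measurable_funM.
- by rewrite ET ltry.
- rewrite ET -(eseries_tri_sum S) -nneseriesZl//.
    apply: eq_eseriesr => k _; rewrite -EFinM mulr_sumr; congr (_%:E).
    apply: eq_big_nat => l /andP[_ lk].
    have e : (l + (k - l) = k)%N by rewrite subnKC.
    by rewrite -g_estimator_coef// e.
  move=> k _; rewrite lee_fin; apply: sumr_ge0 => l _.
  rewrite !poch_nat// divr_ge0 ?sqr_ge0//.
  by rewrite !mulr_ge0// ltW// rising_gt0.
rewrite double_integral_series// ET -(eseries_tri_sum S) -nneseriesZl//.
  apply: eq_eseriesr => k _; rewrite -EFinM mulr_sumr; congr (_%:E).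
  by apply: eq_bigr => l _; rewrite hyp2F1_estimator_coef.
move=> k _; rewrite lee_fin; apply: sumr_ge0 => l _.
apply: mulr_ge0; last exact: sqr_ge0.
by apply: mulr_ge0; exact: hyp2F1_coef_sq_ge0.
Qed.
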